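(* Let $\sigma:\mathbb{R}_+\to\mathbb{R}_+$ be a Borel function that is bounded on $[0,n]$ for each $n\ge1$ and satisfies $\lambda\{u\in\mathbb{R}_+:\sigma(u)=0\}=0$. Let $\mu$ be a finite Borel measure on $\mathbb{R}$ with $\mu(1)>0$ and let $\{X_t:t\ge0\}$ be an interacting super-Brownian motion with branching rate function $\sigma$ and $X_0=\mu$. For $a\ge0$ let $\hat\tau_a:=\inf\{t\ge0:X_t(1)=a\}$ with $\inf\emptyset=\infty$. Then for any constant $a$ satisfying $\mu(1)>a>0$, $\mathbf{P}\{\hat\tau_a<\infty\}=1$. Further, $\mathbf{P}$-a.s. $X_t(1)\to0$ as $t\to\infty$.
   Context: Notation: $\mathbb{R}_+=[0,\infty)$; $\lambda$ is Lebesgue measure. $M(\mathbb{R})$ is the space of finite Borel measures on $\mathbb{R}$ with the weak convergence topology; $\mu(f)=\int f\,d\mu$, so $X_t(1)$ is the total mass. $C^2(\mathbb{R})$ is the space of twice continuously differentiable functions bounded together with their derivatives up to order 2. All random elements are defined on a filtered complete probability space satisfying the usual hypotheses. Interacting super-Brownian motion with branching rate function $\sigma$: a continuous $M(\mathbb{R})$-valued process $\{X_t:t\ge0\}$ such that for any $f\in C^2(\mathbb{R})$, $M_t(f):=X_t(f)-X_0(f)-\frac12\int_0^tX_s(f'')ds$, $t\ge0$, is a continuous local martingale with quadratic variation $\langle M(f)\rangle_t=\int_0^tds\int_{\mathbb{R}}\sigma(X_s((-\infty,x]))f(x)^2X_s(dx)$. *)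

(* Defs.v *)
From HB Require Import structures.
From mathcomp Require Import all_boot all_order all_algebra.
From mathcomp Require Import all_classical all_reals all_analysis.

Set Implicit Arguments.
Unset Strict Implicit.
Unset Printing Implicit Defensive.

Import Order.TTheory GRing.Theory Num.Theory.
Import numFieldNormedType.Exports.

Local Open Scope classical_set_scope.
Local Open Scope ring_scope.

Section finite_borel_measures.
Variable R : realType.

(* A measure is a function on all sets, so Leibniz equality is finer than
   equality of measures, which is agreement on measurable sets. *)
Definition finmeas : Type := {finite_measure set (measurableTypeR R) -> \bar R}.

HB.instance Definition _ := gen_eqMixin finmeas.
HB.instance Definition _ := gen_choiceMixin finmeas.
HB.instance Definition _ := isPointed.Build finmeas mzero.

(* The integral is real-valued; every function integrated below is bounded
   and measurable, hence integrable. *)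
Definition mint (m : finmeas) (f : R -> R) : R := \int[m]_x f x.

Definition bcont : Type := {f : R -> R | continuous f /\ bounded_fun f}.

(* Coarsest topology making m |-> m(f) continuous for all f in C_b(R). *)
Definition finmeas_weak_topology : Type :=
  @sup_topology finmeas bcont
    (fun f => Topological.class (initial_topology (mint ^~ (sval f)))).

HB.instance Definition _ := Topological.copy finmeas finmeas_weak_topology.

Lemma cvg_finmeasP (F : set_system finmeas) (m : finmeas) : Filter F ->
  F --> m <-> forall f : R -> R, continuous f -> bounded_fun f ->
    mint m' f @[m' --> F] --> mint m f.
Proof.
move=> FF; split=> [Fm f cf bf|Fm].
  move: Fm => /cvg_sup/(_ (exist _ f (conj cf bf))) Fm.
  exact: (cvg_trans (cvg_app _ Fm) (@initial_continuous _ _ (mint ^~ f) m)).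
apply/cvg_sup => -[f [cf bf]] A /=; rewrite (@nbhsE (initial_topology (mint ^~ f))).
move=> -[B [[C oC <-] Cm] BA].
rewrite nbhs_filterE; apply: filterS BA _.
by apply: (Fm f cf bf); exact: open_nbhs_nbhs.
Qed.

Definition finmeas_display : measure_display.
Proof. by constructor. Qed.

Definition finmeas_borel : set_system finmeas := <<s open >>.

Let finmeas_borel0 : finmeas_borel set0.
Proof. exact: sigma_algebra0. Qed.

Let finmeas_borelC (U : set finmeas) : finmeas_borel U -> finmeas_borel (~` U).
Proof. exact: sigma_algebraC. Qed.

Let finmeas_borelU (U : (set finmeas)^nat) :
  (forall i, finmeas_borel (U i)) -> finmeas_borel (\bigcup_i U i).
Proof. exact: sigma_algebra_bigcup. Qed.

HB.instance Definition _ := @isMeasurable.Build finmeas_display finmeas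
  finmeas_borel finmeas_borel0 finmeas_borelC finmeas_borelU.

End finite_borel_measures.

(* Time runs through [0, +oo[: processes and filtrations are indexed by R, but
   their values at negative times are never used. *)

Section stochastic_processes.
Context {R : realType} {d : measure_display} {Omega : measurableType d}.
Variables (P : probability Omega R) (F : R -> set (set Omega)).

Record usual_conditions : Prop := UsualConditions {
  uc_complete : measure_is_complete P;
  uc_sigma_algebra : forall t : R, 0 <= t -> sigma_algebra setT (F t);
  uc_measurable : forall t : R, 0 <= t -> F t `<=` measurable;
  uc_filtration : forall s t : R, 0 <= s -> s <= t -> F s `<=` F t;
  uc_right_continuous :
    forall t : R, 0 <= t -> \bigcap_(u in `]t, +oo[) F u `<=` F t;
  uc_null_sets : P.-negligible `<=` F 0 }.

Definition adapted {d'} {T : measurableType d'} (X : R -> Omega -> T) : Prop :=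
  forall t : R, 0 <= t -> forall B, measurable B -> F t (X t @^-1` B).

Definition continuous_paths {T : topologicalType} (X : R -> Omega -> T) : Prop :=
  forall w, {within `[0, +oo[, continuous (X ^~ w)}.

(* Z is a version of E[Y | G]; to be used with Y integrable. *)
Definition is_cond_exp (G : set (set Omega)) (Y Z : Omega -> R) : Prop :=
  [/\ forall B : set R, measurable B -> G (Z @^-1` B),
      P.-integrable setT (EFin \o Z) &
      forall A, G A ->
        (\int[P]_(w in A) (Z w)%:E = \int[P]_(w in A) (Y w)%:E)%E].

Definition martingale (N : R -> Omega -> R) : Prop :=
  [/\ adapted N,
      forall t : R, 0 <= t -> P.-integrable setT (EFin \o N t) &
      forall s t : R, 0 <= s -> s <= t -> is_cond_exp (F s) (N t) (N s)].

Definition stopping_time (tau : Omega -> \bar R) : Prop :=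
  (forall w, (0 <= tau w)%E) /\
  forall t : R, 0 <= t -> F t [set w | (tau w <= t%:E)%E].

Definition stopped (N : R -> Omega -> R) (tau : Omega -> \bar R) :
  R -> Omega -> R := fun t w => N (fine (Order.min t%:E (tau w))) w.

Definition local_martingale (N : R -> Omega -> R) : Prop :=
  adapted N /\
  exists tau : nat -> Omega -> \bar R,
    [/\ forall n, stopping_time (tau n),
        {ae P, forall w, nondecreasing_seq (tau ^~ w)},
        {ae P, forall w, tau n w @[n --> \oo] --> +oo%E} &
        forall n, martingale (stopped N (tau n))].

Definition continuous_local_martingale (N : R -> Omega -> R) : Prop :=
  local_martingale N /\ continuous_paths N.

(* A is the quadratic variation <N> of the continuous local martingale N: the
   (unique up to indistinguishability) continuous adapted nondecreasing process
   started at 0 such that N^2 - A is a local martingale.  Meant for N_0 = 0. *)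
Definition quadratic_variation (N A : R -> Omega -> R) : Prop :=
  [/\ adapted A,
      continuous_paths A,
      forall w, A 0 w = 0,
      forall w (s t : R), 0 <= s -> s <= t -> A s w <= A t w &
      local_martingale (fun t w => N t w ^+ 2 - A t w)].

End stochastic_processes.

Definition C2 {R : realType} (f : R -> R) : Prop :=
  [/\ forall x, derivable f x 1,
      forall x, derivable (derive1 f) x 1,
      continuous (derive1 (derive1 f)) &
      [/\ bounded_fun f, bounded_fun (derive1 f) & bounded_fun (derive1 (derive1 f))]].

Section interacting_super_brownian_motion.
Context {R : realType} {d : measure_display} {Omega : measurableType d}.
Implicit Types (X : R -> Omega -> finmeas R) (f : R -> R).

Definition ISBM_M X f (t : R) (w : Omega) : R :=
  mint (X t w) f - mint (X 0 w) f
  - 2^-1 * \int[lebesgue_measure]_(s in `[0, t]) mint (X s w) (derive1 (derive1 f)).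

Definition ISBM_QV (sigma : R -> R) X f (t : R) (w : Omega) : R :=
  \int[lebesgue_measure]_(s in `[0, t])
    mint (X s w) (fun x => sigma (fine (X s w `]-oo, x]%classic)) * f x ^+ 2).

Record interacting_SBM (P : probability Omega R) (F : R -> set (set Omega))
    (sigma : R -> R) X : Prop := InteractingSBM {
  isbm_adapted : adapted F X;
  isbm_continuous : continuous_paths X;
  isbm_martingale :
    forall f, C2 f -> continuous_local_martingale P F (ISBM_M X f);
  isbm_quadratic_variation :
    forall f, C2 f -> quadratic_variation P F (ISBM_M X f) (ISBM_QV sigma X f) }.

(* inf {t >= 0 : X_t(1) = a}, with ereal_inf set0 = +oo. *)
Definition mass_hitting_time X (a : R) (w : Omega) : \bar R :=
  ereal_inf [set t%:E | t in [set t : R | 0 <= t /\ mint (X t w) (cst 1) = a]].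

End interacting_super_brownian_motion.

(* Main.v *)
Require Import Defs.
From mathcomp Require Import all_boot all_order all_algebra.
From mathcomp Require Import all_classical all_reals all_analysis.
From mathcomp Require Import unstable measurable_realfun.
From mathcomp Require Import ring lra.

(** Why the mass dies out.  Write Y_s = X_s(1).  Testing against the constant
    function 1 shows that M = Y - Y_0 is a continuous local martingale, whose
    bracket A grows at the speed r(X_s), where r(m) is the integral of
    sigma(m((-oo, x])) against m(dx).

    Suppose that m has no atoms.  The image of m under its distribution function
    is then at most Lebesgue measure ([distfun_preimage_le]).  As sigma vanishes
    only on a null set, the values u in [0, b] with sigma(u) < eta form a set of
    small measure when eta is small; hence r is at least some kappa > 0 on all
    atomless measures with mass in [a, b] ([brate_lower_bound]).  If X_s has no
    atoms for almost every s, it follows for the exit time tau of Y from [a, b],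
    cut at an arbitrary horizon, that
    kappa E(tau) <= E(A_tau) = E(M_tau^2) <= b^2 ([expected_time]).  So Y leaves
    the band; it reaches b with probability at most Y_0 / b, and letting b grow
    shows that Y comes below every a > 0 almost surely ([never_low0]).  After
    being below a, the mass reaches eps with probability at most a / eps
    ([rebound_prob]); letting a tend to 0 gives Y -> 0 ([mass_vanishes]), and the
    intermediate value theorem gives the hitting of each level below Y_0.

    Atoms have to be excluded because the distribution function jumps at them,
    possibly onto a zero of sigma, so that r may vanish at a nonzero measure.  Let f
    be x |-> cos(kx) or x |-> sin(kx).  Then f'' = -k^2 f, and Z = X(f) satisfies
    Z_t = Z_0 + M_t - (k^2/2) \int_0^t Z_s ds for the local martingale M = M(f).
    Up to a stopping time tau before which Y <= b, one has
    (k^2/2) E \int_0^tau Z_s^2 ds <= C with C independent of k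
    ([energy_bound]): M_tau - M_s is orthogonal to Z_s, while
    \int_0^tau Z_s (M_tau - M_s) ds is an elementary integral because Z is the
    derivative of its primitive ([energy_pathwise]).  Summing over k, the Fourier
    coefficients of X_s tend to 0 for almost every s ([ae_atomless]), and the
    Fejer kernel bounds the mass of each atom by a Cesaro mean of Fourier
    coefficients ([fourier_no_atom]).

    Optional stopping ([local_martingale_stopping]) is proved for stopping times
    that are bounded and up to which the process is bounded.  The stopping time
    is rounded up to a grid, where the martingale property applies piece by piece;
    truncating the stopped values makes the passage to finer grids a dominated
    convergence ([sampling_clamp]). *)

Set Implicit Arguments.
Unset Strict Implicit.
Unset Printing Implicit Defensive.

Import Order.TTheory GRing.Theory Num.Theory.
Import numFieldNormedType.Exports.

Local Open Scope classical_set_scope.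
Local Open Scope ring_scope.

(** * Integrals of real functions against a finite measure *)

Section real_integrals.
Context {d} {T : measurableType d} {R : realType}.
Variable P : {finite_measure set T -> \bar R}.
Implicit Types (f g : T -> R) (D : set T).

Definition L1 f := P.-integrable setT (EFin \o f).
Definition E f : R := \int[P]_w f w.

Lemma L1_measurable f : L1 f -> measurable_fun setT f.
Proof. by move=> /integrableP[/measurable_EFinP]. Qed.

Lemma L1_bounded (K : R) f : measurable_fun setT f -> (forall w, `|f w| <= K) -> L1 f.
Proof.
move=> mf fK; apply: measurable_bounded_integrable => //.
  by rewrite ltey_eq fin_num_measure.
exists K; split; first exact: num_real.
by move=> M KM w _; exact: (le_trans (fK w) (ltW KM)).
Qed.

Lemma L1_cst (c : R) : L1 (fun=> c).
Proof. by apply: (@L1_bounded `|c|). Qed.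

Lemma L1D f g : L1 f -> L1 g -> L1 (fun w => f w + g w).
Proof. by move=> If Ig; exact: (integrableD measurableT If Ig). Qed.

Lemma L1B f g : L1 f -> L1 g -> L1 (fun w => f w - g w).
Proof. by move=> If Ig; exact: (integrableB measurableT If Ig). Qed.

Lemma L1Z c f : L1 f -> L1 (fun w => c * f w).
Proof.
move=> ?; rewrite /L1 (_ : _ \o _ = fun w => (c%:E * (EFin \o f) w)%E).
  exact: integrableZl.
by apply/funext => w /=; rewrite EFinM.
Qed.

Lemma L1_norm f : L1 f -> L1 (fun w => `|f w|).
Proof. by move=> ?; exact: integrable_norm. Qed.

Lemma L1M (K : R) f g : measurable_fun setT f -> (forall w, `|f w| <= K) -> L1 g ->
  L1 (fun w => f w * g w).
Proof.
move=> mf fK ig; rewrite /L1 (_ : _ \o _ = (EFin \o f) \* (EFin \o g))%E.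
  apply: integrableMr => //; exists K; split; first exact: num_real.
  by move=> M KM w _; exact: (le_trans (fK w) (ltW KM)).
by apply/funext => w /=; rewrite EFinM.
Qed.

Lemma L1_indicM D g : measurable D -> L1 g -> L1 (fun w => \1_D w * g w).
Proof.
move=> mD; apply: (@L1M 1); first exact: measurable_indic.
by move=> w; rewrite indicE; case: (_ \in _); rewrite ?normr1 ?normr0.
Qed.

Lemma L1_indic D : measurable D -> L1 (\1_D).
Proof.
move=> mD; have := L1_indicM mD (L1_cst 1).
by rewrite (_ : (fun w => _) = \1_D)//; apply/funext => w; rewrite mulr1.
Qed.

Lemma L1_sum (I : Type) (s : seq I) (h : I -> T -> R) : (forall i, L1 (h i)) ->
  L1 (fun w => \sum_(i <- s) h i w).
Proof.
move=> ih; elim: s => [|a s IH].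
  by under eq_fun do rewrite big_nil; exact: L1_cst.
by under eq_fun do rewrite big_cons; exact: L1D.
Qed.

Lemma L1_le f g : measurable_fun setT f -> L1 g -> (forall w, `|f w| <= `|g w|) -> L1 f.
Proof.
move=> mf ig fg; apply: (le_integrable measurableT _ _ ig).
  exact/measurable_EFinP.
by move=> w _ /=; rewrite lee_fin.
Qed.

Lemma ED f g : L1 f -> L1 g -> E (fun w => f w + g w) = E f + E g.
Proof. by move=> ? ?; exact: RintegralD. Qed.

Lemma EB f g : L1 f -> L1 g -> E (fun w => f w - g w) = E f - E g.
Proof. by move=> ? ?; exact: RintegralB. Qed.

Lemma EZ c f : L1 f -> E (fun w => c * f w) = c * E f.
Proof. by move=> ?; exact: RintegralZl. Qed.

Lemma E_cst c : E (fun=> c) = c * fine (P setT).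
Proof. by rewrite /E Rintegral_cst. Qed.

Lemma E0 : E (fun=> 0) = 0.
Proof. by rewrite E_cst mul0r. Qed.

Lemma E_indicM D f : E (fun w => \1_D w * f w) = \int[P]_(w in D) f w.
Proof.
rewrite /E [RHS]Rintegral_mkcond; apply: eq_Rintegral => w _.
by rewrite patchE indicE; case: (_ \in _); rewrite ?mul1r ?mul0r.
Qed.

Lemma E_le f g : L1 f -> L1 g -> (forall w, f w <= g w) -> E f <= E g.
Proof. by move=> ? ? fg; apply: le_Rintegral. Qed.

Lemma E_le_ae f g : L1 f -> L1 g -> {ae P, forall w, f w <= g w} -> E f <= E g.
Proof.
move=> If Ig [N [mN N0 fgN]].
(* Both integrals may be restricted to the complement of the exceptional set,
   where the comparison holds everywhere. *)
have EN h : L1 h -> E h = E (fun w => \1_(~` N) w * h w).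
  move=> Ih; rewrite E_indicM /E /Rintegral.
  by rewrite (negligible_integral mN measurableT Ih N0) setTD.
rewrite (EN f)// (EN g)//; apply: E_le; try (apply: L1_indicM => //; exact: measurableC).
move=> w; rewrite indicE; case: (boolP (_ \in _)); rewrite ?mul0r// inE !mul1r => wN.
by apply: contrapT => nfg; apply: wN; apply: fgN.
Qed.

Lemma E_ge0 f : (forall w, 0 <= f w) -> 0 <= E f.
Proof. by move=> f0; exact: Rintegral_ge0. Qed.

Lemma E_sum (I : Type) (s : seq I) (h : I -> T -> R) : (forall i, L1 (h i)) ->
  E (fun w => \sum_(i <- s) h i w) = \sum_(i <- s) E (h i).
Proof.
move=> ih; elim: s => [|a s IH].
  by under eq_fun do rewrite big_nil; rewrite big_nil E0.
under eq_fun do rewrite big_cons.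
by rewrite big_cons ED// ?IH//; exact: L1_sum.
Qed.

Lemma E_indic D : measurable D -> (E (\1_D))%:E = P D.
Proof.
move=> mD; rewrite /E /Rintegral fineK.
  by rewrite integral_indic// setIT.
by rewrite integral_indic// setIT fin_num_measure.
Qed.

Lemma EFin_E f : L1 f -> (E f)%:E = (\int[P]_w (f w)%:E)%E.
Proof. by move=> If; rewrite /E /Rintegral fineK// integrable_fin_num. Qed.

Lemma E_dominated_cvg (h : nat -> T -> R) f g : (forall n, measurable_fun setT (h n)) ->
  measurable_fun setT f -> L1 g ->
  {ae P, forall w, h ^~ w @ \oo --> f w} -> (forall n w, `|h n w| <= g w) ->
  E (h n) @[n --> \oo] --> E f.
Proof.
move=> mh mf ig hf hg.
have := @dominated_convergence _ _ _ P setT measurableT (fun n => EFin \o h n)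
  (EFin \o f) (EFin \o g).
case=> //.
- by move=> n; exact/measurable_EFinP.
- exact/measurable_EFinP.
- by apply: filterS hf => w hw _; apply/cvg_EFin; [exact: nearW|exact: hw].
- by apply: aeW => w n _; rewrite lee_fin.
move=> If _ cv; apply: fine_cvg; rewrite EFin_E//; exact: cv.
Qed.

End real_integrals.

Lemma E_prob_cst d (T : measurableType d) (R : realType) (P : probability T R) (c : R) :
  E P (fun=> c) = c.
Proof.
rewrite E_cst; rewrite [X in fine X](_ : _ = 1%E) ?mulr1//; exact: probability_setT.
Qed.

(** * Continuous paths on the half-line *)

Section paths.
Context {R : realType}.

Lemma near_harmonic_lt (e : R) : 0 < e -> \forall n \near \oo, n.+1%:R^-1 < e.
Proof.
move=> e0; have := @cvg_harmonic R => /cvgrPdist_lt /(_ _ e0); apply: filterS => n.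
by rewrite sub0r normrN ger0_norm /harmonic /= ?invr_ge0.
Qed.

Lemma continuous_maxr0 : continuous (fun s : R => Num.max s 0).
Proof.
move=> x; apply: (@continuous_max R R (fun s => s) (fun=> 0) x).
  exact: cvg_id.
exact: cvg_cst.
Qed.

(** Freezing a path at its initial value for negative times turns continuity
    within [0, +oo[ into continuity on the whole line, to which the theory of
    continuous functions and of primitives applies directly. *)
Lemma continuous_maxl {T : topologicalType} (f : R -> T) :
  {within `[0, +oo[, continuous f} -> continuous (fun s : R => f (Num.max s 0)).
Proof.
move=> cf x.
have h : Num.max x 0 \in `[0, +oo[%classic by rewrite inE /= in_itv /= le_max lexx orbT.
have c := cf (Num.max x 0).
have {}c : f y @[y --> within `[0,+oo[%classic (nbhs (Num.max x 0))] --> f (Num.max x 0).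
  by move: c; rewrite /continuous_at nbhs_subspace_in//; exact: set_mem.
apply: (cvg_trans _ c) => A /= wA.
have : \forall y \near nbhs (Num.max x 0), `[0,+oo[%classic y -> A (f y) by exact: wA.
move/continuous_maxr0 => hn.
change (nbhs x (fun s : R => A (f (Num.max s 0)))).
apply: (@filterS _ (nbhs x) _ _ _ _ hn) => y /= hy; apply: hy.
by rewrite /= in_itv/= le_max lexx orbT.
Qed.

(** Hitting times give bounds that hold strictly before a time; continuity
    carries them over to that time. *)
Lemma continuous_le_at (f : R -> R) (K rho : R) : continuous f -> 0 < rho ->
  (forall s, 0 <= s -> s < rho -> f s <= K) -> f rho <= K.
Proof.
move=> cf r0 fK; apply/ler_addgt0Pr => e e0.
have /cvgrPdist_lt /(_ _ e0) [d /= d0 h] := cf rho.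
pose s := Num.max 0 (rho - d / 2).
have sr : s < rho by rewrite gt_max r0/= ltrBlDr ltrDl divr_gt0.
have s0 : 0 <= s by rewrite le_max lexx.
have : `|f rho - f s| < e.
  apply: h => /=; rewrite ger0_norm ?subr_ge0 1?ltW//.
  have : rho - d / 2 <= s by rewrite le_max lexx orbT.
  by move: d0; lra.
by rewrite ltr_norml => /andP[_]; move: (fK s s0 sr); lra.
Qed.

End paths.

(** * Measurability with respect to a sigma-algebra of events *)

Section sigma_algebras.
Context {d} {T : measurableType d} {R : realType}.
Implicit Types (G : set (set T)) (f : T -> R).

(** The sigma-algebras of a filtration are sets of events on one and the same
    sample space, so measurability is phrased through preimages. *)
Definition measurable_wrt G f : Prop :=
  forall B : set R, measurable B -> G (f @^-1` B).

(** The bridge to the type carrying [G] as its measurable sets, from which the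
    closure properties below are inherited. *)
Lemma measurable_wrtP G f : sigma_algebra setT G ->
  measurable_wrt G f <-> measurable_fun setT (f : g_sigma_algebraType G -> R).
Proof.
move=> sG; split.
  move=> mf _ B mB; rewrite setTI.
  by rewrite /measurable/= /g_sigma_algebraType /= sigma_algebra_id //; exact: mf.
move=> mf B mB; have := mf measurableT B mB; rewrite setTI.
by rewrite /measurable/= sigma_algebra_id.
Qed.

Lemma measurable_wrt_fun G f : G `<=` measurable -> measurable_wrt G f ->
  measurable_fun setT f.
Proof. by move=> GT mf _ B mB; rewrite setTI; apply: GT; exact: mf. Qed.

Section closure.
Variable G : set (set T).
Hypothesis sG : sigma_algebra setT G.

Lemma salg_setT : G setT.
Proof. by case: sG => G0 GC _; have := GC _ G0; rewrite setD0. Qed.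

Lemma salg_set0 : G set0.
Proof. by case: sG. Qed.

Lemma salg_setC A : G A -> G (~` A).
Proof. by case: sG => _ + _ => /[apply]; rewrite setTD. Qed.

Lemma salg_bigcup (A : nat -> set T) : (forall n, G (A n)) -> G (\bigcup_n A n).
Proof. by case: sG => _ _; exact. Qed.

Lemma salg_bigcap (A : nat -> set T) : (forall n, G (A n)) -> G (\bigcap_n A n).
Proof.
move=> GA; rewrite -(setCK (\bigcap_n A n)) setC_bigcap.
by apply: salg_setC; apply: salg_bigcup => n; exact: salg_setC.
Qed.

Lemma salg_setU A B : G A -> G B -> G (A `|` B).
Proof.
by move=> GA GB; rewrite -bigcup2E; apply: salg_bigcup => -[|[|n]] //=; exact: salg_set0.
Qed.

Lemma salg_setI A B : G A -> G B -> G (A `&` B).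
Proof.
move=> GA GB; rewrite -(setCK (A `&` B)) setCI.
by apply: salg_setC; apply: salg_setU; exact: salg_setC.
Qed.

Lemma salg_setD A B : G A -> G B -> G (A `\` B).
Proof. by move=> GA GB; rewrite setDE; apply: salg_setI => //; exact: salg_setC. Qed.

Lemma measurable_wrt_cst c : measurable_wrt G (fun=> c).
Proof. by apply/measurable_wrtP => //; exact: measurable_cst. Qed.

Lemma measurable_wrtD f g : measurable_wrt G f -> measurable_wrt G g ->
  measurable_wrt G (fun w => f w + g w).
Proof.
move=> /(measurable_wrtP _ sG) mf /(measurable_wrtP _ sG) mg.
by apply/measurable_wrtP => //; exact: measurable_funD.
Qed.

Lemma measurable_wrtB f g : measurable_wrt G f -> measurable_wrt G g ->
  measurable_wrt G (fun w => f w - g w).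
Proof.
move=> /(measurable_wrtP _ sG) mf /(measurable_wrtP _ sG) mg.
by apply/measurable_wrtP => //; exact: measurable_funB.
Qed.

Lemma measurable_wrtN f : measurable_wrt G f -> measurable_wrt G (fun w => - f w).
Proof.
move=> /(measurable_wrtP _ sG) mf.
by apply/measurable_wrtP => //; exact: measurable_funN.
Qed.

Lemma measurable_wrt_indicM A f : G A -> measurable_wrt G f ->
  measurable_wrt G (fun w => \1_A w * f w).
Proof.
move=> GA /(measurable_wrtP _ sG) mf; apply/measurable_wrtP => //.
apply: measurable_funM => //; apply: measurable_indic.
by rewrite /measurable /= sigma_algebra_id.
Qed.

Lemma measurable_wrt_cvg (h : nat -> T -> R) f : (forall n, measurable_wrt G (h n)) ->
  (forall w, h ^~ w @ \oo --> f w) -> measurable_wrt G f.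
Proof.
move=> mh hf; apply/measurable_wrtP => //.
apply: (@measurable_fun_cvg _ _ R setT (h : nat -> g_sigma_algebraType G -> R)) => //.
by move=> n; apply/measurable_wrtP.
Qed.

End closure.
End sigma_algebras.

(** * Rounding up to a grid of [0, t] *)

Section grid.
Context {R : realType}.

Definition grid_index (t : R) (n : nat) (r : R) : nat := `|Num.ceil (r * n.+1%:R / t)|%N.
Definition grid_point (t : R) (n k : nat) : R := t * k%:R / n.+1%:R.

(** The Galois connection defining rounding up.  It reduces every event about
    [grid_index] to events of the form [r <= grid_point t n k], which is what a
    stopping time provides. *)
Lemma grid_index_le t n r k : 0 <= r <= t -> (grid_index t n r <= k)%N = (r <= grid_point t n k).
Proof.
move=> /andP[r0 rt]; rewrite /grid_index /grid_point.
have [t0|t0] := ltP 0 t; last first.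
  have t00 : t = 0 by apply: le_anti; rewrite t0 (le_trans r0 rt).
  by rewrite t00 invr0 mulr0 ceil0 /= leq0n !mul0r -t00 rt.
have c0 : 0 <= Num.ceil (r * n.+1%:R / t).
  by rewrite ceil_ge0 (lt_le_trans (ltrN10 _))// divr_ge0 ?mulr_ge0// ltW.
rewrite -lez_nat gez0_abs// ceil_le_int ler_pdivrMr// ler_pdivlMr//.
by rewrite [t * _]mulrC.
Qed.

Lemma grid_index_bound t n r : 0 <= r <= t -> (grid_index t n r <= n.+1)%N.
Proof.
by move=> /[dup] /andP[r0 rt] rrt; rewrite grid_index_le// /grid_point mulfK.
Qed.

Lemma grid_point_ge0 t n k : 0 <= t -> 0 <= grid_point t n k.
Proof. by move=> t0; rewrite /grid_point divr_ge0// mulr_ge0. Qed.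

Lemma grid_point_le t n k : 0 <= t -> (k <= n.+1)%N -> grid_point t n k <= t.
Proof. by move=> t0 kn; rewrite /grid_point ler_pdivrMr// ler_wpM2l// ler_nat. Qed.

Lemma grid_point_mono t n k k' : 0 <= t -> (k <= k')%N -> grid_point t n k <= grid_point t n k'.
Proof.
move=> t0 kk; rewrite /grid_point ler_pM2r ?invr_gt0//.
by rewrite ler_wpM2l// ler_nat.
Qed.

Definition grid_ceil t n r : R := grid_point t n (grid_index t n r).

Lemma grid_ceil_ge t n r : 0 <= r <= t -> r <= grid_ceil t n r.
Proof. by move=> rt; rewrite -grid_index_le. Qed.

Lemma grid_ceil_le t n r : 0 <= r <= t -> grid_ceil t n r <= r + t / n.+1%:R.
Proof.
move=> rt; rewrite /grid_ceil; case E : (grid_index t n r) => [|k].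
  rewrite /grid_point mulr0 mul0r; case/andP: rt => r0 rt.
  by rewrite addr_ge0// divr_ge0// (le_trans r0 rt).
have : ~~ (grid_index t n r <= k)%N by rewrite E ltnn.
rewrite grid_index_le// -ltNge /grid_point => h.
by rewrite -natr1 mulrDr mulr1 mulrDl lerD2r ltW.
Qed.

Lemma grid_ceil_cvg t r : 0 <= r <= t -> grid_ceil t n r @[n --> \oo] --> r.
Proof.
move=> rt; apply: (@squeeze_cvgr _ _ _ _ (fun=> r) (fun n => r + t / n.+1%:R)).
- by apply: nearW => n; rewrite grid_ceil_ge// grid_ceil_le.
- exact: cvg_cst.
rewrite -[X in _ --> X]addr0; apply: cvgD; first exact: cvg_cst.
rewrite -[X in _ --> X](mulr0 t); apply: cvgM; first exact: cvg_cst.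
exact: cvg_harmonic.
Qed.

End grid.

(** * Bounded stopping times *)

Section grid_levels.
Context {R : realType} {d : measure_display} {T : measurableType d}.
Variables (t : R) (r : T -> R).
Hypothesis rt : forall w, 0 <= r w <= t.

Lemma grid_index_level (G : set (set T)) n k : sigma_algebra setT G ->
  (forall j, (j <= k)%N -> G [set w | r w <= grid_point t n j]) ->
  G [set w | grid_index t n (r w) = k].
Proof.
move=> sG Gr; have {}Gr j : (j <= k)%N -> G [set w | (grid_index t n (r w) <= j)%N].
  move=> jk; rewrite (_ : [set _ | _] = [set w | r w <= grid_point t n j]); first exact: Gr.
  by apply/seteqP; split => w /=; rewrite grid_index_le.
case: k Gr => [|k] Gr.
  rewrite (_ : [set _ | _] = [set w | (grid_index t n (r w) <= 0)%N]); first exact: Gr.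
  by apply/seteqP; split => w /=; rewrite leqn0 => /eqP.
rewrite (_ : [set _ | _] = [set w | (grid_index t n (r w) <= k.+1)%N] `\`
    [set w | (grid_index t n (r w) <= k)%N]).
  by apply: (salg_setD sG); exact: Gr.
apply/seteqP; split => w /=; first by move=> ->; rewrite leqnn ltnn.
by move=> [h1 /negP]; rewrite -ltnNge => h2; apply/eqP; rewrite eqn_leq h1.
Qed.

(** Writing a function of a rounded time as a finite sum over the grid reduces
    stopped values to values at deterministic times. *)
Lemma grid_index_sum (g : nat -> R) n w :
  g (grid_index t n (r w)) = \sum_(k < n.+2) \1_[set w | grid_index t n (r w) = k] w * g k.
Proof.
have h : (grid_index t n (r w) < n.+2)%N by rewrite ltnS grid_index_bound.
rewrite (bigD1 (Ordinal h))//= big1 ?addr0; first by rewrite indicE mem_set// mul1r.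
move=> i ih; rewrite indicE memNset ?mul0r// => /= e.
by move/negP: ih; apply; apply/eqP/val_inj; rewrite /= e.
Qed.

End grid_levels.

Section stopping.
Context {R : realType} {d : measure_display} {Omega : measurableType d}.
Variables (P : probability Omega R) (F : R -> set (set Omega)).
Hypothesis hF : usual_conditions P F.
Implicit Types (N Z : R -> Omega -> R) (rho : Omega -> R) (s t u l c : R) (w : Omega).

Let sF (t : R) : 0 <= t -> sigma_algebra setT (F t) := uc_sigma_algebra hF (t:=t).
Let mF (t : R) : 0 <= t -> F t `<=` measurable := uc_measurable hF (t:=t).
Let FS (s t : R) : 0 <= s -> s <= t -> F s `<=` F t := uc_filtration hF (s:=s) (t:=t).

(** The form of path continuity given by [continuous_maxl]. *)
Definition cpaths N := forall w, continuous (fun s : R => N (Num.max s 0) w).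

Lemma cpaths_cvg N w (x : nat -> R) l : cpaths N -> (forall n, 0 <= x n) -> 0 <= l ->
  x @ \oo --> l -> N (x n) w @[n --> \oo] --> N l w.
Proof.
move=> cN u0 l0 ul.
have := cvg_comp _ _ ul (cN w l).
rewrite /comp/= (max_idPl l0) => h.
apply: cvg_trans h; apply: near_eq_cvg; apply: nearW => n.
by rewrite (max_idPl (u0 n)).
Qed.

Definition bstop (t : R) rho := (forall w, 0 <= rho w <= t) /\
  forall u, 0 <= u -> F u [set w | rho w <= u].

Lemma bstop_cst t c : 0 <= c -> c <= t -> bstop t (fun=> c).
Proof.
move=> c0 ct; split=> [w|u u0]; first by rewrite c0.
case: (leP c u) => cu.
  by rewrite (_ : [set _ | _] = setT); [exact: salg_setT (sF u0)|apply/seteqP; split => // w].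
rewrite (_ : [set _ | _] = set0); first exact: salg_set0 (sF u0).
by apply/seteqP; split => // w /=.
Qed.

Lemma bstop_min t t' rho rho' : bstop t rho -> bstop t' rho' ->
  bstop (Num.min t t') (fun w => Num.min (rho w) (rho' w)).
Proof.
move=> [rt mr] [rt' mr']; split=> [w|u u0].
  have := rt w; have := rt' w => /andP[? ?] /andP[? ?].
  by rewrite !le_min; do ! (apply/andP; split => //);
    rewrite ge_min; apply/orP; [left|right].
rewrite (_ : [set _ | _] = [set w | rho w <= u] `|` [set w | rho' w <= u]).
  by apply: salg_setU (sF u0) _ _ _ _; [exact: mr|exact: mr'].
by apply/seteqP; split => w /=; rewrite ge_min => /orP.
Qed.

Lemma bstopW t t' rho : t <= t' -> bstop t rho -> bstop t' rho.
Proof.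
move=> tt [rt mr]; split => // w; have /andP[-> h] := rt w.
by rewrite (le_trans h tt).
Qed.

Lemma bstop_grid_index t rho n k : 0 <= t -> bstop t rho ->
  F (grid_point t n k) [set w | grid_index t n (rho w) = k].
Proof.
move=> t0 [rt mr]; apply: (grid_index_level rt (sF (grid_point_ge0 n k t0))) => j jk.
by apply: (FS (grid_point_ge0 n j t0)) (mr _ (grid_point_ge0 n j t0)); exact: grid_point_mono.
Qed.

Lemma bstop_wrt t rho : 0 <= t -> bstop t rho -> measurable_wrt (F t) rho.
Proof.
move=> t0 rs; have [rt mr] := rs.
apply: (measurable_wrt_cvg (sF t0) (h := fun n w => grid_ceil t n (rho w))); last first.
  by move=> w; exact: grid_ceil_cvg.
move=> n B mB.
rewrite (_ : _ @^-1` B = \bigcup_k ([set w | grid_index t n (rho w) = k] `&`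
    [set w | B (grid_point t n k) /\ (k <= n.+1)%N])).
  apply: salg_bigcup (sF t0) _ _ => k.
  have [[Bk kn]|h] := pselect (B (grid_point t n k) /\ (k <= n.+1)%N); last first.
    rewrite (_ : _ `&` _ = set0); first exact: salg_set0 (sF t0).
    by apply/seteqP; split => // w [].
  apply: salg_setI (sF t0) _ _ _ _.
    by apply: (FS (grid_point_ge0 n k t0) (grid_point_le t0 kn)); exact: bstop_grid_index.
  by rewrite (_ : [set _ | _] = setT); [exact: salg_setT (sF t0)|apply/seteqP; split => // w].
apply/seteqP; split => w /=.
  by move=> Bw; exists (grid_index t n (rho w)) => //; split => //=; split => //; exact: grid_index_bound.
by case=> k _ [/= <- []].
Qed.

Lemma stopped_grid_wrt N t rho n : 0 <= t -> bstop t rho -> adapted F N ->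
  measurable_wrt (F t) (fun w => N (grid_ceil t n (rho w)) w).
Proof.
move=> t0 rs aN B mB; have [rt mr] := rs.
rewrite (_ : _ @^-1` B = \bigcup_k (if (k <= n.+1)%N then
    [set w | grid_index t n (rho w) = k] `&` N (grid_point t n k) @^-1` B else set0)).
  apply: salg_bigcup (sF t0) _ _ => k; case: ifPn => [kn|_]; last exact: salg_set0 (sF t0).
  apply: (FS (grid_point_ge0 n k t0) (grid_point_le t0 kn)).
  apply: salg_setI (sF (grid_point_ge0 n k t0)) _ _ _ _; first exact: bstop_grid_index.
  exact: aN (grid_point_ge0 n k t0) _ mB.
apply/seteqP; split => w /=.
  by move=> Bw; exists (grid_index t n (rho w)) => //; rewrite grid_index_bound//; split.
by case=> k _; case: ifPn => // kn [/= <-].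
Qed.

(** A stopped value is the limit of the values at the times rounded up to finer
    and finer grids, by continuity of the paths. *)
Lemma stopped_wrt N t rho : 0 <= t -> bstop t rho -> adapted F N -> cpaths N ->
  measurable_wrt (F t) (fun w => N (rho w) w).
Proof.
move=> t0 rs aN cN; have [rt _] := rs.
apply: (measurable_wrt_cvg (sF t0) (h := fun n w => N (grid_ceil t n (rho w)) w)).
  by move=> n; exact: stopped_grid_wrt.
move=> w; have /andP[r0 _] := rt w.
apply: cpaths_cvg => //; last exact: grid_ceil_cvg.
by move=> n; rewrite (le_trans r0)// grid_ceil_ge.
Qed.

Lemma stopped_measurable N t rho : 0 <= t -> bstop t rho -> adapted F N -> cpaths N ->
  measurable_fun setT (fun w => N (rho w) w).
Proof. by move=> t0 rs aN cN; apply: measurable_wrt_fun (mF t0) _; exact: stopped_wrt. Qed.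

(** Stopping at [min s rho] uses information up to [s] only, so the stopped
    process is again adapted; its paths are again continuous. *)
Lemma stopped_min_adapted N t rho : bstop t rho -> adapted F N -> cpaths N ->
  adapted F (fun s w => N (Num.min s (rho w)) w).
Proof.
move=> rs aN cN s s0.
suff : measurable_wrt (F s) (fun w => N (Num.min s (rho w)) w) by exact.
apply: stopped_wrt => //.
have t0 : (0 <= t) by have [/(_ point)/andP[h1 h2] _] := rs; rewrite (le_trans h1 h2).
by apply: bstopW (bstop_min (bstop_cst s0 (lexx s)) rs); rewrite ge_min lexx.
Qed.

Lemma stopped_min_cpaths N t rho : bstop t rho -> cpaths N ->
  cpaths (fun s w => N (Num.min s (rho w)) w).
Proof.
move=> [rt _] cN w x.
have /andP[r0 _] := rt w.
have -> : (fun s => N (Num.min (Num.max s 0) (rho w)) w) =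
    (fun s => N (Num.max s 0) w) \o (fun s => Num.min s (rho w)).
  apply/funext => s /=; congr (N _ _).
  by rewrite max_minl (max_idPl r0).
apply: continuous_comp; last exact: cN.
apply: (@continuous_min R R (fun s => s) (fun=> rho w) x); first exact: cvg_id.
exact: cvg_cst.
Qed.

End stopping.

(** * Optional stopping *)

Section optional_stopping.
Context {R : realType} {d : measure_display} {Omega : measurableType d}.
Variables (P : probability Omega R) (F : R -> set (set Omega)).
Hypothesis hF : usual_conditions P F.
Implicit Types (N Z : R -> Omega -> R) (rho : Omega -> R) (s t u l c : R) (w : Omega).

Let sF (t : R) : 0 <= t -> sigma_algebra setT (F t) := uc_sigma_algebra hF (t:=t).
Let mF (t : R) : 0 <= t -> F t `<=` measurable := uc_measurable hF (t:=t).

Local Notation E := (E P).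
Local Notation L1 := (L1 P).

Lemma martingale_E N s t A : martingale P F N -> 0 <= s -> s <= t -> F s A ->
  E (fun w => \1_A w * N s w) = E (fun w => \1_A w * N t w).
Proof.
move=> [_ _ ce] s0 st FA; rewrite !E_indicM.
by have [_ _ /(_ _ FA)] := ce s t s0 st; rewrite /Rintegral => ->.
Qed.

Lemma stopped_gridE N t rho n w : 0 <= t -> bstop F t rho ->
  N (grid_ceil t n (rho w)) w =
  \sum_(k < n.+2) \1_[set w | grid_index t n (rho w) = k] w * N (grid_point t n k) w.
Proof.
by move=> t0 [rt _]; exact: (grid_index_sum rt (fun k => N (grid_point t n k) w)).
Qed.

Lemma L1_stopped_grid N t rho n : 0 <= t -> bstop F t rho -> martingale P F N ->
  L1 (fun w => N (grid_ceil t n (rho w)) w).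
Proof.
move=> t0 rs [_ iN _].
under eq_fun do rewrite (stopped_gridE _ _ _ t0 rs).
apply: L1_sum => k; apply: L1_indicM; last by apply: iN; exact: grid_point_ge0.
by apply: (mF (grid_point_ge0 n k t0)); exact: bstop_grid_index hF _ _ _ _ _ _.
Qed.

(** On each event [D] that is known, on every piece where the rounded time takes
    the value [k], at the [k]-th grid point, the martingale property applies
    piece by piece.  Allowing an event [D] rather than the whole space is what
    makes the tail estimate [sampling_clamp] possible. *)
Lemma sampling_grid N t rho n D : 0 <= t -> bstop F t rho -> martingale P F N ->
  measurable D ->
  (forall k, F (grid_point t n k) (D `&` [set w | grid_index t n (rho w) = k])) ->
  E (fun w => \1_D w * N (grid_ceil t n (rho w)) w) = E (fun w => \1_D w * N t w).
Proof.
move=> t0 rs mN mD FD; have [rt _] := rs; have [_ iN _] := mN.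
have mA k : measurable [set w | grid_index t n (rho w) = k].
  by apply: (mF (grid_point_ge0 n k t0)); exact: bstop_grid_index hF _ _ _ _ _ _.
have indI k w : \1_D w * \1_[set w | grid_index t n (rho w) = k] w =
    \1_(D `&` [set w | grid_index t n (rho w) = k]) w :> R.
  by rewrite indicI.
transitivity (E (fun w => \sum_(k < n.+2)
    \1_(D `&` [set w | grid_index t n (rho w) = k]) w * N (grid_point t n k) w)).
  congr E; apply/funext => w; rewrite (stopped_gridE _ _ _ t0 rs) mulr_sumr.
  by apply: eq_bigr => k _; rewrite mulrA indI.
transitivity (E (fun w => \sum_(k < n.+2)
    \1_(D `&` [set w | grid_index t n (rho w) = k]) w * N t w)); last first.
  congr E; apply/funext => w.
  have := @stopped_gridE (fun=> N t) t rho n w t0 rs => /= {2}->.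
  by rewrite mulr_sumr; apply: eq_bigr => k _; rewrite mulrA indI.
have mDA (k : nat) : measurable (D `&` [set w | grid_index t n (rho w) = k]).
  exact: measurableI.
rewrite !E_sum.
- apply: eq_bigr => k _; apply: martingale_E => //; first exact: grid_point_ge0.
  by apply: grid_point_le => //; rewrite -ltnS.
- by move=> k; apply: L1_indicM => //; exact: iN.
- by move=> k; apply: L1_indicM => //; apply: iN; exact: grid_point_ge0.
Qed.

Definition clamp (L x : R) : R := Num.max (- L) (Num.min x L).

Lemma clamp_bound L x : 0 <= L -> `|clamp L x| <= L.
Proof.
move=> L0; rewrite /clamp ler_norml le_max lexx /= ge_max ge_min lexx orbT andbT.
by move: L0; lra.
Qed.

Lemma clamp_id L x : `|x| <= L -> clamp L x = x.
Proof.
by rewrite ler_norml /clamp => /andP[h1 h2]; rewrite (min_idPl h2) (max_idPr h1).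
Qed.

Lemma clamp_cont L : continuous (clamp L).
Proof.
move=> x; apply: (@continuous_max R R (fun=> - L) (fun x => Num.min x L) x).
  exact: cvg_cst.
apply: (@continuous_min R R (fun x => x) (fun=> L) x); first exact: cvg_id.
exact: cvg_cst.
Qed.

Lemma clampE L x : 0 <= L ->
  x - clamp L x = (L < x)%R%:R * (x - L) + (x < - L)%R%:R * (x + L).
Proof.
move=> L0; rewrite /clamp.
have [Lx|] := boolP (L < x).
  rewrite (min_idPr (ltW Lx)) (max_idPr _); last by move: L0; lra.
  rewrite (_ : (x < - L) = false) ?mul1r ?mul0r ?addr0//.
  by apply/negbTE; rewrite -leNgt; move: L0 Lx; lra.
rewrite -leNgt => Lx; rewrite (min_idPl Lx) mul0r add0r.
have [xL|] := boolP (x < - L); first by rewrite (max_idPl (ltW xL)) opprK mul1r.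
by rewrite -leNgt => xL; rewrite (max_idPr xL) subrr mul0r.
Qed.

(** Truncating the stopped value changes its expectation only on the events
    where it exceeds [L] or is below [- L].  These events belong to the stopped
    past, so on them the stopped value may be replaced by [N t].  The resulting
    error does not depend on the grid: this plays the part of uniform
    integrability when the grid is refined. *)
Lemma sampling_clamp N t rho n L : 0 <= t -> 0 <= L -> bstop F t rho -> martingale P F N ->
  `|E (N t) - E (fun w => clamp L (N (grid_ceil t n (rho w)) w))| <=
  E (fun w => Num.max (`|N t w| - L) 0).
Proof.
move=> t0 L0 rs mN; have [rt _] := rs; have [aN iN _] := mN.
set V := fun w => N (grid_ceil t n (rho w)) w.
have iV : L1 V by exact: L1_stopped_grid.
have iNt : L1 (N t) by exact: iN.
have EV : E (N t) = E V.
  have := @sampling_grid N t rho n setT t0 rs mN measurableT.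
  rewrite (_ : (fun w => \1_setT w * N t w) = N t); last first.
    by apply/funext => w; rewrite indicT mul1r.
  rewrite (_ : (fun w => \1_setT w * _) = V); last first.
    by apply/funext => w; rewrite indicT mul1r.
  by move=> -> // k; rewrite setTI; exact: bstop_grid_index hF _ _ _ _ _ _.
pose D1 := [set w | V w > L]; pose D2 := [set w | V w < - L].
have mV : measurable_fun setT V by exact: L1_measurable iV.
have D1E : D1 = V @^-1` `]L, +oo[.
  by apply/seteqP; split => w; rewrite /D1 /= in_itv/= andbT.
have D2E : D2 = V @^-1` `]-oo, - L[.
  by apply/seteqP; split => w; rewrite /D2 /= in_itv/=.
have mD1 : measurable D1.
  by rewrite D1E -[X in measurable X]setTI; apply: mV => //; exact: measurable_itv.
have mD2 : measurable D2.
  by rewrite D2E -[X in measurable X]setTI; apply: mV => //; exact: measurable_itv.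
have FD (B : set R) k : measurable B ->
    F (grid_point t n k) (V @^-1` B `&` [set w | grid_index t n (rho w) = k]).
  move=> mB; rewrite (_ : _ `&` _ = N (grid_point t n k) @^-1` B `&` [set w | grid_index t n (rho w) = k]).
    apply: salg_setI (sF (grid_point_ge0 n k t0)) _ _ _ _; last exact: bstop_grid_index hF _ _ _ _ _ _.
    exact: aN (grid_point_ge0 n k t0) _ mB.
  by apply/seteqP; split => w [/= + e]; rewrite /V /grid_ceil e.
(* The tail events are decided at the rounded stopping time. *)
have S1 : E (fun w => \1_D1 w * V w) = E (fun w => \1_D1 w * N t w).
  by apply: sampling_grid => // k; rewrite D1E; apply: FD; exact: measurable_itv.
have S2 : E (fun w => \1_D2 w * V w) = E (fun w => \1_D2 w * N t w).
  by apply: sampling_grid => // k; rewrite D2E; apply: FD; exact: measurable_itv.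
have mcl : measurable_fun setT (clamp L).
  exact: continuous_measurable_fun (clamp_cont (L:=L)).
have icl : L1 (fun w => clamp L (V w)).
  apply: (@L1_bounded _ _ _ _ L); first exact: measurableT_comp.
  by move=> w; exact: clamp_bound.
have iI A f : measurable A -> L1 f -> L1 (fun w => \1_A w * f w).
  by move=> mA If; exact: L1_indicM.
have j1 := iI _ _ mD1 (L1B iV (L1_cst P L)).
have j2 := iI _ _ mD2 (L1D iV (L1_cst P L)).
have j1' := iI _ _ mD1 (L1B iNt (L1_cst P L)).
have j2' := iI _ _ mD2 (L1D iNt (L1_cst P L)).
have key : E V - E (fun w => clamp L (V w)) =
    E (fun w => \1_D1 w * (V w - L)) + E (fun w => \1_D2 w * (V w + L)).
  rewrite -EB// -ED//; congr E; apply/funext => w; rewrite clampE//.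
  have -> : \1_D1 w = (L < V w)%R%:R :> R.
    by rewrite indicE; congr (nat_of_bool _)%:R; apply/idP/idP; rewrite inE.
  have -> // : \1_D2 w = (V w < - L)%R%:R :> R.
    by rewrite indicE; congr (nat_of_bool _)%:R; apply/idP/idP; rewrite inE.
have K1 : E (fun w => \1_D1 w * (V w - L)) = E (fun w => \1_D1 w * (N t w - L)).
  have c1 := iI _ _ mD1 (L1_cst P L).
  under eq_fun do rewrite mulrBr; under [in RHS]eq_fun do rewrite mulrBr.
  by rewrite (EB (iI _ _ mD1 iV) c1) (EB (iI _ _ mD1 iNt) c1) S1.
have K2 : E (fun w => \1_D2 w * (V w + L)) = E (fun w => \1_D2 w * (N t w + L)).
  have c2 := iI _ _ mD2 (L1_cst P L).
  under eq_fun do rewrite mulrDr; under [in RHS]eq_fun do rewrite mulrDr.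
  by rewrite (ED (iI _ _ mD2 iV) c2) (ED (iI _ _ mD2 iNt) c2) S2.
have im : L1 (fun w => Num.max (`|N t w| - L) 0).
  have mNt := L1_measurable iNt.
  apply: L1_le iNt _.
    apply: measurable_maxr => //; apply: measurable_funB => //.
    exact: measurableT_comp.
  move=> w; rewrite ger0_norm ?le_max ?lexx ?orbT// ge_max normr_ge0 andbT.
  by move: L0; lra.
have m0 w : 0 <= Num.max (`|N t w| - L) 0 by rewrite le_max lexx orbT.
have m1 w : N t w - L <= Num.max (`|N t w| - L) 0.
  by rewrite le_max lerD2r ler_norm.
have m2 w : - (N t w + L) <= Num.max (`|N t w| - L) 0.
  by rewrite le_max opprD lerD2r -normrN ler_norm.
have P1 : 0 <= E (fun w => \1_D1 w * (V w - L)).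
  apply: E_ge0 => w; rewrite indicE; case: (boolP (_ \in _)); rewrite ?mul0r// inE /D1 /= mul1r.
  by move=> h; rewrite subr_ge0 ltW.
have P2 : E (fun w => \1_D2 w * (V w + L)) <= 0.
  rewrite -(E0 P); apply: E_le => //; first exact: L1_cst.
  move=> w; rewrite indicE; case: (boolP (_ \in _)); rewrite ?mul0r// inE /D2 /= mul1r.
  by lra.
have Q1 : E (fun w => \1_D1 w * (V w - L)) <= E (fun w => Num.max (`|N t w| - L) 0).
  rewrite K1; apply: E_le => // w.
  by rewrite indicE; case: (_ \in _); rewrite ?mul1r ?mul0r.
have Q2 : - E (fun w => Num.max (`|N t w| - L) 0) <= E (fun w => \1_D2 w * (V w + L)).
  rewrite K2 -mulN1r -EZ//; apply: E_le => //; first exact: L1Z.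
  move=> w; rewrite mulN1r indicE; case: (_ \in _); rewrite ?mul1r ?mul0r.
    by rewrite lerNl.
  by rewrite oppr_le0.
by rewrite EV key ler_norml; apply/andP; split; lra.
Qed.

(** Refining the grid in [sampling_clamp] is dominated convergence, thanks to
    the truncation; then the truncation error vanishes as [L] grows.  The bound
    on the stopped value ensures that a high truncation does not affect the
    limit. *)
Lemma martingale_stopping N t rho K : 0 <= t -> bstop F t rho -> martingale P F N -> cpaths N ->
  (forall w, `|N (rho w) w| <= K) ->
  E (fun w => N (rho w) w) = E (N t).
Proof.
move=> t0 rs mN cN NK; have [rt _] := rs; have [aN iN _] := mN.
have mr := stopped_measurable hF t0 rs aN cN.
have iNt : L1 (N t) := iN _ t0.
have H L : 0 <= L -> K <= L -> `|E (N t) - E (fun w => N (rho w) w)| <=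
    E (fun w => Num.max (`|N t w| - L) 0).
  move=> L0 KL.
  have cv : E (fun w => clamp L (N (grid_ceil t n (rho w)) w)) @[n --> \oo] -->
      E (fun w => N (rho w) w).
    apply: (@E_dominated_cvg _ _ _ P _ _ (fun=> L)).
    - move=> n; apply: measurableT_comp.
        exact: continuous_measurable_fun (clamp_cont (L:=L)).
      exact: L1_measurable (L1_stopped_grid _ t0 rs mN).
    - exact: mr.
    - exact: L1_cst.
    - apply: aeW => w; have /andP[r0 _] := rt w.
      rewrite -[X in _ --> X](clamp_id (le_trans (NK w) KL)).
      have cvN : N (grid_ceil t n (rho w)) w @[n --> \oo] --> N (rho w) w.
        apply: cpaths_cvg => //; last exact: grid_ceil_cvg.
        by move=> n; rewrite (le_trans r0)// grid_ceil_ge.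
      have h := cvg_comp _ _ cvN (@clamp_cont L (N (rho w) w)).
      exact: h.
    - by move=> n w; exact: clamp_bound.
  have cv2 : `|E (N t) - E (fun w => clamp L (N (grid_ceil t n (rho w)) w))| @[n --> \oo] -->
      `|E (N t) - E (fun w => N (rho w) w)|.
    by apply: cvg_norm; apply: cvgB => //; exact: cvg_cst.
  apply: (cvgr_to_le cv2); apply: nearW => n.
  exact: sampling_clamp.
have cv0 : E (fun w => Num.max (`|N t w| - n%:R) 0) @[n --> \oo] --> E (fun=> 0 : R).
  apply: (@E_dominated_cvg _ _ _ P _ _ (fun w => `|N t w|)).
  - move=> n; apply: measurable_maxr => //; apply: measurable_funB => //.
    by apply: measurableT_comp => //; exact: L1_measurable iNt.
  - exact: measurable_cst.
  - exact: L1_norm.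
  - apply: aeW => w; apply: (@cvg_near_cst _ _ _ _ _).
    near=> n; apply/max_idPr; rewrite subr_le0.
    by near: n; exact: nbhs_infty_ger.
  - move=> n w; rewrite ger0_norm ?le_max ?lexx ?orbT// ge_max normr_ge0 andbT.
    by rewrite lerBlDr lerDl.
rewrite E0 in cv0.
apply/esym/eqP; rewrite -subr_eq0 -normr_le0.
apply: (cvgr_to_ge cv0); near=> n; apply: H => //.
by near: n; exact: nbhs_infty_ger.
Unshelve. all: by end_near. Qed.

Lemma stopped_cpaths N (tau : Omega -> \bar R) : (forall w, (0 <= tau w)%E) ->
  cpaths N -> cpaths (stopped N tau).
Proof.
move=> tau0 cN w; rewrite /stopped.
case E : (tau w) (tau0 w) => [r| |] //.
  rewrite lee_fin => r0.
  rewrite (_ : (fun s => _) = (fun s => N (Num.min (Num.max s 0) r) w)); last first.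
    by apply/funext => s; rewrite -EFin_min.
  have rs : bstop F r (fun=> r).
    by apply: bstop_cst hF _ _ _ _.
  exact: (stopped_min_cpaths rs cN).
move=> _; rewrite (_ : (fun s => _) = (fun s => N (Num.max s 0) w)); first exact: cN.
by apply/funext => s; rewrite minEle leey.
Qed.

Lemma stopped_time (tau : \bar R) r : (0 <= tau)%E -> 0 <= r ->
  0 <= fine (Order.min r%:E tau) <= r.
Proof.
move=> t0 r0; case: tau t0 => [a| |] //.
  by rewrite lee_fin => a0; rewrite -EFin_min /= le_min r0 a0 ge_min lexx.
by move=> _; rewrite minEle leey /= r0 lexx.
Qed.

(** The bound up to [rho] holds for all the localized martingales at once, so
    dominated convergence removes the localization. *)
Lemma local_martingale_stopping N t rho K : 0 <= t -> bstop F t rho ->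
  local_martingale P F N -> cpaths N ->
  (forall w s, 0 <= s -> s <= rho w -> `|N s w| <= K) ->
  E (fun w => N (rho w) w) = E (N 0).
Proof.
move=> t0 rs [aN [tau [st _ tauoo mS]]] cN NK; have [rt _] := rs.
have tau0 n w : (0 <= tau n w)%E by have [] := st n.
have r0 w : 0 <= rho w by have /andP[] := rt w.
pose S n := stopped N (tau n).
have cS n : cpaths (S n) by apply: stopped_cpaths => // w; exact: tau0.
have S0 n : S n 0 = N 0.
  by apply/funext => w; rewrite /S /stopped minEle tau0.
have ES n : E (fun w => S n (rho w) w) = E (N 0).
  rewrite (martingale_stopping t0 rs (mS n) (cS n) (K := K)); last first.
    by move=> w; have /andP[h1 h2] := stopped_time (tau0 n w) (r0 w); exact: NK.
  rewrite -(S0 n).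
  rewrite -(martingale_stopping t0 (bstop_cst hF (lexx 0) t0) (mS n) (cS n) (K := K))//.
  move=> w /=; have -> : stopped N (tau n) 0 w = N 0 w by exact: (congr1 (@^~ w) (S0 n)).
  exact: NK.
have mN : measurable_fun setT (fun w => N (rho w) w) by exact: (stopped_measurable hF t0).
have cv : E (fun w => S n (rho w) w) @[n --> \oo] --> E (fun w => N (rho w) w).
  apply: (@E_dominated_cvg _ _ _ P _ _ (fun=> K)).
  - move=> n; have [aS _ _] := mS n.
    exact: (stopped_measurable hF t0 rs aS (cS n)).
  - exact: mN.
  - exact: L1_cst.
  - apply: filterS tauoo => w hw; apply: cvg_near_cst.
    have : \forall n \near \oo, ((rho w)%:E < tau n w)%E.
      apply: (hw [set x | ((rho w)%:E < x)%E]).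
      by exists (rho w); split => //; exact: num_real.
    apply: filterS => n hn; rewrite /S /stopped minEle ltW//.
  - move=> n w; have /andP[h1 h2] := stopped_time (tau0 n w) (r0 w).
    exact: NK.
apply: (cvg_unique (@Rhausdorff R) cv).
rewrite (_ : (fun n => _) = fun=> E (N 0)); first exact: cvg_cst.
by apply/funext => n; exact: ES.
Qed.

End optional_stopping.

(** * Orthogonality of increments to the past *)

Section orthogonality.
Context {R : realType} {d : measure_display} {Omega : measurableType d}.
Variables (P : probability Omega R) (F : R -> set (set Omega)).
Hypothesis hF : usual_conditions P F.
Implicit Types (N Z : R -> Omega -> R) (rho tau : Omega -> R) (s t u l c : R) (w : Omega).

Let sF (t : R) : 0 <= t -> sigma_algebra setT (F t) := uc_sigma_algebra hF (t:=t).
Let mF (t : R) : 0 <= t -> F t `<=` measurable := uc_measurable hF (t:=t).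
Let FS (s t : R) : 0 <= s -> s <= t -> F s `<=` F t := uc_filtration hF (s:=s) (t:=t).

Local Notation E := (E P).
Local Notation L1 := (L1 P).

(** Continuing until [tau] on an event [B] of time [s], and stopping at time [s]
    otherwise, is a stopping rule: [B] is known when the choice is made. *)
Lemma bstop_switch t s tau B : 0 <= s -> s <= t -> bstop F t tau -> F s B ->
  bstop F t (fun w => if w \in B then tau w else Num.min s (tau w)).
Proof.
move=> s0 st [rt mr] FB; split=> [w|u u0].
  have /andP[h1 h2] := rt w; case: ifP => _; first by rewrite h1 h2.
  by rewrite le_min s0 h1 /= ge_min st.
have [su|us] := leP s u.
  rewrite (_ : [set _ | _] = (~` B) `|` [set w | tau w <= u]).
    apply: salg_setU (sF u0) _ _ _ _; last exact: mr.
    by apply: salg_setC (sF u0) _ _; exact: FS FB.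
  apply/seteqP; split => w /=.
    by case: ifP => [_ ?|/negbT]; [right|rewrite notin_setE; left].
  case: ifPn => [|_ _]; last by rewrite ge_min su.
  by rewrite inE => Bw [].
rewrite (_ : [set _ | _] = [set w | tau w <= u]); first exact: mr.
apply/seteqP; split => w /=; case: ifP => // _; rewrite ge_min.
  by move=> /orP[|//]; rewrite leNgt us.
by move=> ->; rewrite orbT.
Qed.

Section increments.
Variables (N : R -> Omega -> R) (t K s : R) (tau : Omega -> R).
Hypotheses (s0 : 0 <= s) (st : s <= t) (rs : bstop F t tau).
Hypotheses (lN : local_martingale P F N) (cN : cpaths N).
Hypothesis NK : forall w u, 0 <= u -> u <= tau w -> `|N u w| <= K.

Let t0 : 0 <= t. Proof. exact: le_trans s0 st. Qed.
Let D w := N (tau w) w - N (Num.min s (tau w)) w.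
Let tau0 w : 0 <= tau w. Proof. by have [/(_ w)/andP[]] := rs. Qed.
Let rmin : bstop F t (fun w => Num.min s (tau w)).
Proof. by apply: bstopW (bstop_min hF (bstop_cst hF s0 (lexx s)) rs); rewrite ge_min st. Qed.
Let aN : adapted F N. Proof. by case: lN. Qed.
Let m1 : measurable_fun setT (fun w => N (tau w) w).
Proof. exact: (stopped_measurable hF t0). Qed.
Let m2 : measurable_fun setT (fun w => N (Num.min s (tau w)) w).
Proof. exact: (stopped_measurable hF t0). Qed.
Let b1 w : `|N (tau w) w| <= K. Proof. exact: NK. Qed.
Let b2 w : `|N (Num.min s (tau w)) w| <= K.
Proof. by apply: NK; rewrite ?le_min ?s0 ?tau0// ge_min lexx orbT. Qed.
Let i1 : L1 (fun w => N (tau w) w). Proof. exact: L1_bounded m1 b1. Qed.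
Let i2 : L1 (fun w => N (Num.min s (tau w)) w). Proof. exact: L1_bounded m2 b2. Qed.
Let iD : L1 D. Proof. exact: L1B. Qed.

(** Optional stopping at the switched time and at [min s tau] gives the same
    expectation, and the two stopped values differ by the increment on [B]. *)
Lemma increment_indic B : F s B -> E (fun w => \1_B w * D w) = 0.
Proof.
move=> FB; have mB : measurable B by exact: mF FB.
have := local_martingale_stopping hF t0 (bstop_switch s0 st rs FB) lN cN (K := K).
have -> : (fun w => N (if w \in B then tau w else Num.min s (tau w)) w) =
    (fun w => \1_B w * D w + N (Num.min s (tau w)) w).
  apply/funext => w; rewrite indicE /D; case: ifP => _.
    by rewrite mul1r subrK.
  by rewrite mul0r add0r.
rewrite ED//; last exact: L1_indicM.
rewrite (local_martingale_stopping hF t0 rmin lN cN (K := K)); last first.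
  by move=> w u u0; rewrite le_min => /andP[_]; exact: NK.
move=> h; have {}h := h _; apply: (@addIr _ (E (N 0))); rewrite add0r; apply: h.
move=> w u u0; case: ifP => _; first exact: NK.
by rewrite le_min => /andP[_]; exact: NK.
Qed.

(** By linearity the indicators of [increment_indic] may be replaced by simple
    functions, and a bounded [xi] is a uniform limit of such functions: shift
    it into [0, 2 C] and round it up to a grid of values. *)
Lemma increment_orth xi C : measurable_wrt (F s) xi -> (forall w, `|xi w| <= C) ->
  E (fun w => xi w * D w) = 0.
Proof.
move=> mxi xC; pose r w := xi w + C; pose T := C + C.
have r0T w : 0 <= r w <= T.
  by have := xC w; rewrite ler_norml /r /T => /andP[h1 h2]; rewrite lerD2r h2 andbT; move: h1; lra.
have mr : measurable_wrt (F s) r.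
  by apply: measurable_wrtD => //; [exact: sF|apply: measurable_wrt_cst; exact: sF].
have T0 : 0 <= T by have /andP[h1 h2] := r0T point; exact: le_trans h1 h2.
have FA n k : F s [set w | grid_index T n (r w) = k].
  apply: (grid_index_level r0T (sF s0)) => j _.
  rewrite (_ : [set _ | _] = r @^-1` `]-oo, grid_point T n j]); first exact: mr.
  by apply/seteqP; split => w /=; rewrite in_itv.
have mA n k : measurable [set w | grid_index T n (r w) = k] by exact: mF (FA n k).
have rE n w := grid_index_sum r0T (grid_point T n) n w.
have En n : E (fun w => grid_ceil T n (r w) * D w) = 0.
  transitivity (E (fun w => \sum_(k < n.+2)
      grid_point T n k * (\1_[set w | grid_index T n (r w) = k] w * D w))).
    congr E; apply/funext => w; rewrite /grid_ceil rE mulr_suml.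
    by apply: eq_bigr => k _; rewrite [_ * grid_point _ _ _]mulrC mulrA.
  rewrite E_sum; last by move=> k; apply: L1Z; exact: L1_indicM.
  by rewrite big1// => k _; rewrite EZ ?increment_indic ?mulr0//; exact: L1_indicM.
have mrm := measurable_wrt_fun (mF s0) mr.
have mD : measurable_fun setT D by exact: L1_measurable iD.
have mg n : measurable_fun setT (fun w => grid_ceil T n (r w)).
  rewrite /grid_ceil; under eq_fun do rewrite rE.
  by apply: measurable_sum => k; apply: measurable_funM => //; exact: measurable_indic.
have cv : E (fun w => grid_ceil T n (r w) * D w) @[n --> \oo] --> E (fun w => r w * D w).
  apply: (@E_dominated_cvg _ _ _ P _ _ (fun w => T * `|D w|)).
  - by move=> n; exact: measurable_funM.
  - exact: measurable_funM.
  - by apply: L1Z; exact: L1_norm.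
  - apply: aeW => w; apply: cvgM; last exact: cvg_cst.
    exact: grid_ceil_cvg.
  - move=> n w; rewrite normrM ler_wpM2r//.
    rewrite ger0_norm ?grid_point_ge0// grid_point_le// grid_index_bound//.
have E0 : E (fun w => r w * D w) = 0.
  apply: (cvg_unique (@Rhausdorff R) cv).
  rewrite (_ : (fun n => _) = fun=> 0); first exact: cvg_cst.
  by apply/funext => n; exact: En.
have EC : E (fun w => C * D w) = 0.
  rewrite EZ//; have := increment_indic (salg_setT (sF s0)).
  rewrite (_ : (fun w => \1_setT w * D w) = D); first by move=> ->; rewrite mulr0.
  by apply/funext => w; rewrite indicT mul1r.
have -> : (fun w => xi w * D w) = (fun w => r w * D w - C * D w).
  by apply/funext => w; rewrite -mulrBl /r addrK.
rewrite EB ?E0 ?EC ?subr0//; last exact: L1Z.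
by apply: (@L1M _ _ _ _ T) => // w; have /andP[h1 h2] := r0T w; rewrite ger0_norm.
Qed.

End increments.
End orthogonality.

(** * Hitting times of closed half-lines *)

Section hitting.
Context {R : realType} {d : measure_display} {Omega : measurableType d}.
Variables (P : probability Omega R) (F : R -> set (set Omega)).
Hypothesis hF : usual_conditions P F.
Implicit Types (N Z : R -> Omega -> R) (s t u l c b : R) (w : Omega).

Let sF (t : R) : 0 <= t -> sigma_algebra setT (F t) := uc_sigma_algebra hF (t:=t).
Let FS (s t : R) : 0 <= s -> s <= t -> F s `<=` F t := uc_filtration hF (s:=s) (t:=t).

Definition reaches Z b t w : Prop := exists s, [/\ 0 <= s, s <= t & b <= Z s w].

(** Capped at the horizon [t], so as to be a bounded stopping time. *)
Definition hit Z b t w : R := inf ([set s | [/\ 0 <= s, s <= t & b <= Z s w]] `|` [set t]).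

Section props.
Variables (Z : R -> Omega -> R) (b t : R) (w : Omega).
Hypotheses (t0 : 0 <= t) (cZ : cpaths Z).

Let S := [set s | [/\ 0 <= s, s <= t & b <= Z s w]] `|` [set t].

Let hasinf : has_inf S.
Proof. by split; [exists t; right|exists 0 => s [[]//|->]]. Qed.

Lemma hit_itv : 0 <= hit Z b t w <= t.
Proof.
apply/andP; split; last by apply: ge_inf; [case: hasinf|right].
by apply: lb_le_inf; [exists t; right|move=> s [[]//|->]].
Qed.

Lemma hit_lt s : 0 <= s -> s < hit Z b t w -> Z s w < b.
Proof.
move=> s0 sh; rewrite ltNge; apply/negP => bZ.
have : hit Z b t w <= s.
  apply: ge_inf; first by case: hasinf.
  left; split => //; have /andP[_ ht] := hit_itv.
  exact: (le_trans (ltW sh) ht).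
by rewrite leNgt sh.
Qed.

Lemma hit_le s : 0 <= s -> s <= t -> b <= Z s w -> hit Z b t w <= s.
Proof. by move=> s0 st bZ; apply: ge_inf; [case: hasinf|left]. Qed.

(** The set of times at which a continuous path is at or above [b] is closed. *)
Lemma hit_at : reaches Z b t w -> b <= Z (hit Z b t w) w.
Proof.
move=> [s1 [s10 s1t bs1]]; rewrite leNgt; apply/negP => Zb.
set h := hit Z b t w in Zb.
have /andP[h0 ht] := hit_itv; rewrite -/h in h0 ht.
have e0 : 0 < b - Z h w by rewrite subr_gt0.
have := @cZ w h; move/cvgrPdist_lt => /(_ _ e0) [e /= ep near_h].
have [s Ss sh] := inf_adherent ep hasinf.
have [s' [s'0 s't bs' s'h]] : exists s', [/\ 0 <= s', s' <= t, b <= Z s' w & s' < h + e].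
  case: Ss => [[? ? ?]|st]; first by exists s; split.
  by exists s1; split => //; apply: le_lt_trans s1t _; rewrite -st.
have hs' : h <= s' by exact: hit_le.
have := near_h s'; rewrite /ball_ /= ler0_norm ?subr_le0// opprB (max_idPl h0) (max_idPl s'0).
have -> : s' - h < e by rewrite ltrBlDl.
by move=> /(_ isT); rewrite ltr_norml => /andP[+ _]; lra.
Qed.

Lemma hit_lt_reaches : hit Z b t w < t -> reaches Z b t w.
Proof.
move=> ht; have e0 : 0 < t - hit Z b t w by rewrite subr_gt0.
have [s Ss sh] := inf_adherent e0 hasinf.
move: sh; rewrite -/(hit Z b t w) addrC subrK => st.
by case: Ss => [[? ? ?]|e]; [exists s; split|move: st; rewrite e ltxx].
Qed.

End props.

(** By continuity the level is reached iff for every [n] some grid point of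
    [0, u] has a value above [b - 1/(n+1)]; the converse uses that a continuous
    path attains its maximum on [0, u]. *)
Lemma reaches_measurable Z b u : 0 <= u -> adapted F Z -> cpaths Z ->
  F u [set w | reaches Z b u w].
Proof.
move=> u0 aZ cZ.
rewrite (_ : [set _ | _] = \bigcap_n \bigcup_m \bigcup_k
  (if (k <= m.+1)%N then Z (grid_point u m k) @^-1` `]b - n.+1%:R^-1, +oo[ else set0)).
  apply: (salg_bigcap (sF u0)) => n; apply: (salg_bigcup (sF u0)) => m.
  apply: (salg_bigcup (sF u0)) => k; case: ifPn => [km|_]; last exact: salg_set0 (sF u0).
  apply: (FS (grid_point_ge0 m k u0) (grid_point_le u0 km)).
  by apply: (aZ _ (grid_point_ge0 m k u0)); exact: measurable_itv.
apply/seteqP; split => w.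
  move=> [s [s0 su bZ]] n _ /=.
  have e0 : 0 < n.+1%:R^-1 :> R by rewrite invr_gt0.
  have su' : 0 <= s <= u by rewrite s0.
  have := @cpaths_cvg R _ _ Z w _ _ cZ (fun m => le_trans s0 (grid_ceil_ge m su')) s0 (grid_ceil_cvg su').
  move=> /cvgrPdist_lt /(_ _ e0) [m _ /(_ m (leqnn m))] hm.
  exists m => //; exists (grid_index u m s) => //; rewrite grid_index_bound//=.
  rewrite in_itv/= andbT; move: hm; rewrite ltr_norml /grid_ceil /= => /andP[_ hm].
  by rewrite ltrBlDr; apply: le_lt_trans bZ _; rewrite -ltrBlDl.
move=> H.
(* The maximum over [0, u] dominates all grid values, hence is at least b. *)
have [|c cin cmax] := @EVT_max R (fun s => Z (Num.max s 0) w) 0 u u0.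
  by apply: continuous_subspaceT => s; exact: cZ.
move: cin; rewrite in_itv/= => /andP[c0 cu].
exists c; split => //; apply/ler_addgt0Pr => e e0.
have [n _ hn] := near_harmonic_lt e0.
have [m _ [k _]] := H n I; case: ifPn => // km.
rewrite /= in_itv/= andbT => Zk.
have := cmax (grid_point u m k); rewrite in_itv/= grid_point_ge0// grid_point_le// => /(_ isT).
rewrite (max_idPl c0) (max_idPl (grid_point_ge0 m k u0)) => Zc.
have := hn n (leqnn n); rewrite /= => ne; rewrite -lerBlDr.
by apply: le_trans Zc; apply: le_trans (ltW Zk); rewrite lerD2l lerN2 ltW.
Qed.

Lemma bstop_hit Z b t : 0 <= t -> adapted F Z -> cpaths Z -> bstop F t (hit Z b t).
Proof.
move=> t0 aZ cZ; split=> [w|u u0]; first exact: hit_itv.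
have [tu|ut] := leP t u.
  rewrite (_ : [set _ | _] = setT); first exact: salg_setT (sF u0).
  apply/seteqP; split => // w _ /=; have /andP[_ h] := hit_itv Z b w t0.
  exact: le_trans h tu.
rewrite (_ : [set _ | _] = [set w | reaches Z b u w]); first exact: reaches_measurable.
apply/seteqP; split => w /=.
  move=> hu; have /andP[h0 h1] := hit_itv Z b w t0.
  exists (hit Z b t w); split => //; apply: hit_at => //; apply: hit_lt_reaches => //.
  exact: le_lt_trans hu ut.
move=> [s [s0 su bZ]]; apply: le_trans (su); apply: hit_le => //.
exact: (le_trans su (ltW ut)).
Qed.

End hitting.

(** * Joint measurability in time and chance *)

Section joint.
Context {R : realType} {d : measure_display} {Omega : measurableType d}.
Implicit Types (Z : R -> Omega -> R).

(** Rounding the time down to multiples of 1/(n+1) gives functions that are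
    measurable on each of countably many strips; they converge by continuity of
    the paths. *)
Lemma joint_measurable Z : (forall s : R, 0 <= s -> measurable_fun setT (Z s)) -> cpaths Z ->
  measurable_fun setT (fun x : measurableTypeR R * Omega => Z (Num.max x.1 0) x.2).
Proof.
move=> mZ cZ.
pose k (n : nat) (s : R) : nat := Num.truncn (n.+1%:R * Num.max s 0).
apply: (@measurable_fun_cvg _ _ R setT
  (fun n (x : measurableTypeR R * Omega) => Z ((k n x.1)%:R / n.+1%:R) x.2)).
  move=> n _ B mB; rewrite setTI.
  rewrite (_ : _ @^-1` B = \bigcup_j ([set s : measurableTypeR R | k n s = j] `*`
      (Z (j%:R / n.+1%:R) @^-1` B))).
    apply: bigcupT_measurable => j; apply: measurableX.
      rewrite (_ : [set _ | _] = (fun s : R => n.+1%:R * Num.max s 0) @^-1` `[j%:R, j.+1%:R[).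
        rewrite -[X in measurable X]setTI.
        have : measurable_fun setT (fun s : R => n.+1%:R * Num.max s 0).
          by apply: measurable_funM => //; exact: measurable_maxr.
        by apply => //; exact: measurable_itv.
      apply/seteqP; split => s /=; rewrite in_itv/= -truncn_eq ?mulr_ge0 ?le_max ?lexx ?orbT//.
        by move=> /eqP.
      by move=> /eqP.
    rewrite -[X in measurable X]setTI; apply: mZ => //.
  apply/seteqP; split => [[s w] /= Bw|[s w] [j _ [/= <-]]//].
  by exists (k n s).
move=> [s w] _ /=; apply: cpaths_cvg => //; first by rewrite le_max lexx orbT.
set x := Num.max s 0; have x0 : 0 <= x by rewrite le_max lexx orbT.
apply: (@squeeze_cvgr _ _ _ _ (fun n => x - n.+1%:R^-1) (fun=> x)); last exact: cvg_cst.
  apply: nearW => n.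
  have /andP[h1 h2] : (k n s)%:R <= n.+1%:R * x < (k n s).+1%:R.
    by apply: truncn_itv; rewrite mulr_ge0.
  apply/andP; split; last by rewrite ler_pdivrMr// mulrC.
  by rewrite lerBlDr -[X in _ + X]mul1r -mulrDl natr1 ler_pdivlMr// mulrC ltW.
rewrite -[X in _ --> X](subr0 x); apply: cvgB; first exact: cvg_cst.
exact: cvg_harmonic.
Qed.

End joint.

(** * Fourier coefficients and atoms *)

(** The integral of a nonnegative function is the supremum of the integrals of
    the simple functions below it, hence is monotone whether or not the
    functions are measurable.  The bracket of the martingale problem can thus
    be estimated without discussing the measurability in time of its
    integrand. *)
Lemma le_lower_integral {d} {T : measurableType d} {R : realType}
    (mu : {measure set T -> \bar R}) (D : set T) (f g : T -> \bar R) :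
  (forall x, D x -> (0 <= f x)%E) -> (forall x, D x -> (f x <= g x)%E) ->
  (\int[mu]_(x in D) f x <= \int[mu]_(x in D) g x)%E.
Proof.
move=> f0 fg; have g0 x : D x -> (0 <= g x)%E.
  by move=> Dx; exact: le_trans (f0 x Dx) (fg x Dx).
rewrite !ge0_integralE//; apply: ereal_sup_le => _ [h hf <-]; exists h => //= x.
apply: (le_trans (hf x)); rewrite !patchE; case: ifP => //; rewrite inE.
exact: fg.
Qed.

Section fejer.
Context {R : realType}.
Variable m : finmeas R.

Definition fcos (k : nat) : R := mint m (fun x => cos (k%:R * x)).
Definition fsin (k : nat) : R := mint m (fun x => sin (k%:R * x)).

Let L1c (f : R -> R) K : continuous f -> (forall x, `|f x| <= K) -> L1 m f.
Proof. by move=> cf fK; exact: (L1_bounded m (continuous_measurable_fun cf) fK). Qed.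

Let cA (a b : R) : continuous (fun x => cos (a * (x - b))).
Proof.
move=> x; apply: (@continuous_comp _ _ _ (fun x => a * (x - b)) cos); last exact: continuous_cos.
by apply: cvgM; [exact: cvg_cst|apply: cvgB; [exact: cvg_id|exact: cvg_cst]].
Qed.

Let cB (a b : R) : continuous (fun x => sin (a * (x - b))).
Proof.
move=> x; apply: (@continuous_comp _ _ _ (fun x => a * (x - b)) sin); last exact: continuous_sin.
by apply: cvgM; [exact: cvg_cst|apply: cvgB; [exact: cvg_id|exact: cvg_cst]].
Qed.

Let ncos (x : R) : `|cos x| <= 1. Proof. by rewrite ler_norml cos_geN1 cos_le1. Qed.
Let nsin (x : R) : `|sin x| <= 1. Proof. by rewrite ler_norml sin_geN1 sin_le1. Qed.

Let Lc a b : L1 m (fun x => cos (a * (x - b))).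
Proof. by apply: (@L1c _ 1); [exact: cA|move=> x; exact: ncos]. Qed.

Let Lc0 a : L1 m (fun x => cos (a * x)).
Proof. by have := Lc a 0; under eq_fun do rewrite subr0. Qed.

Let Ls0 a : L1 m (fun x => sin (a * x)).
Proof.
have : L1 m (fun x => sin (a * (x - 0))).
  by apply: (@L1c _ 1); [exact: cB|move=> x; exact: nsin].
by under eq_fun do rewrite subr0.
Qed.

Definition fourier_abs k : R := `|fcos k| + `|fsin k|.

(** The addition formula: a translate of a cosine is a combination of the cosine
    and the sine with coefficients bounded by one. *)
Lemma fourier_shift k (x0 : R) :
  E m (fun x => cos (k%:R * (x - x0))) <= fourier_abs k.
Proof.
have -> : (fun x => cos (k%:R * (x - x0))) =
    (fun x => cos (k%:R * x0) * cos (k%:R * x) + sin (k%:R * x0) * sin (k%:R * x)).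
  by apply/funext => x; rewrite mulrBr cosB mulrC [sin _ * sin _]mulrC.
rewrite ED; [|exact: L1Z|exact: L1Z]; rewrite !EZ// lerD//.
  apply: (le_trans (ler_norm _)); rewrite normrM -[leRHS]mul1r ler_wpM2r//.
apply: (le_trans (ler_norm _)); rewrite normrM -[leRHS]mul1r ler_wpM2r//.
Qed.

(** The square of the modulus of the sum of [e^(iju)] over [j < n], that is, [n]
    times the Fejer kernel. *)
Definition fejer (n : nat) (u : R) : R :=
  (\sum_(j < n) cos (j%:R * u)) ^+ 2 + (\sum_(j < n) sin (j%:R * u)) ^+ 2.

Lemma fejer0 n : fejer n 0 = n%:R ^+ 2.
Proof.
rewrite /fejer; under eq_bigr do rewrite mulr0 cos0.
under [X in _ + X ^+ 2]eq_bigr do rewrite mulr0 sin0.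
by rewrite big1_eq expr0n addr0 sumr_const card_ord.
Qed.

(** Adding the term of index [n] to the exponential sum adds its square modulus,
    which is one, and twice the real part of its products with the previous
    terms; reversing the order of these makes them the cosines of
    [u, ..., n u]. *)
Lemma fejerS n u : fejer n.+1 u = fejer n u + 1 + 2 * \sum_(j < n) cos (j.+1%:R * u).
Proof.
rewrite /fejer !big_ord_recr/=.
set A := \sum_(j < n) cos _; set B := \sum_(j < n) sin _.
have -> : \sum_(j < n) cos (j.+1%:R * u) = A * cos (n%:R * u) + B * sin (n%:R * u).
  rewrite -[LHS](big_mkord xpredT (fun j => cos (j.+1%:R * u))) big_nat_rev /= add0n big_mkord.
  rewrite /A /B !mulr_suml -big_split/=; apply: eq_bigr => j _.
  rewrite subnSK// natrB; last exact: ltnW.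
  by rewrite mulrBl cosB mulrC [sin _ * sin _]mulrC.
have := cos2Dsin2 (n%:R * u); rewrite !sqrrD.
by rewrite !mulr2n; lra.
Qed.

(** Integrating the recursion [fejerS]: each step contributes the total mass and
    at most twice the first Fourier coefficients. *)
Lemma E_fejer n (x0 : R) : L1 m (fun x => fejer n (x - x0)) /\
  E m (fun x => fejer n (x - x0)) <=
  n%:R * (fine (m setT) + 2 * \sum_(i < n) fourier_abs i.+1).
Proof.
elim: n => [|n [IL IE]].
  have -> : (fun x => fejer 0 (x - x0)) = fun=> 0.
    by apply/funext => x; rewrite /fejer !big_ord0 expr0n addr0.
  by split; [exact: L1_cst|rewrite E0 mul0r].
have -> : (fun x => fejer n.+1 (x - x0)) = (fun x => fejer n (x - x0) + 1 +
    2 * \sum_(j < n) cos (j.+1%:R * (x - x0))).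
  by apply/funext => x; rewrite fejerS.
have L2 : L1 m (fun x => \sum_(j < n) cos (j.+1%:R * (x - x0))).
  by apply: L1_sum => j; exact: Lc.
have L1' : L1 m (fun x => fejer n (x - x0) + 1) by apply: L1D => //; exact: L1_cst.
split; first by apply: L1D => //; exact: L1Z.
rewrite ED//; last exact: L1Z.
rewrite ED//; last exact: L1_cst.
rewrite EZ// E_cst mul1r E_sum//.
have S1 : \sum_(i < n) E m (fun x => cos (i.+1%:R * (x - x0))) <=
    \sum_(i < n) fourier_abs i.+1.
  by apply: ler_sum => i _; exact: fourier_shift.
rewrite big_ord_recr/=.
have a0 k : 0 <= fourier_abs k by rewrite addr_ge0.
have S0 : 0 <= \sum_(i < n) fourier_abs i.+1 by exact: sumr_ge0.
move: IE S1 (a0 n.+1) S0.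
set X := \sum_(i < n) E m _; set S := \sum_(i < n) fourier_abs _.
set e := E m _; set M := fine _; set a := fourier_abs _ => IE XS a1 S1.
rewrite -[n.+1%:R]natr1.
have n0 : 0 <= n%:R :> R by [].
have na := mulr_ge0 n0 a1.
have -> : (n%:R + 1) * (M + 2 * (S + a)) =
    n%:R * (M + 2 * S) + 2 * (n%:R * a) + M + 2 * S + 2 * a by ring.
by move: IE na XS a1 S1; set W := n%:R * (_ + _); lra.
Qed.

(** The kernel centred at [x0] is nonnegative and equals [n ^ 2] at [x0]. *)
Lemma fejer_atom n (x0 : R) :
  n%:R * fine (m [set x0]) <= fine (m setT) + 2 * \sum_(i < n) fourier_abs i.+1.
Proof.
case: n => [|n].
  by rewrite mul0r big_ord0 mulr0 addr0 fine_ge0.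
have [IL IE] := E_fejer n.+1 x0.
have n0 : 0 < n.+1%:R :> R by [].
rewrite -(ler_pM2l n0); apply: le_trans IE.
have m1 : measurable [set x0 : measurableTypeR R] by exact: measurable_set1.
have -> : n.+1%:R * (n.+1%:R * fine (m [set x0])) =
    E m (fun x => n.+1%:R ^+ 2 * \1_[set x0] x).
  rewrite EZ; last exact: L1_indic.
  rewrite mulrA; congr (_ * _).
  by have := E_indic m m1 => /(congr1 fine)/= <-.
apply: E_le => //.
  by apply: L1Z; exact: L1_indic.
move=> x; rewrite indicE; case: (boolP (x \in _)).
  by rewrite inE => ->; rewrite subrr fejer0 mulr1.
by move=> _; rewrite mulr0 /fejer addr_ge0// sqr_ge0.
Qed.

(** A form of Wiener's lemma: by [fejer_atom] the mass of an atom is at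
    most a Cesaro mean of the Fourier coefficients, up to a term of order
    [1/n]. *)
Lemma fourier_no_atom (x0 : R) : fcos k @[k --> \oo] --> 0 -> fsin k @[k --> \oo] --> 0 ->
  m [set x0] = 0%E.
Proof.
move=> cc cs.
have cb : fourier_abs k @[k --> \oo] --> `|0 : R| + `|0 : R|.
  by apply: cvgD; exact: cvg_norm.
rewrite normr0 addr0 in cb.
have ca : fourier_abs k.+1 @[k --> \oo] --> 0.
  by have := cb; rewrite -cvg_shiftS.
have ces := cesaro ca.
have h : fine (m [set x0]) <= 0.
  have cv : fine (m setT) * n.+1%:R^-1 + 2 * arithmetic_mean (fun k => fourier_abs k.+1) n
      @[n --> \oo] --> (0 : R).
    rewrite -[X in _ --> X](addr0 0); apply: cvgD.
      rewrite -[X in _ --> X](mulr0 (fine (m setT))); apply: cvgM; first exact: cvg_cst.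
      exact: cvg_harmonic.
    by rewrite -[X in _ --> X](mulr0 2); apply: cvgM => //; exact: cvg_cst.
  apply: (cvgr_to_ge cv); apply: nearW => n.
  rewrite /arithmetic_mean /= /series /= big_mkord.
  have := fejer_atom n.+1 x0.
  rewrite -ler_pdivlMl//; rewrite mulrDr mulrC => /le_trans; apply.
  by rewrite lerD2l mulrCA.
apply/eqP; rewrite -[m _]fineK ?fin_num_measure// eqe eq_le h fine_ge0//.
Qed.

End fejer.

(** * The distribution function of an atomless measure *)

Section distribution_function.
Context {R : realType}.
Variable m : finmeas R.
Hypothesis m_atomless : forall x : R, m [set x] = 0%E.

Definition distfun (x : R) : R := fine (m `]-oo, x]%classic).
Local Notation G := distfun.

Let mI x : measurable (`]-oo, x]%classic : set (measurableTypeR R)).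
Proof. exact: measurable_itv. Qed.

Lemma EFin_distfun x : (G x)%:E = m `]-oo, x]%classic.
Proof. by rewrite /G fineK// fin_num_measure. Qed.

Lemma distfun_ge0 x : 0 <= G x.
Proof. exact: fine_ge0. Qed.

Lemma distfun_le_mass x : G x <= fine (m setT).
Proof.
rewrite -lee_fin EFin_distfun fineK ?fin_num_measure//.
by apply: le_measure; rewrite ?inE//; exact: sublevel_measurable.
Qed.

Lemma distfun_mono : nondecreasing_fun G.
Proof.
move=> x y xy; rewrite -lee_fin !EFin_distfun.
apply: le_measure; rewrite ?inE//.
by move=> z /=; rewrite !in_itv/= => /le_trans; exact.
Qed.

Lemma distfun_measurable : measurable_fun setT G.
Proof. by apply: nondecreasing_measurable => //; exact: distfun_mono. Qed.

Let sublevel_measurable v : measurable ([set x | G x <= v] : set (measurableTypeR R)).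
Proof.
rewrite (_ : [set _ | _] = G @^-1` `]-oo, v]).
  by rewrite -[X in measurable X]setTI; apply: distfun_measurable => //; exact: measurable_itv.
by apply/seteqP; split => x /=; rewrite in_itv.
Qed.

Let open_closed c : m `]-oo, c]%classic = m `]-oo, c[%classic.
Proof.
apply/eqP; rewrite eq_le; apply/andP; split; last first.
  by apply: le_measure; rewrite ?inE// => x /=; rewrite !in_itv/= => /ltW.
have -> : `]-oo, c]%classic = `]-oo, c[ `|` [set c].
  apply/seteqP; split => x /=; rewrite !in_itv/=.
    by rewrite le_eqVlt => /orP[/eqP ->|->]; [right|left].
  by case=> [/ltW//|->].
apply: (le_trans (measureU2 m _ _)) => //=.
by rewrite m_atomless adde0.
Qed.

(** The sublevel set is a half-line.  If it is bounded with right end [c], then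
    all points strictly to the left of [c] belong to it, so that continuity
    from below bounds the mass of the open half-line up to [c]; and [c] itself
    carries no mass.  If it is the whole line, the same argument is run at
    infinity. *)
Lemma distfun_sublevel_le v : 0 <= v -> (m [set x | (G x <= v)%R] <= v%:E)%E.
Proof.
move=> v0; set D := [set x | _].
have [D0|D0] := pselect (D !=set0); last first.
  by rewrite (_ : D = set0) ?measure0 ?lee_fin//; apply/seteqP; split => // x Dx; apply: D0; exists x.
have [ub|nub] := pselect (has_ubound D); last first.
  have DT : D = setT.
    apply/seteqP; split => // x _; have [y Dy xy] : exists2 y, D y & x <= y.
      apply: contrapT => h; apply: nub; exists x => y Dy; rewrite leNgt; apply/negP => xy.
      by apply: h; exists y => //; exact: ltW.
    exact: le_trans (distfun_mono xy) Dy.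
  have cv : m (`]-oo, n%:R]%classic) @[n --> \oo] --> m setT.
    have -> : setT = \bigcup_n `]-oo, n%:R]%classic :> set (measurableTypeR R).
      apply/seteqP; split => // x _; exists (Num.bound x) => //=.
      by rewrite in_itv/= ltW// ltr_bound.
    apply: nondecreasing_cvg_mu => //; first exact: bigcup_measurable.
    move=> i j ij; apply/subsetPset => x /=; rewrite !in_itv/= => /le_trans; apply.
    by rewrite ler_nat.
  rewrite DT; apply: (cvge_to_le cv); apply: nearW => n.
  rewrite -EFin_distfun lee_fin.
  by have : D n%:R by rewrite DT.
have hs : has_sup D by [].
pose c := sup D.
have Dc : D `<=` `]-oo, c].
  by move=> x Dx /=; rewrite in_itv/=; exact: ub_le_sup.
apply: (@le_trans _ _ (m `]-oo, c]%classic)); first by apply: le_measure; rewrite ?inE//; exact: sublevel_measurable.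
rewrite open_closed.
have cv : m (`]-oo, c - n.+1%:R^-1]%classic) @[n --> \oo] --> m `]-oo, c[%classic.
  have -> : `]-oo, c[%classic = \bigcup_n `]-oo, c - n.+1%:R^-1]%classic :> set (measurableTypeR R).
    apply/seteqP; split => x /=; last first.
      case=> n _ /=; rewrite !in_itv/= => /le_lt_trans; apply.
      by rewrite ltrBlDr ltrDl.
    rewrite in_itv/= => xc; have e0 : 0 < c - x by rewrite subr_gt0.
    have [n _ hn] := near_harmonic_lt e0.
    exists n => //=; rewrite in_itv/= lerBrDr -lerBrDl ltW//; exact: hn (leqnn n).
  apply: nondecreasing_cvg_mu => //; first exact: bigcup_measurable.
  move=> i j ij; apply/subsetPset => x /=; rewrite !in_itv/= => /le_trans; apply.
  by rewrite lerD2l lerN2 lef_pV2 ?posrE// ler_nat.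
apply: (cvge_to_le cv); apply: nearW => n.
rewrite -EFin_distfun lee_fin.
have e0 : 0 < n.+1%:R^-1 :> R by [].
have [y Dy yc] := sup_adherent e0 hs.
by apply: le_trans Dy; apply: distfun_mono; exact: ltW.
Qed.

(** Symmetrically, approach the left end of the complementary half-line from the
    right and use continuity from above. *)
Lemma distfun_sublevel_ge u : u <= fine (m setT) -> (u%:E <= m [set x | (G x <= u)%R])%E.
Proof.
move=> uM; set D := [set x | _]; pose U := ~` D.
have Ugt x : U x -> u < G x by rewrite /U /D /= => /negP; rewrite -ltNge.
have [U0|U0] := pselect (U !=set0); last first.
  have -> : D = setT.
    by apply/seteqP; split => // x _; apply: contrapT => nx; apply: U0; exists x.
  by rewrite -[m setT]fineK ?fin_num_measure// lee_fin.
have [lb|nlb] := pselect (has_lbound U); last first.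
  have Gu x : u < G x.
    have [y Uy xy] : exists2 y, U y & y <= x.
      apply: contrapT => h; apply: nlb; exists x => y Uy; rewrite leNgt; apply/negP => xy.
      by apply: h; exists y => //; exact: ltW.
    exact: lt_le_trans (Ugt _ Uy) (distfun_mono xy).
  apply: (@le_trans _ _ 0%E) => //.
  have cv : m (`]-oo, - n%:R]%classic) @[n --> \oo] --> m set0.
    have -> : set0 = \bigcap_n `]-oo, - n%:R]%classic :> set (measurableTypeR R).
      apply/seteqP; split => // x /(_ (Num.bound x) I) /=.
      by rewrite in_itv/= leNgt => /negP; apply; rewrite ltrNl ltrNbound.
    apply: nonincreasing_cvg_mu => //.
    - by rewrite ltey_eq fin_num_measure.
    - exact: bigcap_measurable.
    - move=> i j ij; apply/subsetPset => x /=; rewrite !in_itv/= => /le_trans; apply.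
      by rewrite lerN2 ler_nat.
  rewrite measure0 in cv; apply: (cvge_to_ge cv); apply: nearW => n.
  by rewrite -EFin_distfun lee_fin ltW.
have hi : has_inf U by [].
pose c := inf U.
have Dc : `]-oo, c[ `<=` D.
  move=> x /=; rewrite in_itv/= => xc; apply: contrapT => /= nD.
  have : c <= x by apply: ge_inf.
  by rewrite leNgt xc.
apply: (@le_trans _ _ (m `]-oo, c[%classic)); last by apply: le_measure; rewrite ?inE//; exact: sublevel_measurable.
rewrite -open_closed.
have cv : m (`]-oo, c + n.+1%:R^-1]%classic) @[n --> \oo] --> m `]-oo, c]%classic.
  have -> : `]-oo, c]%classic = \bigcap_n `]-oo, c + n.+1%:R^-1]%classic :> set (measurableTypeR R).
    apply/seteqP; split => x /=.
      rewrite in_itv/= => xc n _ /=; rewrite in_itv/=; apply: (le_trans xc).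
      by rewrite lerDl.
    move=> H; rewrite in_itv/=; apply/ler_addgt0Pr => e e0.
    have [n _ hn] := near_harmonic_lt e0.
    have := H n I; rewrite /= in_itv/= => /le_trans; apply.
    by rewrite lerD2l ltW//; exact: hn (leqnn n).
  apply: nonincreasing_cvg_mu => //.
  - by rewrite ltey_eq fin_num_measure.
  - exact: bigcap_measurable.
  - move=> i j ij; apply/subsetPset => x /=; rewrite !in_itv/= => /le_trans; apply.
    by rewrite lerD2l lef_pV2 ?posrE// ler_nat.
apply: (cvge_to_ge cv); apply: nearW => n.
rewrite -EFin_distfun lee_fin.
have e0 : 0 < n.+1%:R^-1 :> R by [].
have [y Uy yc] := inf_adherent e0 hi.
by apply: le_trans (ltW (Ugt _ Uy)) _; apply: distfun_mono; exact: ltW.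
Qed.

(** The difference of the two preceding bounds, once [u] and [v] are compared
    with the range [0, m setT] of the distribution function. *)
Lemma distfun_preimage_oc (u v : R) : u < v ->
  (m (G @^-1` `]u, v]%classic) <= (v - u)%:E)%E.
Proof.
move=> uv.
have S : [set x | G x <= v] = [set x | G x <= u] `|` G @^-1` `]u, v] :> set (measurableTypeR R).
  apply/seteqP; split => x /=; rewrite in_itv/=.
    by move=> ->; rewrite andbT; have [|] := leP (G x) u; [left|right].
  by case=> [/le_trans|/andP[]//]; apply; exact: ltW.
have mG : measurable (G @^-1` `]u, v] : set (measurableTypeR R)).
  by rewrite -[X in measurable X]setTI; apply: distfun_measurable => //; exact: measurable_itv.
have dis : [set x | G x <= u] `&` G @^-1` `]u, v] = set0 :> set (measurableTypeR R).
  by apply/seteqP; split => x //= []; rewrite in_itv/= leNgt => /negP h /andP[].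
have [vneg|v0] := ltP v 0.
  rewrite (_ : G @^-1` _ = set0) ?measure0 ?lee_fin ?subr_ge0 ?ltW//.
  apply/seteqP; split => x //=; rewrite in_itv/= => /andP[_ h].
  by have := le_trans (distfun_ge0 x) h; rewrite leNgt vneg.
have [uM|Mu] := leP u (fine (m setT)); last first.
  rewrite (_ : G @^-1` _ = set0) ?measure0 ?lee_fin ?subr_ge0 ?ltW//.
  apply/seteqP; split => x //=; rewrite in_itv/= => /andP[h _].
  by have := lt_trans Mu h; rewrite ltNge distfun_le_mass.
have := distfun_sublevel_le v0.
have -> : (m [set x | (G x <= v)%R] = m [set x | (G x <= u)%R] + m (G @^-1` `]u, v]%classic))%E.
  by rewrite S measureU.
have := distfun_sublevel_ge uM.
have f1 : m [set x | (G x <= u)%R] \is a fin_num by rewrite fin_num_measure.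
have f2 : m (G @^-1` `]u, v]%classic) \is a fin_num by rewrite fin_num_measure.
rewrite -(fineK f1) -(fineK f2) -EFinD !lee_fin; lra.
Qed.

(** A quantile transform: the image of an atomless measure under its
    distribution function is at most Lebesgue measure.  As Lebesgue measure is an
    infimum over covers by half-open intervals, it suffices to know this for
    these intervals. *)
Lemma distfun_preimage_le (B : set R) : measurable B ->
  (m (G @^-1` B) <= lebesgue_measure B)%E.
Proof.
move=> mB; apply: le_ereal_inf_tmp => _ [A [mA BA] <-].
have mGA (k : nat) : measurable (G @^-1` (A k) : set (measurableTypeR R)).
  have /ocitvP[->|[x _ ->]] := mA k; first by rewrite preimage_set0.
  by rewrite -[X in measurable X]setTI; apply: distfun_measurable => //; exact: measurable_itv.
have mGB : measurable (G @^-1` B : set (measurableTypeR R)).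
  by rewrite -[X in measurable X]setTI; exact: distfun_measurable.
apply: (@le_trans _ _ (\sum_(k <oo) m (G @^-1` (A k)))%E).
  apply: measure_sigma_subadditive => //.
  by move=> x /BA[k _ Ak]; exists k.
apply: lee_nneseries => // k _.
have /ocitvP[->|[x xx ->]] := mA k; first by rewrite preimage_set0 measure0; exact: wlength_ge0.
have /= := @wlength_itv_bnd R idfun x.1 x.2 false false (ltW xx).
move=> wl; apply: (@le_trans _ _ (x.2 - x.1)%:E); first exact: distfun_preimage_oc.
by rewrite -wl.
Qed.

End distribution_function.

(** * A lower bound for the branching rate *)

Lemma mint_cst {R : realType} (m : finmeas R) (c : R) : mint m (cst c) = c * fine (m setT).
Proof. exact: E_cst. Qed.

Lemma mint_cst1 {R : realType} (m : finmeas R) : mint m (cst 1) = fine (m setT).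
Proof. by rewrite mint_cst mul1r. Qed.

Section branching.
Context {R : realType}.
Variable sigma : R -> R.
Hypothesis sigma_ge0 : forall u : R, 0 <= u -> 0 <= sigma u.
Hypothesis sigma_borel : measurable_fun (`[0, +oo[ : set R) sigma.
Hypothesis sigma_bounded :
  forall n : nat, (1 <= n)%N -> [bounded sigma u | u in `[0, n%:R]].
Hypothesis sigma_zeros :
  lebesgue_measure [set u : R | 0 <= u /\ sigma u = 0] = 0%E.

Lemma sigma_sup (b : R) : exists2 S, 0 <= S & forall u, 0 <= u -> u <= b -> sigma u <= S.
Proof.
pose n := (Num.bound b).+1.
have [M [Mr hM]] := @sigma_bounded n isT.
exists (`|M| + 1) => [|u u0 ub]; first by rewrite addr_ge0.
have := hM (`|M| + 1); rewrite ltr_pwDr ?ler_norm// => /(_ isT u) /=.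
rewrite in_itv/= u0 /= => h; apply: (le_trans (ler_norm _)); apply: h.
apply: (le_trans ub); rewrite ltW// (lt_le_trans (ltr_bound b))// ler_nat.
exact: leqnSn.
Qed.

(** The spatial density of the speed of the bracket at the state [m]. *)
Definition brate (m : finmeas R) (f : R -> R) (x : R) : R :=
  sigma (fine (m `]-oo, x]%classic)) * f x ^+ 2.

Lemma brate_ge0 m f x : 0 <= brate m f x.
Proof. by rewrite /brate mulr_ge0 ?sqr_ge0// sigma_ge0// fine_ge0. Qed.

Lemma brate_integral_le (m : finmeas R) f (b S : R) : 0 <= S ->
  (forall u, 0 <= u -> u <= b -> sigma u <= S) ->
  fine (m setT) <= b -> (forall x, `|f x| <= 1) ->
  (\int[m]_x (brate m f x)%:E <= (S * b)%:E)%E.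
Proof.
move=> S0 hS mb f1.
apply: (@le_trans _ _ (\int[m]_x (S%:E))%E).
  apply: le_lower_integral => x _; rewrite lee_fin; first exact: brate_ge0.
  rewrite /brate -[leRHS]mulr1; apply: ler_pM; rewrite ?sqr_ge0//.
  - by rewrite sigma_ge0// fine_ge0.
  - apply: hS; first exact: fine_ge0.
    exact: (le_trans (distfun_le_mass m x) mb).
  - by rewrite -real_normK ?num_real// expr_le1.
rewrite integral_cst// -[X in (_ * X)%E]fineK ?fin_num_measure// -EFinM lee_fin.
by rewrite ler_wpM2l.
Qed.

Lemma brate_le (m : finmeas R) f (b S : R) : 0 <= S ->
  (forall u, 0 <= u -> u <= b -> sigma u <= S) ->
  fine (m setT) <= b -> (forall x, `|f x| <= 1) ->
  0 <= mint m (brate m f) <= S * b.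
Proof.
move=> S0 hS mb f1; apply/andP; split.
  by apply: Rintegral_ge0 => x _; exact: brate_ge0.
have h := brate_integral_le S0 hS mb f1.
have h0 : (0 <= \int[m]_x (brate m f x)%:E)%E.
  by apply: integral_ge0 => x _; rewrite lee_fin brate_ge0.
rewrite /mint /Rintegral -lee_fin fineK//.
by rewrite ge0_fin_numE// (le_lt_trans h)// ltry.
Qed.

Definition sigma_low (b eta : R) : set R := [set u | 0 <= u <= b /\ sigma u < eta].

(** The sets where [sigma] is below [1/(n+1)] decrease to the zero set of
    [sigma], and within [0, b] they have finite measure. *)
Lemma sigma_small (b d : R) : 0 < d -> exists2 eta : R, 0 < eta &
  measurable (sigma_low b eta) /\ (lebesgue_measure (sigma_low b eta) <= d%:E)%E.
Proof.
move=> d0.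
pose N (n : nat) := sigma_low b n.+1%:R^-1.
have mN n : measurable (N n).
  have -> : N n = `[0, b] `&` (`[0, +oo[ `&` sigma @^-1` `]-oo, n.+1%:R^-1[).
    apply/seteqP; split => u /=; rewrite /N /sigma_low /= !in_itv/= ?andbT.
      by move=> [/andP[-> ->] ->].
    by move=> [? [? ?]].
  apply: (@measurableI _ (measurableTypeR R)); first exact: measurable_itv.
  by apply: sigma_borel; exact: measurable_itv.
have cap0 : lebesgue_measure (\bigcap_n N n) = 0%E.
  have mz : measurable [set u : R | 0 <= u /\ sigma u = 0].
    have -> : [set u : R | 0 <= u /\ sigma u = 0] = `[0, +oo[ `&` sigma @^-1` [set 0].
      by apply/seteqP; split => u /=; rewrite in_itv/= andbT.
    by apply: sigma_borel; [exact: measurable_itv|exact: measurable_set1].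
  apply/eqP; rewrite -measure_le0 -sigma_zeros; apply: le_measure; rewrite ?inE//.
    by apply: bigcapT_measurable => ?; exact: mN.
  move=> u H /=; have [/andP[u0 _] _] := H 0%N I; split => //.
  apply: le_anti; rewrite sigma_ge0// andbT; apply/ler_addgt0Pr => e e0.
  have [n _ hn] := near_harmonic_lt e0.
  rewrite add0r; have [_ /ltW/le_trans] := H n I; apply; apply: ltW.
  exact: hn (leqnn n).
have cv : lebesgue_measure (N n) @[n --> \oo] --> lebesgue_measure (\bigcap_n N n).
  apply: nonincreasing_cvg_mu => //.
  - apply: (@le_lt_trans _ _ (lebesgue_measure (`[0, b]%classic : set R))).
      apply: le_measure; rewrite ?inE; [exact: mN|exact: measurable_itv|].
      by move=> u [/= h _]; rewrite in_itv.
    by rewrite lebesgue_measure_itv; case: ifP => //=; rewrite -?EFinB ltry.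
  - by apply: bigcapT_measurable => ?; exact: mN.
  - move=> i j ij; apply/subsetPset => u [/= h hu]; split => //; apply: (lt_le_trans hu).
    by rewrite lef_pV2 ?posrE// ler_nat.
rewrite cap0 in cv.
have : \forall n \near \oo, (lebesgue_measure (N n) < d%:E)%E.
  by apply: (cv [set x | (x < d%:E)%E]); apply: open_ereal_lt'; rewrite lte_fin.
case=> n _ hn; exists n.+1%:R^-1 => //; split; first exact: mN.
by apply: ltW; exact: (hn n (leqnn n)).
Qed.

(** Choose [eta] such that [sigma] is below [eta] only on a set [N] of Lebesgue
    measure at most [a / 2] in [0, b].  By [distfun_preimage_le] the points whose
    distribution value falls in [N] have mass at most [a / 2], so at least
    [a / 2] of the mass branches at rate at least [eta]. *)
Lemma brate_lower_bound (a b : R) : 0 < a -> exists2 kappa : R, 0 < kappa &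
  forall m : finmeas R, (forall x : R, m [set x] = 0%E) ->
  a <= fine (m setT) -> fine (m setT) <= b ->
  kappa <= mint m (brate m (cst 1)).
Proof.
move=> a0; have a20 : 0 < a / 2 by rewrite divr_gt0.
have [eta eta0 [mN Nle]] := sigma_small b a20.
have [S S0 hS] := sigma_sup b.
exists (eta * (a / 2)); first by rewrite mulr_gt0.
move=> m m_atom am mb.
set N := sigma_low b eta in mN Nle.
pose B := distfun m @^-1` N : set (measurableTypeR R).
have mB : measurable B.
  by rewrite -[X in measurable X]setTI; apply: distfun_measurable.
have mle : (m B <= (a / 2)%:E)%E by apply: le_trans (distfun_preimage_le m_atom mN) Nle.
have mC : ((a / 2)%:E <= m (~` B))%E.
  have e : (m setT = m B + m (~` B))%E.
    by rewrite -measureU ?setUv ?setICr//; exact: measurableC.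
  have f1 : m B \is a fin_num by rewrite fin_num_measure.
  have f2 : m (~` B) \is a fin_num by rewrite fin_num_measure//; exact: measurableC.
  move: am mle; rewrite e -(fineK f1) -(fineK f2) -EFinD /= !lee_fin; lra.
have L : ((eta * (a / 2))%:E <= \int[m]_x (brate m (cst 1) x)%:E)%E.
  apply: (@le_trans _ _ (\int[m]_x (eta * \1_(~` B) x)%:E)%E).
    under eq_integral do rewrite EFinM.
    rewrite ge0_integralZl_EFin; [|exact: measurableT|by move=> x _; rewrite lee_fin| |exact: ltW]; last first.
      by apply/measurable_EFinP; apply: measurable_indic; exact: measurableC.
    rewrite integral_indic//; last exact: measurableC.
    by rewrite setIT EFinM lee_wpmul2l// lee_fin ltW.
  apply: le_lower_integral => x _; rewrite lee_fin.
    by rewrite mulr_ge0// ltW.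
  rewrite indicE; case: (boolP (x \in ~` B)); last by rewrite mulr0 brate_ge0.
  rewrite inE /B /N /sigma_low /= /brate /= expr1n !mulr1 => h; rewrite leNgt; apply/negP => hs.
  by apply: h; split => //; rewrite distfun_ge0 (le_trans (distfun_le_mass m x) mb).
have f1 (x : R) : `|(cst 1 : R -> R) x| <= 1 by rewrite normr1.
have U := brate_integral_le S0 hS mb f1.
rewrite /mint /Rintegral -lee_fin fineK//.
have h0 : (0 <= \int[m]_x (brate m (cst 1) x)%:E)%E.
  by apply: integral_ge0 => x _; rewrite lee_fin brate_ge0.
by rewrite ge0_fin_numE// (le_lt_trans U)// ltry.
Qed.

End branching.

(** * Fubini on a bounded time interval, and a primitive *)

Section compact_fubini.
Context {R : realType} {d : measure_display} {Omega : measurableType d}.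
Variables (P : probability Omega R) (h : Omega * measurableTypeR R -> R) (C t : R).
Local Notation leb := (@lebesgue_measure R).
Hypothesis mh : measurable_fun setT h.
Hypothesis hC : forall x, `|h x| <= C * \1_(`[0, t]%classic : set R) x.2.
Hypothesis t0 : 0 <= t.

Let C0 : 0 <= C.
Proof.
have := hC (point, 0); rewrite indicE mem_set /= ?in_itv/= ?lexx//.
by rewrite mulr1; exact: le_trans.
Qed.

Let mI : measurable (`[0, t]%classic : set R). Proof. exact: measurable_itv. Qed.

Let leb_int : (\int[leb]_s (C * \1_(`[0, t]%classic : set R) s)%:E = (C * t)%:E)%E.
Proof.
under eq_integral do rewrite EFinM.
rewrite ge0_integralZl_EFin//; last first.
  by apply/measurable_EFinP; exact: measurable_indic.
rewrite integral_indic// setIT /= lebesgue_measure_itv /= lte_fin.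
case: ltP => [_|tn]; first by rewrite -EFinB subr0 -EFinM.
by have -> : t = 0 by apply: le_anti; rewrite tn.
Qed.

Lemma section_integrable w : leb.-integrable setT (EFin \o (fun s => h (w, s))).
Proof.
apply/integrableP; split; first by apply/measurable_EFinP; exact: measurableT_comp.
apply: (@le_lt_trans _ _ (C * t)%:E); last by rewrite ltry.
rewrite -leb_int; apply: ge0_le_integral => //.
- by apply: measurableT_comp => //; apply/measurable_EFinP; exact: measurableT_comp.
- apply/measurable_EFinP; apply: measurable_funM => //; exact: measurable_indic.
- by move=> s _; rewrite lee_fin; exact: (hC (w, s)).
Qed.

Lemma prod_integrable : (P \x leb)%E.-integrable setT (EFin \o h).
Proof.
apply/integrable12ltyP; first exact/measurable_EFinP.
apply: (@le_lt_trans _ _ (\int[P]_w (C * t)%:E)%E).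
  apply: le_lower_integral => w _; first exact: integral_ge0.
  rewrite -leb_int; apply: le_lower_integral => // s _.
  by rewrite lee_fin; exact: (hC (w, s)).
rewrite integral_cst// [X in (_ * X)%E](_ : _ = 1%E) ?mule1 ?ltry//.
exact: probability_setT.
Qed.

Lemma section_L1 s : L1 P (fun w => h (w, s)).
Proof.
apply: (L1_bounded P (K := C)); first exact: measurableT_comp.
move=> w; apply: (le_trans (hC (w, s))); by rewrite -[leRHS]mulr1 ler_wpM2l//.
Qed.

Lemma EFin_section_int w :
  (\int[leb]_s h (w, s))%:E = (\int[leb]_s (h (w, s))%:E)%E.
Proof.
rewrite /Rintegral fineK//; apply: integrable_fin_num => //.
exact: section_integrable.
Qed.

Lemma section_int_L1 : L1 P (fun w => \int[leb]_s h (w, s)).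
Proof.
have := integrable_fubini_F prod_integrable.
apply: eq_integrable => // w _; rewrite /= EFin_section_int//.
Qed.

Lemma compact_fubini :
  E P (fun w => \int[leb]_s h (w, s)) = \int[leb]_s E P (fun w => h (w, s)).
Proof.
rewrite /E {1 3}/Rintegral; congr fine.
under eq_integral do rewrite EFin_section_int.
under [RHS]eq_integral => s _ do rewrite (EFin_E (section_L1 s)).
exact: (Fubini prod_integrable).
Qed.

End compact_fubini.

Section primitive.
Context {R : realType}.
Local Notation leb := (@lebesgue_measure R).
Variables (z : R -> R) (a c T : R).
Hypotheses (cz : continuous z) (T0 : 0 < T).

Let I (s : R) : R := \int[leb]_(u in `[0, s]) z u.

Let iz (s : R) : leb.-integrable `[0, s] (EFin \o z).
Proof.
apply: continuous_compact_integrable; first exact: segment_compact.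
exact: continuous_subspaceT.
Qed.

Let dI (s : R) : 0 < s -> is_derive s 1 I (z s).
Proof.
move=> s0; have s1 : s < s + 1 by rewrite ltrDl.
have [h1 h2] := continuous_FTC1_closed s1 (iz (s + 1)) s0 (cz (x:=s)).
by apply: DeriveDef => //; rewrite -derive1E.
Qed.

Let cI : {within `[0, T], continuous I}.
Proof. by apply: parameterized_integral_continuous; [exact: ltW|exact: iz]. Qed.

Let Phi (s : R) : R := a * I s - c / 2 * I s ^+ 2.

Let dPhi (s : R) : 0 < s -> is_derive s 1 Phi (z s * (a - c * I s)).
Proof.
move=> s0; have dIs := dI s0.
have -> : Phi = (cst a * I - (c / 2) *: (I ^+ 2)).
  by apply/funext => u.
apply: is_derive_eq.
rewrite /cst /GRing.scale /=.
by field.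
Qed.

(** The integrand is the derivative of [a I - c/2 I^2], where [I] is the primitive
    of [z]. *)
Lemma cst_minus_primitive_int :
  \int[leb]_(s in `[0, T]) (z s * (a - c * \int[leb]_(u in `[0, s]) z u)) =
  a * (\int[leb]_(u in `[0, T]) z u) - c / 2 * (\int[leb]_(u in `[0, T]) z u) ^+ 2.
Proof.
have [cIo c0 cT] := (continuous_within_itvP I T0).1 cI.
have I0 : I 0 = 0 by rewrite /I set_itv1 Rintegral_set1.
have cPhi (G : set_system R) (FG : Filter G) (l : R) : I @ G --> I l -> Phi @ G --> Phi l.
  move=> h; apply: cvgB; first by apply: cvgM => //; exact: cvg_cst.
  apply: cvgM; first exact: cvg_cst.
  under eq_fun do rewrite expr2; rewrite expr2; exact: cvgM.
have := @continuous_FTC2 R (fun s => z s * (a - c * I s)) Phi 0 T T0.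
rewrite /Rintegral => -> //.
- rewrite -EFinB /=; rewrite /Phi I0 expr0n !mulr0 subrr subr0.
  by [].
- move=> s; apply: cvgM; first by have := continuous_subspaceT (A := `[0, T]%classic) cz => /(_ s).
  apply: cvgB; first exact: cvg_cst.
  by apply: cvgM; [exact: cvg_cst|exact: cI].
- split; [|exact: cPhi|exact: cPhi].
  by move=> s; rewrite in_itv/= => /andP[s0 _]; have [] := dPhi s0.
- move=> s; rewrite in_itv/= => /andP[s0 _].
  by rewrite derive1E; have [_ ->] := dPhi s0.
Qed.

End primitive.

(** * The martingale problem up to a stopping time *)

Section mint_functional.
Context {R : realType}.
Implicit Types (f : R -> R) (m : finmeas R).

Lemma L1_bcont m f : continuous f -> (forall x, `|f x| <= 1) -> L1 m f.
Proof. by move=> cf f1; exact: (L1_bounded m (continuous_measurable_fun cf) f1). Qed.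

Lemma mint_norm_le_mass m f : continuous f -> (forall x, `|f x| <= 1) ->
  `|mint m f| <= mint m (cst 1).
Proof.
move=> cf f1; have i1 := L1_bcont m cf f1.
apply: (le_trans (le_normr_Rintegral measurableT i1)).
by apply: E_le => //; [exact: L1_norm|exact: L1_cst].
Qed.

Lemma mint_ge0 m f : (forall x, 0 <= f x) -> 0 <= mint m f.
Proof. by move=> f0; apply: Rintegral_ge0. Qed.

Lemma bounded_fun1 f (K : R) : (forall x, `|f x| <= K) -> bounded_fun f.
Proof.
move=> fK; exists K; split; first exact: num_real.
by move=> M KM x _; exact: (le_trans (fK x) (ltW KM)).
Qed.

Lemma mint_continuous f : continuous f -> bounded_fun f ->
  continuous (fun m : finmeas R => mint m f).
Proof. by move=> cf bf m; exact: ((@cvg_finmeasP R (nbhs m) m _).1 (@cvg_id _ _) f cf bf). Qed.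

(** Open sets for the weak topology are Borel, and superlevel sets of a weakly
    continuous functional are open. *)
Lemma mint_measurable f : continuous f -> bounded_fun f ->
  measurable_fun setT (fun m : finmeas R => mint m f).
Proof.
move=> cf bf; apply: (measurability (@RGenOInfty.G R)).
  exact: RGenOInfty.measurableE.
move=> _ [_ [r ->] <-]; rewrite setTI.
apply: sub_sigma_algebra.
by apply: open_comp; [move=> m _; exact: mint_continuous|exact: interval_open].
Qed.

End mint_functional.

Section isbm.
Context {R : realType} {d : measure_display} {Omega : measurableType d}.
Variables (P : probability Omega R) (F : R -> set (set Omega)).
Hypothesis hF : usual_conditions P F.
Variables (sigma : R -> R) (X : R -> Omega -> finmeas R).
Hypothesis sigma_ge0 : forall u : R, 0 <= u -> 0 <= sigma u.
Hypothesis hX : interacting_SBM P F sigma X.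
Implicit Types (f : R -> R) (s t u b : R) (w : Omega) (tau : Omega -> R).

Let sF (t : R) : 0 <= t -> sigma_algebra setT (F t) := uc_sigma_algebra hF (t:=t).
Let mF (t : R) : 0 <= t -> F t `<=` measurable := uc_measurable hF (t:=t).

Local Notation E := (E P).
Local Notation L1 := (L1 P).
Local Notation leb := (@lebesgue_measure R).

Definition obs f : R -> Omega -> R := fun s w => mint (X s w) f.
Definition mass : R -> Omega -> R := obs (cst 1).

Lemma mass_ge0 s w : 0 <= mass s w.
Proof. by apply: mint_ge0 => x. Qed.

Lemma obs_adapted f : continuous f -> bounded_fun f -> adapted F (obs f).
Proof.
move=> cf bf t t0 B mB.
have := isbm_adapted hX t0 (mint_measurable cf bf measurableT mB).
by rewrite setTI.
Qed.

Lemma obs_cpaths f : continuous f -> bounded_fun f -> cpaths (obs f).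
Proof.
move=> cf bf w s.
have cX := continuous_maxl (@isbm_continuous _ _ _ _ _ _ _ hX w).
have h := @continuous_comp _ _ _ (fun s : R => X (Num.max s 0) w) (fun m => mint m f) s (cX s).
by apply: h; exact: mint_continuous.
Qed.

Lemma cpaths_of (N : R -> Omega -> R) : continuous_paths N -> cpaths N.
Proof. by move=> cN w; exact: (@continuous_maxl R R (N ^~ w) (cN w)). Qed.

Lemma cst1_bounded : bounded_fun (cst 1 : R -> R).
Proof. by apply: (@bounded_fun1 _ _ 1) => x; rewrite normr1. Qed.

Lemma mass_adapted : adapted F mass.
Proof. by apply: obs_adapted; [move=> x; exact: cvg_cst|exact: cst1_bounded]. Qed.

Lemma mass_cpaths : cpaths mass.
Proof. by apply: obs_cpaths; [move=> x; exact: cvg_cst|exact: cst1_bounded]. Qed.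

(** The inequality [s < tau w] is strict so that [tau = 0] is always allowed: the
    initial mass may exceed [b], and where it does, stopping at once makes all
    the stopped quantities vanish. *)
Definition below b tau := forall w s, 0 <= s -> s < tau w -> mass s w <= b.

Lemma below_at b tau w s : below b tau -> 0 < tau w -> 0 <= s -> s <= tau w ->
  mass s w <= b.
Proof.
move=> bt t0 s0; rewrite le_eqVlt => /orP[/eqP ->|]; last exact: bt.
rewrite -(max_idPl (ltW t0)).
apply: (continuous_le_at (@mass_cpaths w)) => // u u0 ut.
by rewrite (max_idPl u0); exact: bt.
Qed.

(* Test functions with f'' = - k2 f make the drift of X(f) linear in X(f).  The
   constant function, with k2 = 0, gives the total mass; cosines and sines give
   the Fourier coefficients of X. *)
Section eigenfunction.
Variables (f : R -> R) (k2 : R).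
Hypotheses (f_C2 : C2 f) (f_cont : continuous f) (f1 : forall x, `|f x| <= 1).
Hypotheses (k20 : 0 <= k2) (f_eigen : derive1 (derive1 f) = fun x => - k2 * f x).

Local Notation Z := (obs f).
Local Notation M := (ISBM_M X f).
Local Notation A := (ISBM_QV sigma X f).

Let bf : bounded_fun f. Proof. exact: bounded_fun1 f1. Qed.

Lemma Z_le_mass s w : `|Z s w| <= mass s w.
Proof. exact: mint_norm_le_mass. Qed.

Let Zc w : continuous (fun s : R => Z (Num.max s 0) w).
Proof. exact: obs_cpaths. Qed.

Lemma Z_integrable w t : leb.-integrable `[0, t] (EFin \o (Z ^~ w)).
Proof.
have : leb.-integrable `[0, t] (EFin \o (fun s : R => Z (Num.max s 0) w)).
  apply: continuous_compact_integrable; first exact: segment_compact.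
  by apply: continuous_subspaceT => s; exact: Zc.
apply: eq_integrable => // s; rewrite inE/= in_itv/= => /andP[s0 _].
by rewrite (max_idPl s0).
Qed.

Definition Zint t w : R := \int[leb]_(s in `[0, t]) Z s w.

Lemma ISBM_ME t w : M t w = Z t w - Z 0 w + k2 / 2 * Zint t w.
Proof.
rewrite /ISBM_M f_eigen /Zint.
have -> : (fun s => mint (X s w) (fun x => - k2 * f x)) = (fun s => - k2 * Z s w).
  by apply/funext => s; rewrite /Z /obs /mint; apply: EZ; exact: L1_bcont.
by rewrite RintegralZl//; [rewrite !mulNr mulrN opprK mulrA [_^-1 * _]mulrC|exact: Z_integrable].
Qed.

Lemma Zint0 w : Zint 0 w = 0.
Proof. by rewrite /Zint set_itv1 Rintegral_set1. Qed.

Lemma ISBM_M0 w : M 0 w = 0.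
Proof. by rewrite ISBM_ME Zint0 mulr0 addr0 subrr. Qed.

Lemma ISBM_M_cpaths : cpaths M.
Proof. by apply: cpaths_of; have [_] := isbm_martingale hX f_C2. Qed.

Lemma ISBM_M_local : local_martingale P F M.
Proof. by have [] := isbm_martingale hX f_C2. Qed.

Lemma ISBM_M_adapted : adapted F M.
Proof. by have [] := ISBM_M_local. Qed.

Lemma ISBM_QV_cpaths : cpaths A.
Proof. by apply: cpaths_of; have [_ ? _ _ _] := isbm_quadratic_variation hX f_C2. Qed.

Lemma ISBM_QV_adapted : adapted F A.
Proof. by have [? _ _ _ _] := isbm_quadratic_variation hX f_C2. Qed.

Lemma ISBM_QV0 w : A 0 w = 0.
Proof. by have [_ _ h _ _] := isbm_quadratic_variation hX f_C2; exact: h. Qed.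

Lemma ISBM_M2_QV_local : local_martingale P F (fun t w => M t w ^+ 2 - A t w).
Proof. by have [_ _ _ _ ?] := isbm_quadratic_variation hX f_C2. Qed.

Lemma ISBM_M2_QV_cpaths : cpaths (fun t w => M t w ^+ 2 - A t w).
Proof.
move=> w s; apply: cvgB; last exact: ISBM_QV_cpaths.
rewrite expr2; under eq_fun do rewrite expr2.
by apply: cvgM; exact: ISBM_M_cpaths.
Qed.

Section stopped.
Variables (b t S : R) (tau : Omega -> R).
Hypotheses (b0 : 0 <= b) (t0 : 0 <= t) (S0 : 0 <= S).
Hypothesis hS : forall u, 0 <= u -> u <= b -> sigma u <= S.
Hypotheses (rs : bstop F t tau) (bt : below b tau).

Let tau0 w : 0 <= tau w. Proof. by have [/(_ w)/andP[]] := rs. Qed.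
Let taut w : tau w <= t. Proof. by have [/(_ w)/andP[]] := rs. Qed.

Lemma Z_bound w s : 0 < tau w -> 0 <= s -> s <= tau w -> `|Z s w| <= b.
Proof. by move=> ? ? ?; apply: le_trans (Z_le_mass _ _) _; exact: (below_at bt). Qed.

Lemma Zint_bound w s : 0 < tau w -> 0 <= s -> s <= tau w -> `|Zint s w| <= t * b.
Proof.
move=> tw s0 st; apply: (le_trans (le_normr_Rintegral _ (Z_integrable w s))) => //.
apply: (@le_trans _ _ (\int[leb]_(u in `[0, s]) b)).
  apply: le_Rintegral => //.
  - by apply: integrable_norm; exact: Z_integrable.
  - apply: (continuous_compact_integrable (f := fun=> b)); first exact: segment_compact.
    by apply: continuous_subspaceT => u; exact: cvg_cst.
  - move=> u; rewrite /= in_itv/= => /andP[u0 us].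
    by apply: Z_bound => //; exact: le_trans us st.
rewrite Rintegral_cst//= lebesgue_measure_itv /= lte_fin.
case: ifP => _ /=; last by rewrite mulr0 mulr_ge0.
by rewrite subr0 mulrC ler_wpM2r// (le_trans st).
Qed.

Definition Mbound : R := 2 * b + k2 / 2 * (t * b).

Lemma ISBM_M_bound w s : 0 <= s -> s <= tau w -> `|M s w| <= Mbound.
Proof.
move=> s0 st; have B0 : 0 <= Mbound by rewrite /Mbound addr_ge0// !mulr_ge0// divr_ge0.
have := tau0 w; rewrite le_eqVlt => /orP[/eqP tw|tw].
  have -> : s = 0 by apply: le_anti; rewrite s0 tw st.
  by rewrite ISBM_M0 normr0.
rewrite ISBM_ME /Mbound; apply: (le_trans (ler_normD _ _)); apply: lerD.
  apply: (le_trans (ler_normB _ _)); rewrite mulrDl mul1r; apply: lerD.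
    exact: Z_bound.
  by apply: Z_bound => //; exact: tau0.
rewrite normrM ger0_norm ?divr_ge0// ler_wpM2l ?divr_ge0//.
exact: Zint_bound.
Qed.

(** Branching is bounded as long as the mass is. *)
Lemma brate_section w s u : 0 < tau w -> s <= tau w -> 0 <= u -> u <= s ->
  0 <= mint (X u w) (brate sigma (X u w) f) <= S * b.
Proof.
move=> tw st u0 us; apply: brate_le => //.
by rewrite -mint_cst1; apply: (below_at bt tw) => //; exact: le_trans us st.
Qed.

(** The extended integral is finite by the bound on its integrand, so that it
    agrees with the real-valued bracket; estimates of the bracket can then be made
    by monotonicity of the extended integral. *)
Lemma EFin_ISBM_QV w s : 0 < tau w -> 0 <= s -> s <= tau w ->
  (A s w)%:E = (\int[leb]_(u in `[0%R, s]) (mint (X u w) (brate sigma (X u w) f))%:E)%E /\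
  0 <= A s w <= S * b * t.
Proof.
move=> tw s0 st; have H := @brate_section w s _ tw st.
have I0 : (0 <= \int[leb]_(u in `[0%R, s]) (mint (X u w) (brate sigma (X u w) f))%:E)%E.
  apply: integral_ge0 => u; rewrite /= in_itv/= => /andP[u0 us].
  by have /andP[h _] := H u u0 us; rewrite lee_fin.
have I1 : (\int[leb]_(u in `[0%R, s]) (mint (X u w) (brate sigma (X u w) f))%:E <= (S * b * t)%:E)%E.
  apply: (@le_trans _ _ (\int[leb]_(u in `[0%R, s]) (S * b)%:E)%E).
    apply: le_lower_integral => u; rewrite /= in_itv/= => /andP[u0 us];
      by have /andP[? ?] := H u u0 us; rewrite lee_fin.
  rewrite integral_cst//= lebesgue_measure_itv /= lte_fin; case: ifP => _ /=.
    rewrite -EFinB -EFinM lee_fin subr0 ler_wpM2l ?mulr_ge0//.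
    exact: le_trans st (taut w).
  by rewrite mule0 lee_fin !mulr_ge0.
have AE : (A s w)%:E = (\int[leb]_(u in `[0%R, s]) (mint (X u w) (brate sigma (X u w) f))%:E)%E.
  by rewrite /ISBM_QV /Rintegral fineK// ge0_fin_numE// (le_lt_trans I1)// ltry.
by split=> //; rewrite -!lee_fin AE I0.
Qed.

Lemma ISBM_QV_bound w s : 0 <= s -> s <= tau w -> 0 <= A s w <= S * b * t.
Proof.
move=> s0 st; have := tau0 w; rewrite le_eqVlt => /orP[/eqP tw|tw].
  have -> : s = 0 by apply: le_anti; rewrite s0 tw st.
  by rewrite ISBM_QV0 lexx !mulr_ge0.
by have [] := EFin_ISBM_QV tw s0 st.
Qed.

Lemma ISBM_M_tau_measurable : measurable_fun setT (fun w => M (tau w) w).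
Proof. by apply: (stopped_measurable hF t0 rs); [exact: ISBM_M_adapted|exact: ISBM_M_cpaths]. Qed.

Lemma ISBM_QV_tau_measurable : measurable_fun setT (fun w => A (tau w) w).
Proof. by apply: (stopped_measurable hF t0 rs); [exact: ISBM_QV_adapted|exact: ISBM_QV_cpaths]. Qed.

Lemma L1_ISBM_M_tau : L1 (fun w => M (tau w) w).
Proof. by apply: (L1_bounded P ISBM_M_tau_measurable (K := Mbound)) => w; exact: ISBM_M_bound. Qed.

Lemma L1_ISBM_QV_tau : L1 (fun w => A (tau w) w).
Proof.
apply: (L1_bounded P ISBM_QV_tau_measurable (K := S * b * t)) => w.
by have /andP[h1 h2] := ISBM_QV_bound (tau0 w) (lexx (tau w)); rewrite ger0_norm.
Qed.

Lemma L1_ISBM_M2_tau : L1 (fun w => M (tau w) w ^+ 2).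
Proof.
apply: (L1_bounded P (K := Mbound ^+ 2)); first exact: measurable_funX ISBM_M_tau_measurable.
move=> w; rewrite normrX ler_pXn2r ?nnegrE//; first exact: ISBM_M_bound.
exact: le_trans (normr_ge0 _) (ISBM_M_bound (tau0 w) (lexx _)).
Qed.

Lemma E_ISBM_M_tau : E (fun w => M (tau w) w) = 0.
Proof.
rewrite (local_martingale_stopping hF t0 rs ISBM_M_local ISBM_M_cpaths (K := Mbound)).
  rewrite (_ : M 0 = fun=> 0); first exact: E0.
  by apply/funext => w; exact: ISBM_M0.
by move=> w s; exact: ISBM_M_bound.
Qed.

(** Optional stopping for [M^2 - A]. *)
Lemma E_ISBM_M2_tau : E (fun w => M (tau w) w ^+ 2) = E (fun w => A (tau w) w).
Proof.
apply/eqP; rewrite -subr_eq0 -EB; [|exact: L1_ISBM_M2_tau|exact: L1_ISBM_QV_tau].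
rewrite (local_martingale_stopping hF t0 rs ISBM_M2_QV_local ISBM_M2_QV_cpaths (K := Mbound ^+ 2 + S * b * t)).
  rewrite (_ : (fun w => _) = fun=> 0); first by rewrite E0.
  by apply/funext => w; rewrite ISBM_M0 ISBM_QV0 expr0n subr0.
move=> w s s0 st; apply: (le_trans (ler_normB _ _)); apply: lerD.
  rewrite normrX ler_pXn2r ?nnegrE//; first exact: ISBM_M_bound.
  exact: le_trans (normr_ge0 _) (ISBM_M_bound s0 st).
by have /andP[h1 h2] := ISBM_QV_bound s0 st; rewrite ger0_norm.
Qed.

Lemma E_ISBM_QV_tau_le : E (fun w => A (tau w) w) <= S * b * t.
Proof.
rewrite -(E_prob_cst P (S * b * t)); apply: E_le; [exact: L1_ISBM_QV_tau|exact: L1_cst|].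
by move=> w; have /andP[] := ISBM_QV_bound (tau0 w) (lexx (tau w)).
Qed.

Definition alive : set (Omega * measurableTypeR R) :=
  [set x | 0 <= x.2 /\ x.2 < tau x.1].

(** Integrals over the random interval from [0] to [tau] become integrals over all
    times of functions on the product space, to which Fubini's theorem applies;
    the cut-off at [0] makes [Z] jointly measurable there. *)
Definition alive_obs (x : Omega * measurableTypeR R) : R :=
  \1_alive x * Z (Num.max x.2 0) x.1.

(** The increment of [M] from [s] to [tau]; the cut-offs at [0] and [tau] make it
    a bounded function of all real times [s]. *)
Definition remaining_increment (x : Omega * measurableTypeR R) : R :=
  M (tau x.1) x.1 - M (Num.min (Num.max x.2 0) (tau x.1)) x.1.

Let tau_meas : measurable_fun setT tau.
Proof. exact: measurable_wrt_fun (mF t0) (bstop_wrt hF t0 rs). Qed.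

Lemma alive_measurable : measurable alive.
Proof.
have m2 : measurable_fun setT (fun x : Omega * measurableTypeR R => x.2 : R).
  exact: measurable_snd.
have -> : alive = (fun x => (0 <= x.2) && (x.2 < tau x.1)) @^-1` [set true].
  by apply/seteqP; split => x /=; [move=> [-> ->]|move=> /andP].
rewrite -[X in measurable X]setTI.
suff : measurable_fun setT (fun x : Omega * measurableTypeR R => (0 <= x.2) && (x.2 < tau x.1)).
  by apply.
apply: measurable_and.
  by apply: measurable_fun_ler => //; exact: measurable_cst.
by apply: measurable_fun_ltr => //; exact: measurableT_comp.
Qed.

Lemma joint_swap (N : R -> Omega -> R) : adapted F N -> cpaths N ->
  measurable_fun setT (fun x : Omega * measurableTypeR R => N (Num.max x.2 0) x.1).
Proof.
move=> aN cN.
have := @joint_measurable R d Omega N.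
have mN s : 0 <= s -> measurable_fun setT (N s).
  by move=> s0; apply: measurable_wrt_fun (mF s0) _; exact: aN.
move=> /(_ mN cN) h.
exact: (measurableT_comp h (measurable_swap (T1 := Omega) (T2 := measurableTypeR R))).
Qed.

Lemma alive_obs_measurable : measurable_fun setT alive_obs.
Proof.
apply: measurable_funM; first by apply: measurable_indic; exact: alive_measurable.
by apply: joint_swap; [exact: obs_adapted|exact: obs_cpaths].
Qed.

Lemma remaining_increment_measurable : measurable_fun setT remaining_increment.
Proof.
apply: measurable_funB.
  exact: (measurableT_comp ISBM_M_tau_measurable measurable_fst).
apply: (@joint_swap (fun s w => M (Num.min s (tau w)) w)).
  exact: (stopped_min_adapted hF rs ISBM_M_adapted ISBM_M_cpaths).
exact: (stopped_min_cpaths rs ISBM_M_cpaths).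
Qed.

Lemma alive_obs_bound x : `|alive_obs x| <= b * \1_(`[0, t]%classic : set R) x.2.
Proof.
rewrite /alive_obs; case: (pselect (alive x)) => [al|nal].
  have [x0 xt] := al; rewrite !indicE !mem_set//; last first.
    by rewrite /= in_itv/= x0 (le_trans (ltW xt)).
  rewrite mul1r mulr1 (max_idPl x0); apply: Z_bound => //; last exact: ltW.
  exact: le_lt_trans x0 xt.
by rewrite indicE memNset// mul0r normr0 mulr_ge0.
Qed.

Lemma remaining_increment_bound x : `|remaining_increment x| <= 2 * Mbound.
Proof.
rewrite /remaining_increment; apply: (le_trans (ler_normB _ _)); rewrite mulrDl mul1r; apply: lerD.
  exact: ISBM_M_bound.
by apply: ISBM_M_bound; rewrite ?ge_min ?lexx ?orbT// le_min tau0 le_max lexx orbT.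
Qed.

Let mgd : measurable_fun setT (fun x => alive_obs x * remaining_increment x).
Proof. by apply: measurable_funM; [exact: alive_obs_measurable|exact: remaining_increment_measurable]. Qed.

Let bgd x : `|alive_obs x * remaining_increment x| <= (b * (2 * Mbound)) * \1_(`[0, t]%classic : set R) x.2.
Proof.
rewrite normrM mulrAC; apply: ler_pM => //; [exact: alive_obs_bound|exact: remaining_increment_bound].
Qed.

Let mgg2 : measurable_fun setT (fun x => alive_obs x ^+ 2).
Proof. by apply: measurable_funX; exact: alive_obs_measurable. Qed.

Let bgg2 x : `|alive_obs x ^+ 2| <= b ^+ 2 * \1_(`[0, t]%classic : set R) x.2.
Proof.
have := alive_obs_bound x; rewrite indicE; case: (_ \in _) => /=.
  by rewrite !mulr1 => h; rewrite normrX ler_pXn2r ?nnegrE.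
by rewrite !mulr0 normr_le0 => /eqP ->; rewrite expr0n normr0.
Qed.

Definition energy w : R := \int[leb]_s (alive_obs (w, s) ^+ 2).
Definition cross w : R := \int[leb]_s (alive_obs (w, s) * remaining_increment (w, s)).

Lemma L1_energy : L1 energy.
Proof. exact: (section_int_L1 P mgg2 bgg2 t0). Qed.

(** Before [tau], the value [Z s] is known at time [s], hence orthogonal to the
    remaining increment; integrate over [s]. *)
Lemma E_cross : L1 cross /\ E cross = 0.
Proof.
split; first exact: (section_int_L1 P mgd bgd t0).
rewrite /cross (compact_fubini P mgd bgd t0).
rewrite (eq_Rintegral _ (g := fun=> 0)); first by rewrite Rintegral_cst//= mul0r.
move=> s _; have [s0|s0] := leP 0 s; last first.
  rewrite (_ : (fun w => _) = fun=> 0); first exact: E0.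
  apply/funext => w; rewrite /alive_obs indicE memNset ?mul0r// => -[/=].
  by rewrite leNgt s0.
have [st|ts] := leP s t; last first.
  rewrite (_ : (fun w => _) = fun=> 0); first exact: E0.
  apply/funext => w; rewrite /alive_obs indicE memNset ?mul0r// => -[/= _ h].
  by have := lt_le_trans h (taut w); rewrite ltNge (ltW ts).
have := @increment_orth R d Omega P F hF M t Mbound s tau s0 st rs ISBM_M_local ISBM_M_cpaths ISBM_M_bound
  (fun w => alive_obs (w, s)) b.
rewrite /remaining_increment /= (max_idPl s0); apply.
  have -> : (fun w => alive_obs (w, s)) = (fun w => \1_(~` [set w | tau w <= s]) w * Z s w).
    apply/funext => w; rewrite /alive_obs !indicE /= (max_idPl s0); congr ((nat_of_bool _)%:R * _).
    apply/idP/idP; rewrite !inE /alive /=; first by move=> [_]; rewrite ltNge => /negP.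
    by move=> /negP; rewrite -ltNge.
  apply: measurable_wrt_indicM (sF s0) _ _ _ _.
    by apply: salg_setC (sF s0) _ _; have [_] := rs; exact.
  exact: obs_adapted.
by move=> w; apply: (le_trans (alive_obs_bound _)); rewrite -[leRHS]mulr1 ler_wpM2l.
Qed.

(** A form of Ito's formula for [Z^2] that holds path by path.  Put
    [c = k2 / 2], [I s = \int_0^s Z] and [a = M_tau + Z_0].  The equation
    [Z = Z_0 + M - c I] reads [M_tau - M_s = a - Z_s - c I_s], so
    [energy + cross] is the integral of [Z (a - c I)], which is
    [a I_tau - c/2 I_tau^2].  Multiplied by [c] this is at most
    [a^2 / 2 <= M_tau^2 + Z_0^2]. *)
Lemma energy_pathwise w :
  k2 / 2 * energy w <= M (tau w) w ^+ 2 + b ^+ 2 - k2 / 2 * cross w.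
Proof.
have := tau0 w; rewrite le_eqVlt => /orP[/eqP tw|tw].
  have g0 s : alive_obs (w, s) = 0.
    rewrite /alive_obs indicE memNset ?mul0r// => -[/= h1 h2].
    by have := le_lt_trans h1 h2; rewrite -tw ltxx.
  have -> : energy w = 0.
    rewrite /energy (eq_Rintegral _ (g := fun=> 0)); first by rewrite Rintegral_cst//= mul0r.
    by move=> s _; rewrite g0 expr0n.
  have -> : cross w = 0.
    rewrite /cross (eq_Rintegral _ (g := fun=> 0)); first by rewrite Rintegral_cst//= mul0r.
    by move=> s _; rewrite g0 mul0r.
  by rewrite !mulr0 subr0 addr_ge0// sqr_ge0.
pose z (s : R) := Z (Num.max s 0) w.
pose a := M (tau w) w + Z 0 w.
pose I (s : R) : R := \int[leb]_(u in `[0, s]) z u.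
have IE s : Zint s w = I s.
  apply: eq_Rintegral => u; rewrite inE/= in_itv/= => /andP[u0 _].
  by rewrite /z (max_idPl u0).
have key : energy w + cross w = a * I (tau w) - k2 / 2 / 2 * I (tau w) ^+ 2.
  rewrite /energy /cross -RintegralD//; last 2 first.
  - exact: (section_integrable mgg2 bgg2 t0).
  - exact: (section_integrable mgd bgd t0).
  rewrite -(cst_minus_primitive_int a (k2 / 2) (Zc (w:=w)) tw).
  (* The energy is over [0, tau[, the primitive over [0, tau]. *)
  rewrite -Rintegral_itv_bndo_bndc; last first.
    have int : leb.-integrable `[0, tau w]
        (EFin \o (fun s => Z (Num.max s 0) w * (a - k2 / 2 * I s))).
      apply: continuous_compact_integrable; first exact: segment_compact.
      move=> s; apply: cvgM.
        by have := continuous_subspaceT (A := `[0, tau w]%classic) (Zc (w:=w)) => /(_ s).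
      apply: cvgB; first exact: cvg_cst.
      apply: cvgM; first exact: cvg_cst.
      apply: parameterized_integral_continuous; first exact: ltW.
      apply: continuous_compact_integrable; first exact: segment_compact.
      by apply: continuous_subspaceT; exact: Zc.
    apply: (integrableS _ _ _ int) => //.
    by move=> s /=; rewrite !in_itv/= => /andP[-> /ltW ->].
  rewrite [RHS]Rintegral_mkcond; apply: eq_Rintegral => s _.
  rewrite patchE /alive_obs indicE.
  have -> : (s \in `[0, tau w[%classic) = ((w, s) \in alive).
    by apply/idP/idP; rewrite !inE /alive /= in_itv/= => /andP.
  case: (boolP (_ \in _)); last by rewrite !mul0r expr0n addr0.
  rewrite inE => -[/= s0 st]; rewrite !mul1r /remaining_increment /= (max_idPl s0) (min_idPl (ltW st)).
  by rewrite [M s w]ISBM_ME IE /a /I /z; ring.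
have Z0b : Z 0 w ^+ 2 <= b ^+ 2.
  rewrite -real_normK ?num_real// ler_pXn2r ?nnegrE//.
  exact: Z_bound.
have -> : k2 / 2 * cross w = k2 / 2 * (a * I (tau w) - k2 / 2 / 2 * I (tau w) ^+ 2) - k2 / 2 * energy w.
  by rewrite -key; ring.
(* The two squares complete, respectively, a x - x^2/2 <= a^2/2 for x = c I_tau
   and (M_tau + Z_0)^2 / 2 <= M_tau^2 + Z_0^2. *)
have h1 : 0 <= (a - k2 / 2 * I (tau w)) ^+ 2 by exact: sqr_ge0.
have h2 : 0 <= (M (tau w) w - Z 0 w) ^+ 2 by exact: sqr_ge0.
rewrite /a in h1 *; move: h1 h2 Z0b.
set m := M _ _; set z0 := Z 0 w; set i := I _; set e := energy _; set c := k2 / 2.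
nra.
Qed.

(** The right-hand side does not involve [k2]: the energy of the Fourier
    coefficient of frequency [k] is of order [1 / k^2], hence summable. *)
Lemma energy_bound : k2 / 2 * E energy <= S * b * t + b ^+ 2.
Proof.
have [iC EC] := E_cross.
have i1 := L1_energy; have i2 := L1_ISBM_M2_tau.
have i3 : L1 (fun w => M (tau w) w ^+ 2 + b ^+ 2) by apply: L1D => //; exact: L1_cst.
rewrite -EZ//; apply: (@le_trans _ _ (E (fun w => M (tau w) w ^+ 2 + b ^+ 2 - k2 / 2 * cross w))).
  apply: E_le; [exact: L1Z|by apply: L1B => //; exact: L1Z|exact: energy_pathwise].
rewrite EB//; last exact: L1Z.
rewrite EZ// EC mulr0 subr0 ED//; last exact: L1_cst.
by rewrite E_prob_cst lerD2r E_ISBM_M2_tau; exact: E_ISBM_QV_tau_le.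
Qed.

End stopped.
End eigenfunction.
End isbm.

(** * Constant and trigonometric test functions *)

Section trig.
Context {R : realType}.
Implicit Types (k x : R).

Lemma is_derive_kcos k x : is_derive x 1 (fun x : R => cos (k * x)) (- k * sin (k * x)).
Proof.
have h : is_derive x 1 (fun x : R => k * x) k.
  have -> : (fun x : R => k * x) = k *: id by apply/funext.
  by apply: is_derive_eq; rewrite /GRing.scale /= mulr1.
apply: (is_derive_eq (is_derive1_comp (is_derive_cos (k * x)) h)).
by rewrite mulrC mulrN mulNr.
Qed.

Lemma is_derive_ksin k x : is_derive x 1 (fun x : R => sin (k * x)) (k * cos (k * x)).
Proof.
have h : is_derive x 1 (fun x : R => k * x) k.
  have -> : (fun x : R => k * x) = k *: id by apply/funext.
  by apply: is_derive_eq; rewrite /GRing.scale /= mulr1.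
apply: (is_derive_eq (is_derive1_comp (is_derive_sin (k * x)) h)).
by rewrite mulrC.
Qed.

Lemma derive1_kcos k : derive1 (fun x : R => cos (k * x)) = fun x => - k * sin (k * x).
Proof. by apply/funext => x; rewrite derive1E; have [_ ->] := is_derive_kcos k x. Qed.

Lemma derive1_ksin k : derive1 (fun x : R => sin (k * x)) = fun x => k * cos (k * x).
Proof. by apply/funext => x; rewrite derive1E; have [_ ->] := is_derive_ksin k x. Qed.

Lemma is_derive_scale (f : R -> R) (c x df : R) : is_derive x 1 f df ->
  is_derive x 1 (fun x => c * f x) (c * df).
Proof.
by move=> h; have -> : (fun x => c * f x) = c *: f by []; apply: is_deriveZ.
Qed.

Lemma derive1_scale (f : R -> R) (c : R) : (forall x, derivable f x 1) ->
  derive1 (fun x => c * f x) = fun x => c * derive1 f x.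
Proof.
move=> df; apply/funext => x; rewrite !derive1E.
have h : is_derive x 1 f ('D_1 f x) by apply: DeriveDef.
by have [_ ->] := is_derive_scale c h.
Qed.

Lemma kcos_derivable k x : derivable (fun x : R => cos (k * x)) x 1.
Proof. by have [] := is_derive_kcos k x. Qed.

Lemma ksin_derivable k x : derivable (fun x : R => sin (k * x)) x 1.
Proof. by have [] := is_derive_ksin k x. Qed.

Lemma kcos_eigen k :
  derive1 (derive1 (fun x : R => cos (k * x))) = fun x => - k ^+ 2 * cos (k * x).
Proof.
rewrite derive1_kcos derive1_scale; last by move=> x; exact: ksin_derivable.
by apply/funext => x; rewrite derive1_ksin; ring.
Qed.

Lemma ksin_eigen k :
  derive1 (derive1 (fun x : R => sin (k * x))) = fun x => - k ^+ 2 * sin (k * x).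
Proof.
rewrite derive1_ksin derive1_scale; last by move=> x; exact: kcos_derivable.
by apply/funext => x; rewrite derive1_kcos; ring.
Qed.

Lemma kcos_continuous k : continuous (fun x : R => cos (k * x)).
Proof. by move=> x; apply: differentiable_continuous; apply/derivable1_diffP; exact: kcos_derivable. Qed.

Lemma ksin_continuous k : continuous (fun x : R => sin (k * x)).
Proof. by move=> x; apply: differentiable_continuous; apply/derivable1_diffP; exact: ksin_derivable. Qed.

Lemma kcos_le1 k x : `|cos (k * x)| <= 1.
Proof. by rewrite ler_norml cos_geN1 cos_le1. Qed.

Lemma ksin_le1 k x : `|sin (k * x)| <= 1.
Proof. by rewrite ler_norml sin_geN1 sin_le1. Qed.

Lemma bounded_scale (f : R -> R) (c : R) : (forall x, `|f x| <= 1) ->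
  bounded_fun (fun x => c * f x).
Proof.
move=> f1; apply: (@bounded_fun1 _ _ `|c|) => x.
by rewrite normrM -[leRHS]mulr1 ler_wpM2l.
Qed.

Lemma continuous_scale (f : R -> R) (c : R) : continuous f -> continuous (fun x => c * f x).
Proof. by move=> cf x; apply: cvgM; [exact: cvg_cst|exact: cf]. Qed.

Lemma kcos_C2 k : C2 (fun x : R => cos (k * x)).
Proof.
split.
- by move=> x; exact: kcos_derivable.
- move=> x; rewrite derive1_kcos.
  by have [] := is_derive_scale (- k) (is_derive_ksin k x).
- by rewrite kcos_eigen; apply: continuous_scale; exact: kcos_continuous.
- rewrite kcos_eigen derive1_kcos; split.
  + by apply: (@bounded_fun1 _ _ 1) => x; exact: kcos_le1.
  + by apply: bounded_scale => x; exact: ksin_le1.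
  + by apply: bounded_scale => x; exact: kcos_le1.
Qed.

Lemma ksin_C2 k : C2 (fun x : R => sin (k * x)).
Proof.
split.
- by move=> x; exact: ksin_derivable.
- move=> x; rewrite derive1_ksin.
  by have [] := is_derive_scale k (is_derive_kcos k x).
- by rewrite ksin_eigen; apply: continuous_scale; exact: ksin_continuous.
- rewrite ksin_eigen derive1_ksin; split.
  + by apply: (@bounded_fun1 _ _ 1) => x; exact: ksin_le1.
  + by apply: bounded_scale => x; exact: kcos_le1.
  + by apply: bounded_scale => x; exact: ksin_le1.
Qed.

Lemma cst1_eigen : derive1 (derive1 (cst 1 : R -> R)) = fun x => - 0 * (cst 1 : R -> R) x.
Proof.
have d1 (c : R) : derive1 (cst c : R -> R) = cst 0.
  by apply/funext => x; rewrite derive1E derive_cst.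
by rewrite !d1; apply/funext => x; rewrite oppr0 mul0r.
Qed.

Lemma cst1_C2 : C2 (cst 1 : R -> R).
Proof.
have d1 (c : R) : derive1 (cst c : R -> R) = cst 0.
  by apply/funext => x; rewrite derive1E derive_cst.
have b0 (c : R) : bounded_fun (cst c : R -> R).
  by apply: (@bounded_fun1 _ _ `|c|) => x.
by rewrite /C2 !d1; split => //; try (by move=> x; exact: cvg_cst).
Qed.

End trig.

(** * The measures X_s have no atoms *)

Section ae_series.
Context {R : realType} {d : measure_display} {Omega : measurableType d}.
Variables (P : probability Omega R).
Local Notation leb := (@lebesgue_measure R).

(** By Tonelli the series of the [e k] is integrable over chance and time, hence
    finite almost everywhere, and the terms of a convergent series tend to
    zero. *)
Lemma ae_series_cvg0 (e : nat -> Omega * measurableTypeR R -> R) (C c : nat -> R) (B t : R) :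
  0 <= t -> (forall k, measurable_fun setT (e k)) -> (forall k x, 0 <= e k x) ->
  (forall k x, `|e k x| <= C k * \1_(`[0, t]%classic : set R) x.2) ->
  (forall k, E P (fun w => \int[leb]_s e k (w, s)) <= c k) ->
  (forall n, \sum_(0 <= k < n) c k <= B) ->
  {ae P, forall w, {ae leb, forall s : R, e k (w, s) @[k --> \oo] --> 0}}.
Proof.
move=> t0 me e0 eC ec cB.
pose H (x : Omega * measurableTypeR R) : \bar R := (\sum_(k <oo) (e k x)%:E)%E.
have mH : measurable_fun setT H.
  by apply: ge0_emeasurable_sum => [k x _ _|k _]; [rewrite lee_fin|exact/measurable_EFinP].
have H0 x : (0 <= H x)%E by apply: nneseries_ge0 => k _ _; rewrite lee_fin.
have Ik k : (\int[(P \x leb)%E]_x (e k x)%:E = (E P (fun w => \int[leb]_s e k (w, s)))%:E)%E.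
  rewrite (EFin_E (section_int_L1 P (me k) (eC k) t0)).
  rewrite (fubini_tonelli1 (EFin \o e k)) //; last 2 first.
  - exact/measurable_EFinP.
  - by move=> x; rewrite lee_fin.
  by apply: eq_integral => w _; rewrite (EFin_section_int (me k) (eC k) t0 w).
have iH : (P \x leb)%E.-integrable setT H.
  apply/integrableP; split => //.
  under eq_integral do rewrite gee0_abs//.
  rewrite integral_nneseries//; last 2 first.
  - by move=> k; exact/measurable_EFinP.
  - by move=> k x _; rewrite lee_fin.
  apply: (@le_lt_trans _ _ B%:E); last by rewrite ltry.
  apply: lime_le.
    by apply: is_cvg_nneseries => k _ _; apply: integral_ge0 => x _; rewrite lee_fin.
  apply: nearW => n; under eq_bigr do rewrite Ik.
  rewrite sumEFin lee_fin; apply: le_trans (cB n); apply: ler_sum => k _; exact: ec.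
have := ae_integrable1 iH; apply: filterS => w iw.
have := integrable_ae measurableT iw; apply: filterS => s /(_ I) fs.
apply: cvg_series_cvg_0; apply: nondecreasing_is_cvgn.
  by apply/nondecreasing_seqP => n; rewrite /series /= big_nat_recr//= lerDl.
exists (fine (H (w, s))) => _ [n _ <-]; rewrite -lee_fin fineK// /series /= -sumEFin.
by apply: nneseries_lim_ge => k _ _; rewrite lee_fin.
Qed.

(** Comparison with the telescoping series of [1/k - 1/(k+1)]. *)
Lemma sum_inv_sqr (n : nat) : \sum_(0 <= k < n) (k.+1%:R ^+ 2)^-1 <= 2 :> R.
Proof.
suff H m : \sum_(0 <= k < m.+1) (k.+1%:R ^+ 2)^-1 <= 2 - m.+1%:R^-1 :> R.
  case: n => [|n]; first by rewrite big_nil.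
  by apply: (le_trans (H n)); rewrite lerBlDr lerDl.
elim: m => [|m IH]; first by rewrite big_nat1 expr1n invr1; lra.
rewrite big_nat_recr//=.
have m1 : m.+1%:R != 0 :> R by [].
have m2 : m.+2%:R != 0 :> R by [].
have e : m.+1%:R^-1 - m.+2%:R^-1 = (m.+1%:R * m.+2%:R)^-1 :> R.
  have h (x y : R) : x != 0 -> y != 0 -> y = x + 1 -> x^-1 - y^-1 = (x * y)^-1.
    move=> x0 y0 yx; apply: (mulfI (mulf_neq0 x0 y0)).
    rewrite mulfV ?mulf_neq0// mulrBr [x * y * x^-1]mulrAC mulfV// mul1r mulfK// yx.
    by rewrite addrAC subrr add0r.
  by apply: h => //; rewrite natr1.
have : (m.+2%:R ^+ 2)^-1 <= m.+1%:R^-1 - m.+2%:R^-1 :> R.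
  rewrite e lef_pV2 ?posrE ?mulr_gt0 ?exprn_gt0//.
  by rewrite expr2 ler_wpM2r// ler_nat.
move: IH; set a := \sum_(_ <= _ < _) _; set x := m.+1%:R^-1; set y := m.+2%:R^-1; set v := (_ ^+ 2)^-1.
lra.
Qed.

End ae_series.

Lemma cvg0_of_sqr {R : realType} (u v : nat -> R) :
  (forall k, u k ^+ 2 <= v k) -> v k @[k --> \oo] --> 0 -> u k @[k --> \oo] --> 0.
Proof.
move=> uv v0; apply/cvgrPdist_lt => e e0.
have e20 : 0 < e ^+ 2 by rewrite exprn_gt0.
move/cvgrPdist_lt : v0 => /(_ _ e20); apply: filterS => k; rewrite !sub0r !normrN => vk.
have : `|u k| ^+ 2 < e ^+ 2.
  by rewrite real_normK ?num_real//; apply: le_lt_trans (uv k) _; exact: le_lt_trans (ler_norm _) vk.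
by rewrite ltr_pXn2r// nnegrE// ltW.
Qed.

(** * Extinction of the total mass *)

Section extinction.
Context {R : realType} {d : measure_display} {Omega : measurableType d}.
Variables (P : probability Omega R) (F : R -> set (set Omega)).
Hypothesis hF : usual_conditions P F.
Variables (sigma : R -> R) (X : R -> Omega -> finmeas R).
Hypothesis sigma_ge0 : forall u : R, 0 <= u -> 0 <= sigma u.
Hypothesis sigma_borel : measurable_fun (`[0, +oo[ : set R) sigma.
Hypothesis sigma_bounded :
  forall n : nat, (1 <= n)%N -> [bounded sigma u | u in `[0, n%:R]].
Hypothesis sigma_zeros :
  lebesgue_measure [set u : R | 0 <= u /\ sigma u = 0] = 0%E.
Hypothesis hX : interacting_SBM P F sigma X.
Implicit Types (f : R -> R) (s t u a b : R) (w : Omega) (tau : Omega -> R).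

Local Notation E := (E P).
Local Notation L1 := (L1 P).
Local Notation leb := (@lebesgue_measure R).
Local Notation Y := (mass X).

Let aY : adapted F Y := mass_adapted hX.
Let cY : cpaths Y := mass_cpaths hX.

Lemma below_hit b t : 0 <= t -> below X b (hit Y b t).
Proof. by move=> t0 w s s0 sh; apply: ltW; exact: hit_lt sh. Qed.

Lemma below_min b tau tau' : below X b tau -> below X b (fun w => Num.min (tau' w) (tau w)).
Proof. by move=> bt w s s0; rewrite lt_min => /andP[_]; exact: bt. Qed.

Section atomless.
Variables (b t : R) (tau : Omega -> R).
Hypotheses (b0 : 0 <= b) (t0 : 0 <= t) (rs : bstop F t tau) (bt : below X b tau).

Let kc (k : nat) (x : R) : R := cos (k.+1%:R * x).
Let ks (k : nat) (x : R) : R := sin (k.+1%:R * x).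

(** The energies of the cosine and sine coefficients of frequency [k + 1] add up
    to at most a constant over [(k + 1)^2], so by [ae_series_cvg0] all Fourier
    coefficients tend to zero at almost every time before [tau], and
    [fourier_no_atom] applies. *)
Lemma ae_atomless : {ae P, forall w, {ae leb, forall s : R,
  0 <= s -> s < tau w -> forall x : R, X s w [set x] = 0%E}}.
Proof.
have [S S0 hS] := sigma_sup sigma_bounded b.
pose e k x := alive_obs X (kc k) tau x ^+ 2 + alive_obs X (ks k) tau x ^+ 2.
pose CC := S * b * t + b ^+ 2.
have cc k : continuous (kc k) by exact: kcos_continuous.
have cs k : continuous (ks k) by exact: ksin_continuous.
have c1 k x : `|kc k x| <= 1 by exact: kcos_le1.
have s1 k x : `|ks k x| <= 1 by exact: ksin_le1.
have mc k := alive_obs_measurable hF hX (cc k) (c1 k) t0 rs.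
have ms k := alive_obs_measurable hF hX (cs k) (s1 k) t0 rs.
have bc k x := alive_obs_bound hX (cc k) (c1 k) b0 rs bt x.
have bs k x := alive_obs_bound hX (cs k) (s1 k) b0 rs bt x.
have k0 (k : nat) : 0 <= k.+1%:R ^+ 2 :> R by exact: sqr_ge0.
have ec k := energy_bound hF sigma_ge0 hX (kcos_C2 k.+1%:R) (cc k) (c1 k) (k0 k)
  (kcos_eigen k.+1%:R) b0 t0 S0 hS rs bt.
have es k := energy_bound hF sigma_ge0 hX (ksin_C2 k.+1%:R) (cs k) (s1 k) (k0 k)
  (ksin_eigen k.+1%:R) b0 t0 S0 hS rs bt.
have ic k := L1_energy hF hX (cc k) (c1 k) b0 t0 rs bt.
have iss k := L1_energy hF hX (cs k) (s1 k) b0 t0 rs bt.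
have sq2 (g C i : R) : `|g| <= C * i -> i ^+ 2 = i -> 0 <= C -> `|g ^+ 2| <= C ^+ 2 * i.
  move=> gC ii C0; rewrite normrX -[X in _ <= _ * X]ii -exprMn ler_pXn2r ?nnegrE//.
  exact: le_trans gC.
have I2 (s : R) : (\1_(`[0, t]%classic : set R) s : R) ^+ 2 = \1_(`[0, t]%classic : set R) s.
  by rewrite indicE; case: (_ \in _); rewrite ?expr1n ?expr0n.
have mc2 k : measurable_fun setT (fun x => alive_obs X (kc k) tau x ^+ 2).
  by apply: measurable_funX; exact: mc.
have ms2 k : measurable_fun setT (fun x => alive_obs X (ks k) tau x ^+ 2).
  by apply: measurable_funX; exact: ms.
have bc2 k x := sq2 _ _ _ (bc k x) (I2 x.2) b0.
have bs2 k x := sq2 _ _ _ (bs k x) (I2 x.2) b0.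
have := @ae_series_cvg0 R d Omega P e (fun=> b ^+ 2 + b ^+ 2)
  (fun k => (4 * CC) * (k.+1%:R ^+ 2)^-1) (4 * CC * 2) t t0.
have CC0 : 0 <= CC by rewrite addr_ge0 ?sqr_ge0// !mulr_ge0.
case.
- by move=> k; apply: measurable_funD.
- by move=> k x; rewrite addr_ge0 ?sqr_ge0.
- move=> k x; rewrite mulrDl; apply: (le_trans (ler_normD _ _)); apply: lerD; [exact: bc2|exact: bs2].
- move=> k.
  have -> : (fun w => \int[leb]_s e k (w, s)) = (fun w => energy X (kc k) tau w + energy X (ks k) tau w).
    apply/funext => w; rewrite /energy -RintegralD//.
      exact: (section_integrable (mc2 k) (bc2 k) t0).
    exact: (section_integrable (ms2 k) (bs2 k) t0).
  rewrite (ED (ic k) (iss k)).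
  have kk : 0 < k.+1%:R ^+ 2 :> R by rewrite exprn_gt0.
  have aux (x p q C : R) : x / 2 * p <= C -> x / 2 * q <= C -> (p + q) * x <= 4 * C.
    by lra.
  by rewrite ler_pdivlMr//; exact: (aux _ _ _ _ (ec k) (es k)).
- by move=> n; rewrite -mulr_sumr ler_wpM2l ?mulr_ge0// sum_inv_sqr.
move=> N [mN N0 sN]; exists N; split => // w nw; apply: sN => /= nw2; apply: nw.
case: nw2 => N' [mN' N'0 sN']; exists N'; split => // s ns; apply: sN' => /= cv; apply: ns.
move=> s0 st x; have al : alive tau (w, s) by [].
have ggE f : alive_obs X f tau (w, s) = mint (X s w) f.
  by rewrite /alive_obs indicE mem_set// mul1r /= (max_idPl s0).
apply: fourier_no_atom.
  rewrite -cvg_shiftS; apply: (cvg0_of_sqr (v := fun k => e k (w, s))) => // k.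
  by rewrite /e /= ggE /fcos lerDl sqr_ge0.
rewrite -cvg_shiftS; apply: (cvg0_of_sqr (v := fun k => e k (w, s))) => // k.
by rewrite /e /= [alive_obs X (ks k) _ _]ggE /fsin lerDr sqr_ge0.
Qed.

Let cst1c : continuous (cst 1 : R -> R). Proof. by move=> x; exact: cvg_cst. Qed.
Let cst1n (x : R) : `|(cst 1 : R -> R) x| <= 1. Proof. by rewrite normr1. Qed.

Local Notation A := (ISBM_QV sigma X (cst 1)).
Local Notation M := (ISBM_M X (cst 1)).

Lemma ISBM_M_mass s w : M s w = Y s w - Y 0 w.
Proof. by rewrite (ISBM_ME hX cst1c cst1n cst1_eigen) mul0r mul0r addr0. Qed.

Lemma L1_ISBM_M : L1 (fun w => M (tau w) w).
Proof. exact: (L1_ISBM_M_tau hF hX cst1_C2 cst1c cst1n (lexx 0) cst1_eigen b0 t0 rs bt). Qed.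

Lemma E_ISBM_M : E (fun w => M (tau w) w) = 0.
Proof. exact: (E_ISBM_M_tau hF hX cst1_C2 cst1c cst1n (lexx 0) cst1_eigen b0 t0 rs bt). Qed.

(** Both [Y_tau] and [Y_0] lie in [0, b], unless [tau = 0]. *)
Lemma ISBM_M_le w : `|M (tau w) w| <= b.
Proof.
have /andP[h0 _] := (proj1 rs) w.
move: h0; rewrite le_eqVlt => /orP[/eqP tw|tw].
  by rewrite -tw ISBM_M_mass subrr normr0.
have h1 := below_at hX bt tw (ltW tw) (lexx _).
have h2 := below_at hX bt tw (lexx 0) (ltW tw).
have h3 := mass_ge0 X (tau w) w; have h4 := mass_ge0 X 0 w.
by rewrite ISBM_M_mass ler_norml; apply/andP; split; move: h1 h2 h3 h4; lra.
Qed.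

Lemma bstop_L1 : L1 tau.
Proof.
have [rt _] := rs.
apply: (L1_bounded P (K := t)); last by move=> w; have /andP[h1 h2] := rt w; rewrite ger0_norm.
exact: measurable_wrt_fun (uc_measurable hF t0) (bstop_wrt hF t0 rs).
Qed.

(** Before [tau] the bracket grows at speed at least [kappa], at almost every time
    because [X] is then atomless.  Hence
    [kappa E tau <= E A_tau = E M_tau^2 <= b^2], uniformly in the horizon. *)
Lemma expected_time a kappa : 0 < kappa ->
  (forall m : finmeas R, (forall x : R, m [set x] = 0%E) ->
    a <= fine (m setT) -> fine (m setT) <= b -> kappa <= mint m (brate sigma m (cst 1))) ->
  (forall w s, 0 <= s -> s < tau w -> a <= Y s w) ->
  kappa * E tau <= b ^+ 2.
Proof.
move=> kappa0 hk at_.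
have [S S0 hS] := sigma_sup sigma_bounded b.
have iM2 := L1_ISBM_M2_tau hF hX cst1_C2 cst1c cst1n (lexx 0) cst1_eigen b0 t0 rs bt.
have iA := L1_ISBM_QV_tau hF sigma_ge0 hX cst1_C2 cst1n b0 t0 S0 hS rs bt.
rewrite -EZ; last exact: bstop_L1.
apply: (@le_trans _ _ (E (fun w => A (tau w) w))); last first.
  rewrite -(E_ISBM_M2_tau hF sigma_ge0 hX cst1_C2 cst1c cst1n (lexx 0) cst1_eigen b0 t0 S0 hS rs bt).
  rewrite -[leRHS](E_prob_cst P); apply: E_le => //; first exact: L1_cst.
  move=> w; rewrite -real_normK ?num_real// ler_pXn2r ?nnegrE//; exact: ISBM_M_le.
apply: E_le_ae; [by apply: L1Z; exact: bstop_L1|exact: iA|].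
have := ae_atomless; apply: filterS => w [N [mN N0 sN]].
have /andP[h0 _] := (proj1 rs) w.
have /andP[A00 _] := ISBM_QV_bound sigma_ge0 hX cst1_C2 cst1n b0 t0 S0 hS rs bt h0 (lexx (tau w)).
move: h0; rewrite le_eqVlt => /orP[/eqP tw|tw].
  by apply: le_trans A00; rewrite -tw mulr0.
have [AE _] := EFin_ISBM_QV sigma_ge0 hX cst1n b0 t0 S0 hS rs bt tw (ltW tw) (lexx _).
rewrite -lee_fin AE.
have mJ : measurable (`[0, tau w[%classic : set (measurableTypeR R)) by exact: measurable_itv.
have iJ : leb.-integrable `[0, tau w[ (EFin \o (fun=> kappa)).
  have int : leb.-integrable `[0, tau w] (EFin \o (fun=> kappa)).
    apply: continuous_compact_integrable; first exact: segment_compact.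
    by apply: continuous_subspaceT => s; exact: cvg_cst.
  apply: (integrableS _ _ _ int) => //.
  by move=> s /=; rewrite !in_itv/= => /andP[-> /ltW ->].
have <- : (\int[leb]_(s in `[0%R, tau w[) kappa%:E = (kappa * tau w)%:E)%E.
  rewrite integral_cst//= lebesgue_measure_itv /= lte_fin tw.
  by rewrite -EFinB subr0 -EFinM.
(* Discard the null set of times at which X has an atom. *)
rewrite (negligible_integral mN mJ iJ N0) integral_mkcond [leRHS]integral_mkcond.
apply: le_lower_integral => s _; rewrite !patchE.
  by case: ifP => // _; rewrite lee_fin ltW.
case: ifPn => [|_]; last first.
  case: ifP => // _; rewrite lee_fin; apply: Rintegral_ge0 => x _; exact: brate_ge0.
rewrite inE => -[/=]; rewrite in_itv/= => /andP[s0 st] nN.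
rewrite mem_set; last by rewrite /= in_itv/= s0 ltW.
rewrite lee_fin; apply: hk.
- move=> x; have : (fun s : R => 0 <= s -> s < tau w -> forall x : R, X s w [set x] = 0%E) s.
    by apply: contrapT => h; apply: nN; apply: sN.
  exact.
- by rewrite -mint_cst1; exact: at_.
- by rewrite -mint_cst1; exact: bt.
Qed.

End atomless.

Section start.
Variable y0 : R.
Hypothesis hY0 : {ae P, forall w, Y 0 w = y0}.

Let nY s w : R := - Y s w.

Let anY : adapted F nY.
Proof.
move=> s s0; suff : measurable_wrt (F s) (nY s) by exact.
by apply: measurable_wrtN (uc_sigma_algebra hF s0) _ _; exact: aY.
Qed.

Let cnY : cpaths nY.
Proof. by move=> w s; apply: cvgN; exact: cY. Qed.

Definition high b t : set Omega := [set w | reaches Y b t w].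
(** The mass reaches the half-line below [a] when its opposite reaches [- a]. *)
Definition low a t : set Omega := [set w | reaches nY (- a) t w].

Let mhigh b t : 0 <= t -> measurable (high b t).
Proof. by move=> t0; exact: (uc_measurable hF t0 (reaches_measurable hF b t0 (@aY) (@cY))). Qed.

Let mlow a t : 0 <= t -> measurable (low a t).
Proof. by move=> t0; exact: (uc_measurable hF t0 (reaches_measurable hF (- a) t0 (@anY) (@cnY))). Qed.

(** Doob's maximal inequality: the mass stopped at its hitting time of [b] has
    expectation [y0] and is at least [b] on the event. *)
Lemma high_bound b t : 0 < b -> 0 <= t -> b * E (\1_(high b t)) <= y0.
Proof.
move=> b0 t0; have rs := bstop_hit hF b t0 (@aY) (@cY); have bt := @below_hit b t t0.
have iM := L1_ISBM_M (ltW b0) t0 rs bt.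
have EM := E_ISBM_M (ltW b0) t0 rs bt.
rewrite -EZ; last by apply: L1_indic; exact: mhigh.
have -> : y0 = E (fun w => y0 + ISBM_M X (cst 1) (hit Y b t w) w).
  by rewrite ED//; [rewrite EM addr0 E_prob_cst|exact: L1_cst].
apply: E_le_ae.
- by apply: L1Z; apply: L1_indic; exact: mhigh.
- by apply: L1D => //; exact: L1_cst.
- apply: filterS hY0 => w hw; rewrite ISBM_M_mass hw addrC subrK indicE.
  case: (boolP (w \in _)); rewrite ?mulr1 ?mulr0 => h; last exact: mass_ge0.
  by apply: hit_at => //; move: h; rewrite inE.
Qed.

(** On the event the exit time from the band between [a] and [b] equals the
    horizon [t]; combine [expected_time] with Markov's inequality. *)
Lemma exit_bound a b t kappa : 0 < b -> 0 <= t -> 0 < kappa ->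
  (forall m : finmeas R, (forall x : R, m [set x] = 0%E) ->
    a <= fine (m setT) -> fine (m setT) <= b -> kappa <= mint m (brate sigma m (cst 1))) ->
  kappa * (t * E (\1_(~` low a t `&` ~` high b t))) <= b ^+ 2.
Proof.
move=> b0 t0 kappa0 hk.
pose tau w := Num.min (hit nY (- a) t w) (hit Y b t w).
have rs : bstop F t tau.
  by apply: bstopW (bstop_min hF (bstop_hit hF _ t0 (@anY) (@cnY)) (bstop_hit hF _ t0 (@aY) (@cY))); rewrite ge_min lexx.
have bt : below X b tau by apply: below_min; exact: below_hit.
have iT := bstop_L1 t0 rs.
apply: le_trans (expected_time (ltW b0) t0 rs bt kappa0 hk _); last first.
  move=> w s s0; rewrite lt_min => /andP[h _].
  by have := hit_lt t0 s0 h; rewrite /nY ltrN2 => /ltW.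
have mB : measurable (~` low a t `&` ~` high b t).
  by apply: measurableI; apply: measurableC; [exact: mlow|exact: mhigh].
apply: ler_wpM2l; first exact: ltW.
rewrite -EZ; last exact: L1_indic.
apply: E_le => //; first by apply: L1Z; exact: L1_indic.
move=> w; rewrite indicE; case: (boolP (w \in _)); rewrite ?mulr0 ?mulr1; last first.
  by move=> _; have /andP[] := (proj1 rs) w.
rewrite inE => -[nl nh]; rewrite /tau le_min; apply/andP; split.
  by rewrite leNgt; apply/negP => h; apply: nl; exact: hit_lt_reaches h.
by rewrite leNgt; apply/negP => h; apply: nh; exact: hit_lt_reaches h.
Qed.

Let y00 : 0 <= y0.
Proof.
by have := high_bound ltr01 (lexx 0); apply: le_trans; rewrite mul1r; apply: E_ge0 => w; rewrite indicE.
Qed.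

Definition never_low a : set Omega := \bigcap_(n : nat) ~` low a n%:R.

(** A mass that stays above [a] up to time [n] either reaches [b], which is
    unlikely for [b] large by [high_bound], or stays in the band up to time [n],
    which is unlikely for [n] large by [exit_bound]. *)
Lemma never_low0 a : 0 < a -> measurable (never_low a) /\ P (never_low a) = 0%E.
Proof.
move=> a0.
have mN : measurable (never_low a).
  by apply: bigcapT_measurable => n; apply: measurableC; exact: mlow.
split => //; rewrite -E_indic//; congr (_%:E).
set p := E _; have p0 : 0 <= p by apply: E_ge0 => w; rewrite indicE.
apply/eqP; rewrite eq_le p0 andbT leNgt; apply/negP => pp.
(* The level b makes reaching b less likely than p / 4; then n is chosen so
   large that staying in the band until n is less likely than p / 4. *)
pose b := 4 * (y0 + 1) / p.
have b0 : 0 < b by rewrite divr_gt0// mulr_gt0// ltr_wpDl.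
have [kappa kappa0 hk] := brate_lower_bound sigma_ge0 sigma_borel sigma_bounded sigma_zeros b a0.
pose q := 4 * b ^+ 2 / (kappa * p).
pose n := (Num.bound q).+1.
have n0 : 0 < n%:R :> R by rewrite ltr0n.
have qn : q < n%:R by apply: (lt_trans (ltr_bound q)); rewrite ltr_nat.
have H1 := high_bound b0 (ltW n0).
have H2 := exit_bound b0 (ltW n0) kappa0 hk.
have mB : measurable (~` low a n%:R `&` ~` high b n%:R).
  by apply: measurableI; apply: measurableC; [exact: mlow|exact: mhigh].
have mH : measurable (high b n%:R) by exact: mhigh.
have H3 : p <= E (\1_(~` low a n%:R `&` ~` high b n%:R)) + E (\1_(high b n%:R)).
  rewrite -ED; [|exact: L1_indic|exact: L1_indic].
  apply: E_le; [exact: L1_indic|by apply: L1D; exact: L1_indic|] => w.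
  rewrite !indicE; have [h|h] := pselect (never_low a w); last first.
    by rewrite memNset//= addr_ge0.
  rewrite [w \in never_low a]mem_set//=.
  have [hh|hh] := pselect (high b n%:R w).
    by rewrite [w \in high _ _]mem_set// lerDr.
  rewrite [w \in _ `&` _]mem_set ?lerDl//.
  by split=> //; exact: h.
set u := E _ in H2 H3; set v := E _ in H1 H3.
have v4 : v <= p / 4.
  rewrite -(ler_pM2l b0); apply: (le_trans H1).
  have -> : b * (p / 4) = y0 + 1 by rewrite /b; field; rewrite gt_eqF.
  by rewrite lerDl.
have u4 : u <= p / 4.
  have kn : 0 < kappa * n%:R by rewrite mulr_gt0.
  have Hq : 4 * b ^+ 2 <= n%:R * (kappa * p).
    by rewrite -ler_pdivrMr ?mulr_gt0// ltW.
  rewrite -(ler_pM2l kn) -mulrA; apply: (le_trans H2).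
  have -> : kappa * n%:R * (p / 4) = n%:R * (kappa * p) / 4 by rewrite !mulrA [_ * kappa]mulrC.
  by rewrite ler_pdivlMr// mulrC.
by move: H3 v4 u4 pp; lra.
Qed.

Section rebound.
Variables (a eps : R).
Hypotheses (a0 : 0 < a) (aeps : a < eps).

(** The gain in mass since it was first at most [a], and zero until then. *)
Definition rise t s w : R := Y s w - Y (Num.min s (hit nY (- a) t w)) w.
Definition rebound t : set Omega := [set w | reaches (rise t) (eps - a) t w].

Let rho_bstop t : 0 <= t -> bstop F t (hit nY (- a) t).
Proof. by move=> t0; exact: (bstop_hit hF (- a) t0 (@anY) (@cnY)). Qed.

Let rise_adapted t : 0 <= t -> adapted F (rise t).
Proof.
move=> t0 s s0; suff : measurable_wrt (F s) (rise t s) by exact.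
apply: (measurable_wrtB (uc_sigma_algebra hF s0)); first exact: aY.
exact: (stopped_min_adapted hF (rho_bstop t0) (@aY) (@cY)).
Qed.

Let rise_cpaths t : 0 <= t -> cpaths (rise t).
Proof.
move=> t0 w s; apply: cvgB; first exact: cY.
exact: (stopped_min_cpaths (rho_bstop t0) (@cY)).
Qed.

Lemma rebound_measurable t : 0 <= t -> measurable (rebound t).
Proof.
move=> t0; apply: (uc_measurable hF t0).
exact: (reaches_measurable hF (eps - a) t0 (rise_adapted t0) (rise_cpaths t0)).
Qed.

(** Compare the time [tau1] of first being at most [a] with the time [tau2] of the
    rebound, both cut at the hitting time of [b] to keep the mass bounded.  The
    expected masses at the two times agree.  On the event the gain is at least
    [eps - a]; otherwise it is at least [- a], because the mass at [tau1] is at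
    most [a] and the mass at [tau2] is nonnegative, or because the two times
    coincide. *)
Lemma rebound_bound b t : 0 < b -> 0 <= t ->
  eps * E (\1_(rebound t `&` ~` high b t)) <= a.
Proof.
move=> b0 t0.
pose rho := hit nY (- a) t.
pose rho' := hit (rise t) (eps - a) t.
pose tau1 w := Num.min (rho w) (hit Y b t w).
pose tau2 w := Num.min (rho' w) (hit Y b t w).
have rsY := bstop_hit hF b t0 (@aY) (@cY).
have rs1 : bstop F t tau1.
  by apply: bstopW (bstop_min hF (rho_bstop t0) rsY); rewrite ge_min lexx.
have rs2 : bstop F t tau2.
  have r' := bstop_hit hF (eps - a) t0 (rise_adapted t0) (rise_cpaths t0).
  by apply: bstopW (bstop_min hF r' rsY); rewrite ge_min lexx.
have bt1 : below X b tau1 by apply: below_min; exact: below_hit.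
have bt2 : below X b tau2 by apply: below_min; exact: below_hit.
have i1 := L1_ISBM_M (ltW b0) t0 rs1 bt1; have i2 := L1_ISBM_M (ltW b0) t0 rs2 bt2.
have E1 := E_ISBM_M (ltW b0) t0 rs1 bt1; have E2 := E_ISBM_M (ltW b0) t0 rs2 bt2.
have mB : measurable (rebound t `&` ~` high b t).
  by apply: measurableI; [exact: rebound_measurable|apply: measurableC; exact: mhigh].
have : E (fun w => eps * \1_(rebound t `&` ~` high b t) w - a) <= 
    E (fun w => ISBM_M X (cst 1) (tau2 w) w - ISBM_M X (cst 1) (tau1 w) w).
  apply: E_le => [||w].
  - by apply: L1B; [apply: L1Z; exact: L1_indic|exact: L1_cst].
  - exact: L1B.
  rewrite !ISBM_M_mass opprB addrA subrK.
  have /andP[r0 rt] := (proj1 (rho_bstop t0)) w; rewrite -/rho in r0 rt.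
  have /andP[r'0 r't] := hit_itv (rise t) (eps - a) w t0; rewrite -/rho' in r'0 r't.
  have /andP[h0 ht] := (proj1 rsY) w.
  have ea : 0 < eps - a by rewrite subr_gt0.
  (* A rebound takes place strictly after the mass was low, since the rise is zero
     before. *)
  have rebE : rebound t w -> rho w < rho' w /\ eps - a <= Y (rho' w) w - Y (rho w) w.
    move=> rb; have hh := hit_at t0 (rise_cpaths t0) rb; rewrite -/rho' /rise -/rho in hh.
    have [lt|le] := ltP (rho w) (rho' w).
      by rewrite (min_idPr (ltW lt)) in hh.
    by move: hh; rewrite (min_idPl le) subrr leNgt ea.
  have rr : rho w <= rho' w.
    have [lt|le] := ltP (rho' w) t; last exact: le_trans rt le.
    by have [/ltW] := rebE (hit_lt_reaches t0 lt).
  (* If the level b comes first, both times are cut there and nothing is gained. *)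
  have [hr|rh] := leP (hit Y b t w) (rho w).
    rewrite /tau1 /tau2 (min_idPr hr) (min_idPr (le_trans hr rr)) subrr.
    rewrite indicE memNset ?mulr0 ?sub0r ?oppr_le0 ?(ltW a0)//.
    move=> [rb nh]; have [lt _] := rebE rb.
    apply: nh; apply: (hit_lt_reaches t0).
    by apply: (le_lt_trans hr); exact: lt_le_trans lt r't.
  have Yr : Y (rho w) w <= a.
    have lo : reaches nY (- a) t w by apply: (hit_lt_reaches t0); exact: lt_le_trans rh ht.
    by have := hit_at t0 (@cnY) lo; rewrite /nY lerN2.
  rewrite /tau1 (min_idPl (ltW rh)) indicE.
  case: (boolP (w \in _)); rewrite ?mulr0 ?mulr1; last first.
    by move=> _; apply: lerB => //; exact: mass_ge0.
  rewrite inE => -[rb nh]; have [_ h] := rebE rb.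
  rewrite /tau2 (min_idPl _)//; rewrite (le_trans r't)// leNgt; apply/negP => lt.
  by apply: nh; exact: hit_lt_reaches lt.
rewrite (EB (L1Z eps (L1_indic P mB)) (L1_cst P a)) (EB i2 i1) E1 E2 subrr E_prob_cst.
by rewrite (EZ eps (L1_indic P mB)) subr_le0.
Qed.

(** Let [b] tend to infinity in [rebound_bound]. *)
Lemma rebound_prob t : 0 <= t -> eps * E (\1_(rebound t)) <= a.
Proof.
move=> t0; have e0 : 0 < eps := lt_trans a0 aeps.
apply/ler_addgt0Pr => e ep.
(* For this level, reaching b has probability at most e / eps. *)
pose b := eps * (y0 + 1) / e.
have b0 : 0 < b by rewrite divr_gt0// mulr_gt0// ltr_wpDl.
have mH : measurable (high b t) by exact: mhigh.
have mR := rebound_measurable t0.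
have mB : measurable (rebound t `&` ~` high b t).
  by apply: measurableI => //; exact: measurableC.
have H1 := high_bound b0 t0.
have H2 := rebound_bound b0 t0.
have H3 : E (\1_(rebound t)) <= E (\1_(rebound t `&` ~` high b t)) + E (\1_(high b t)).
  rewrite -ED; [|exact: L1_indic|exact: L1_indic].
  apply: E_le; [exact: L1_indic|by apply: L1D; exact: L1_indic|] => w.
  rewrite !indicE; have [h|h] := pselect (rebound t w); last first.
    by rewrite memNset//= addr_ge0.
  rewrite [w \in rebound t]mem_set//=.
  have [hh|hh] := pselect (high b t w).
    by rewrite [w \in high _ _]mem_set// lerDr.
  by rewrite [w \in _ `&` _]mem_set ?lerDl.
have H4 : eps * E (\1_(high b t)) <= e.
  have : eps * (b * E (\1_(high b t))) <= eps * (y0 + 1).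
    by rewrite ler_pM2l//; apply: (le_trans H1); rewrite lerDl.
  rewrite mulrCA {1}/b; set v := eps * E _.
  have -> : eps * (y0 + 1) / e * v = eps * (y0 + 1) * (v / e) by rewrite mulrAC mulrA.
  rewrite -[leRHS]mulr1 ler_pM2l; last by rewrite mulr_gt0// ltr_wpDl.
  by rewrite ler_pdivrMr// mul1r.
apply: (@le_trans _ _ (eps * (E (\1_(rebound t `&` ~` high b t)) + E (\1_(high b t))))).
  by rewrite ler_pM2l.
by rewrite mulrDr; exact: lerD.
Qed.

Lemma rebound_intro t s1 s2 w : 0 <= s1 -> s1 <= s2 -> s2 <= t ->
  Y s1 w <= a -> eps <= Y s2 w -> rebound t w.
Proof.
move=> s10 s12 s2t Y1 Y2; have t0 : 0 <= t := le_trans s10 (le_trans s12 s2t).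
have lo : reaches nY (- a) t w.
  by exists s1; split=> //; [exact: le_trans s12 s2t|rewrite lerN2].
have h1 : hit nY (- a) t w <= s1.
  by apply: hit_le => //; [exact: le_trans s12 s2t|rewrite lerN2].
exists s2; split=> //; first exact: le_trans s10 s12.
rewrite /rise (min_idPr (le_trans h1 s12)); apply: lerB => //.
by have := hit_at t0 (@cnY) lo; rewrite /nY lerN2.
Qed.

(** The lower limit of the rebound events along integer horizons: rebounds that
    happen at some time are seen by all later horizons. *)
Definition eventual_rebound : set Omega := \bigcup_(N : nat) \bigcap_(n : nat) rebound (N + n)%:R.

Lemma eventual_rebound_prob : measurable eventual_rebound /\ (P eventual_rebound <= (a / eps)%:E)%E.
Proof.
pose G N := \bigcap_(n : nat) rebound (N + n)%:R.
have mG N : measurable (G N).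
  by apply: bigcapT_measurable => n; exact: rebound_measurable.
have mE : measurable eventual_rebound by exact: bigcupT_measurable.
split=> //.
have cv : P (G n) @[n --> \oo] --> P (\bigcup_n G n).
  apply: nondecreasing_cvg_mu => // i j ij; apply/subsetPset => w Gw n _.
  by have := Gw (j - i + n)%N I; rewrite /= addnA subnKC.
apply: (cvge_to_le cv); apply: nearW => n.
have e0 : 0 < eps := lt_trans a0 aeps.
have mR : measurable (rebound n%:R) by exact: rebound_measurable.
apply: (@le_trans _ _ (P (rebound n%:R))).
  by apply: le_measure; rewrite ?inE// => w /(_ 0%N I); rewrite /= addn0.
by rewrite -E_indic// lee_fin ler_pdivlMr// mulrC rebound_prob.
Qed.

End rebound.

(** The mass almost surely comes below every level.  If moreover it did not
    eventually stay below [1/(j+1)], it would rebound to this level from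
    [1/(k+1)] for every [k > j], an event of probability at most
    [(j+1)/(k+1)] for every such [k], hence null. *)
Lemma mass_vanishes : {ae P, forall w, Y t w @[t --> +oo] --> 0} /\
  {ae P, forall w, forall a, 0 < a -> exists2 s, 0 <= s & Y s w <= a}.
Proof.
have inv0 (k : nat) : 0 < k.+1%:R^-1 :> R by [].
have nb : P.-negligible (\bigcup_k never_low k.+1%:R^-1).
  apply: negligible_bigcup => k; have [mN N0] := never_low0 (inv0 k).
  by exists (never_low k.+1%:R^-1); split.
have low_ae : {ae P, forall w, forall a, 0 < a -> exists2 s, 0 <= s & Y s w <= a}.
  apply: negligibleS nb => w /= nw.
  have [a a0 na] : exists2 a, 0 < a & forall s, 0 <= s -> a < Y s w.
    apply: contrapT => h; apply: nw => a a0; apply: contrapT => h2; apply: h.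
    by exists a => // s s0; rewrite ltNge; apply/negP => Ys; apply: h2; exists s.
  have [k _ hk] := near_harmonic_lt a0.
  exists k => // n _ /= [s [s0 sn]]; rewrite lerN2 => Ys.
  have := lt_trans (hk k (leqnn k)) (na s s0).
  by rewrite ltNge Ys.
split=> //.
pose Bad (j : nat) := \bigcap_(k in [set k | (j < k)%N]) eventual_rebound k.+1%:R^-1 j.+1%:R^-1.
have Badn j : P.-negligible (Bad j).
  pose B := \bigcap_(n : nat) eventual_rebound (j.+1 + n).+1%:R^-1 j.+1%:R^-1.
  have lt_inv n : (j.+1 + n).+1%:R^-1 < j.+1%:R^-1 :> R.
    by rewrite ltf_pV2 ?posrE// ltr_nat ltnS ltn_addr.
  have H n := eventual_rebound_prob (inv0 (j.+1 + n)%N) (lt_inv n).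
  have mB : measurable B by apply: bigcapT_measurable => n; have [] := H n.
  exists B; split=> //; last first.
    by move=> w bw n _; apply: bw; rewrite /= ltn_addr.
  apply/eqP; rewrite eq_le measure_ge0 andbT.
  apply/lee_addgt0Pr => e e0; rewrite add0e.
  have e1 : 0 < e * j.+1%:R^-1 by rewrite mulr_gt0.
  have [n _ hn] := near_harmonic_lt e1.
  have [mE PE] := H n.
  apply: (@le_trans _ _ (P (eventual_rebound (j.+1 + n).+1%:R^-1 j.+1%:R^-1))).
    by apply: le_measure; rewrite ?inE// => w; exact.
  apply: (le_trans PE); rewrite lee_fin ler_pdivrMr// ltW//.
  have := hn (j.+1 + n)%N; apply; exact: leq_addl.
have nBad : P.-negligible (\bigcup_j Bad j) by exact: negligible_bigcup.
have nBae : {ae P, forall w, ~ (\bigcup_j Bad j) w}.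
  by apply: negligibleS nBad => w /= /contrapT.
apply: filterS2 low_ae nBae => w lw nB; apply/cvgrPdist_lt => e e0.
have [j _ hj] := near_harmonic_lt e0.
have [T hT] : exists T : R, forall s, T < s -> Y s w < j.+1%:R^-1.
  apply: contrapT => nT; apply: nB; exists j => // k /= jk.
  have [s1 s10 Y1] := lw _ (inv0 k).
  have [s2 s12 Y2] : exists2 s2, s1 < s2 & j.+1%:R^-1 <= Y s2 w.
    apply: contrapT => h; apply: nT; exists s1 => s s1s; rewrite ltNge; apply/negP => Ys.
    by apply: h; exists s.
  exists (Num.bound s2) => // n _ /=.
  apply: (rebound_intro s10 (ltW s12) _ Y1 Y2).
  by rewrite ltW// (lt_le_trans (ltr_bound s2))// ler_nat leq_addr.
exists T; split; first exact: num_real.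
move=> s Ts; rewrite sub0r normrN ger0_norm ?mass_ge0//.
by apply: lt_trans (hT s Ts) _; exact: hj (leqnn j).
Qed.

End start.

End extinction.

(** By continuity the mass, which starts above [a] and comes below it, passes
    through [a].  The event of hitting [a] contains an almost sure event, so
    completeness makes it measurable. *)
Theorem theorem3p4 (R : realType) (d : measure_display)
    (Omega : measurableType d) (P : probability Omega R)
    (F : R -> set (set Omega)) (hF : usual_conditions P F)
    (sigma : R -> R)
    (sigma_ge0 : forall u : R, 0 <= u -> 0 <= sigma u)
    (sigma_borel : measurable_fun (`[0, +oo[ : set R) sigma)
    (sigma_bounded :
      forall n : nat, (1 <= n)%N -> [bounded sigma u | u in `[0, n%:R]])
    (sigma_zeros :
      lebesgue_measure [set u : R | 0 <= u /\ sigma u = 0] = 0%E)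
    (mu : finmeas R) (mu_gt0 : 0 < mint mu (cst 1))
    (X : R -> Omega -> finmeas R) (hX : interacting_SBM P F sigma X)
    (hX0 : {ae P, forall w,
       forall A : set (measurableTypeR R), measurable A -> X 0 w A = mu A}) :
  (forall a : R, 0 < a -> a < mint mu (cst 1) ->
     P [set w | (mass_hitting_time X a w < +oo)%E] = 1%E) /\
  {ae P, forall w, mint (X t w) (cst 1) @[t --> +oo] --> 0}.
Proof.
have hY0 : {ae P, forall w, mass X 0 w = mint mu (cst 1)}.
  apply: filterS hX0 => w Xmu.
  by rewrite /mass /obs !mint_cst1 (Xmu setT measurableT).
have [mass0 mass_low] :=
  mass_vanishes hF sigma_ge0 sigma_borel sigma_bounded sigma_zeros hX hY0.
split=> // a a0 amu.
have hit_ae : {ae P, forall w, (mass_hitting_time X a w < +oo)%E}.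
  apply: filterS2 hY0 mass_low => w Y0 low_w.
  have [s s0 Ys] := low_w a a0.
  have [||c] := @IVT R (fun u => mass X (Num.max u 0) w) 0 s a s0.
  - by apply: continuous_subspaceT; exact: mass_cpaths hX w.
  - rewrite maxxx (max_idPl s0) Y0 ge_min Ys orbT /= le_max.
    by rewrite (ltW amu).
  rewrite in_itv/= => /andP[c0 _]; rewrite (max_idPl c0) => Yc.
  apply: (@le_lt_trans _ _ c%:E); last by rewrite ltry.
  by apply: ereal_inf_lbound; exists c.
have mT : measurable (~` [set w | (mass_hitting_time X a w < +oo)%E]).
  by apply: (uc_complete hF); exact: hit_ae.
have PT : P (~` [set w | (mass_hitting_time X a w < +oo)%E]) = 0%E.
  exact: measure_negligible mT hit_ae.
have mT' : measurable [set w | (mass_hitting_time X a w < +oo)%E].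
  by rewrite -[X in measurable X]setCK; exact: measurableC.
by rewrite -[X in P X]setCK probability_setC// PT sube0.
Qed.
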